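(* Let $0<\alpha<2$, $p>1$, let $d\ge 2$ be an integer, and let $0<\tau<1+\alpha$. Then there exists a positive constant $C'_{d,\alpha,p,\tau}$ (depending only on $d,\alpha,p,\tau$) such that for all $u\in C_c(\mathbb{R}^d_+)$ if $\alpha\ge 1$, or for all $u\in C_c(\overline{\mathbb{R}^d_+})$ if $\alpha<1$, $$\int_{\mathbb{R}^d_+}\int_{\mathbb{R}^d_+}\frac{\left(u(x)-u(y)\right)\left(u(x)^{\langle p-1\rangle}-u(y)^{\langle p-1\rangle}\right)}{|x-y|^{d+\alpha}}\,dy\,dx\ \ge\ \mathcal{D}'_{d,\alpha,p}\int_{\mathbb{R}^d_+}\frac{|u(x)|^p}{x_d^{\alpha}}\,dx+C'_{d,\alpha,p,\tau}\int_{\mathbb{R}^d_+}\frac{|u(x)|^p}{x_d^{\alpha-\tau}\left(x_{d-1}^2+x_d^2\right)^{\tau/2}}\,dx,$$ where $$\mathcal{D}'_{d,\alpha,p}=-\frac{2\pi^{\frac{d-1}{2}}\Gamma\left(\frac{1+\alpha}{2}\right)}{\Gamma\left(\frac{d+\alpha}{2}\right)}\left[\mathrm{B}\left(\tfrac{\alpha-1}{p}+1,-\alpha\right)+\mathrm{B}\left(\alpha-\tfrac{\alpha-1}{p},-\alpha\right)+\frac{1}{\alpha}\right].$$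
   Context: $\mathbb{R}^d_+=\{x=(x_1,\dots,x_d)\in\mathbb{R}^d: x_d>0\}$ and $\overline{\mathbb{R}^d_+}$ is its closure. $C_c(\Omega)$ denotes the real-valued continuous functions with compact support contained in $\Omega$; functions in $C_c(\overline{\mathbb{R}^d_+})$ need not vanish on $\{x_d=0\}$. The left-hand side (whose integrand is nonnegative) may be $+\infty$. For $a\in\mathbb{R}$ and $t>0$, $a^{\langle t\rangle}:=|a|^t\,\mathrm{sgn}(a)$. $\Gamma$ is the Euler Gamma function and $\mathrm{B}(a,b)=\Gamma(a)\Gamma(b)/\Gamma(a+b)$ is the Euler Beta function, extended to negative arguments by this formula. For $\alpha=1$ the expression in the square bracket is understood by its continuous extension, and $\mathcal{D}'_{d,1,p}=0$. (The constant $\mathcal{D}'_{d,\alpha,p}$ is the sharp constant in the Hardy inequality for the Sobolev--Bregman form on the half-space.) *)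

(* Defs.v *)
From HB Require Import structures.
From mathcomp Require Import all_boot all_order all_algebra.
From mathcomp Require Import all_classical all_reals all_analysis.

Set Implicit Arguments.
Unset Strict Implicit.
Unset Printing Implicit Defensive.

Import Order.TTheory GRing.Theory Num.Theory.
Import numFieldNormedType.Exports.

Local Open Scope classical_set_scope.
Local Open Scope ring_scope.

Definition rV_display : measure_display -> measure_display.
Proof. exact. Qed.

Definition rV_coord (T : Type) (n : nat) (i : 'I_n) (x : 'rV[T]_n) : T :=
  x ord0 i.

(* Product sigma-algebra, the same construction as the one of the library on
   n.-tuple T; for T = R it is the Borel sigma-algebra of R^n. *)
Section rV_measurable.
Context d (T : sigmaRingType d) (n : nat).

Let G := g_sigma_preimage (@rV_coord T n).

Let rV_set0 : G set0. Proof. exact: sigma_algebra0. Qed.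

Let rV_setC A : G A -> G (~` A). Proof. exact: sigma_algebraC. Qed.

Let rV_bigcup (F : (set 'rV[T]_n)^nat) :
  (forall i, G (F i)) -> G (\bigcup_i (F i)).
Proof. exact: sigma_algebra_bigcup. Qed.

HB.instance Definition _ := @isMeasurable.Build (rV_display d)
  'rV[T]_n G rV_set0 rV_setC rV_bigcup.

End rV_measurable.

Lemma measurable_rV_coord d (T : sigmaRingType d) n (i : 'I_n) :
  measurable_fun [set: 'rV[T]_n] (rV_coord i).
Proof.
move=> _ Y mY; rewrite setTI; apply: sub_sigma_algebra => /=.
rewrite -bigcup_seq/=; exists i => /=; first by rewrite mem_index_enum.
by exists Y => //; rewrite setTI.
Qed.

Lemma measurable_fun_rVP d1 d2 (T1 : measurableType d1) (T2 : measurableType d2)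
    n (f : T1 -> 'rV[T2]_n) :
  measurable_fun [set: T1] f <->
  forall i, measurable_fun [set: T1] (rV_coord i \o f).
Proof.
split=> [mf i|mf].
  by apply: measurableT_comp => //; exact: measurable_rV_coord.
apply: (@measurability _ _ _ _ _ _
  (\big[setU/set0]_(i < n) preimage_set_system setT (@rV_coord T2 n i) measurable)) => //.
move=> _ [B + <-]; rewrite -bigcup_seq/= => -[i _ [A mA <-]].
by rewrite !setTI -comp_preimage -[X in measurable X]setTI; exact: mf.
Qed.

Section lebesgue_measure_rV.
Context {R : realType}.

Definition cons_rV n (p : measurableTypeR R * 'rV[R]_n) : 'rV[R]_n.+1 :=
  row_mx (p.1)%:M p.2.

Definition uncons_rV n (x : 'rV[R]_n.+1) : measurableTypeR R * 'rV[R]_n :=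
  (x ord0 ord0, \row_i x ord0 (lift ord0 i)).

Lemma cons_rV0 n p : rV_coord ord0 (@cons_rV n p) = p.1.
Proof.
rewrite /rV_coord /cons_rV (_ : ord0 = lshift n (ord0 : 'I_1)); last exact/val_inj.
by rewrite (@row_mxEl _ 1 1) mxE eqxx.
Qed.

Lemma cons_rVS n p (i : 'I_n) :
  rV_coord (lift ord0 i) (@cons_rV n p) = rV_coord i p.2.
Proof.
rewrite /rV_coord /cons_rV (_ : lift ord0 i = rshift 1 i); last exact/val_inj.
by rewrite (@row_mxEr _ 1 1).
Qed.

Lemma cons_rVK n : cancel (@cons_rV n) (@uncons_rV n).
Proof.
move=> [a v]; congr pair; first exact: cons_rV0.
by apply/rowP => i; rewrite mxE; exact: cons_rVS.
Qed.

Lemma uncons_rVK n : cancel (@uncons_rV n) (@cons_rV n).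
Proof.
move=> x; apply/rowP => i; case: (unliftP ord0 i) => [j ->|->].
  by rewrite [LHS]cons_rVS /rV_coord mxE.
exact: cons_rV0.
Qed.

Lemma measurable_cons_rV n : measurable_fun [set: _] (@cons_rV n).
Proof.
apply/measurable_fun_rVP => i; case: (unliftP ord0 i) => [j ->|->].
  rewrite (_ : _ \o _ = rV_coord j \o snd).
    exact: (measurableT_comp (measurable_rV_coord j) measurable_snd).
  by apply/funext => p /=; rewrite cons_rVS.
rewrite (_ : _ \o _ = fst); first exact: measurable_fst.
by apply/funext => p /=; rewrite cons_rV0.
Qed.

Lemma measurable_uncons_rV n : measurable_fun [set: _] (@uncons_rV n).
Proof.
apply/measurable_fun_pairP; split; first exact: (measurable_rV_coord ord0).
apply/measurable_fun_rVP => i.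
rewrite (_ : _ \o _ = rV_coord (lift ord0 i)); first exact: measurable_rV_coord.
by apply/funext => x /=; rewrite /rV_coord mxE.
Qed.

Section step.
Context n (mu : {sigma_finite_measure set 'rV[R]_n -> \bar R}).

Definition lebesgue_rV_step : set 'rV[R]_n.+1 -> \bar R :=
  pushforward (lebesgue_measure \x mu)%E (@cons_rV n).

Let step0 : lebesgue_rV_step set0 = 0%E.
Proof. by rewrite /lebesgue_rV_step /pushforward preimage_set0 measure0. Qed.

Let step_ge0 A : (0 <= lebesgue_rV_step A)%E.
Proof. by rewrite /lebesgue_rV_step /pushforward measure_ge0. Qed.

Let step_sigma_additive : semi_sigma_additive lebesgue_rV_step.
Proof.
have := @measure_semi_sigma_additive _ _ _
  (pushforward (lebesgue_measure \x mu)%E (@cons_rV n)).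
by apply; exact: measurable_cons_rV.
Qed.

HB.instance Definition _ := isMeasure.Build _ _ _ lebesgue_rV_step
  step0 step_ge0 step_sigma_additive.

Let step_sigma_finite : sigma_finite setT lebesgue_rV_step.
Proof.
have /sigma_finiteP[F [TF ndF Foo]] :=
  sigma_finiteT (@lebesgue_measure R : {sigma_finite_measure set _ -> \bar R}).
have /sigma_finiteP[G [TG ndG Goo]] := sigma_finiteT mu.
exists (fun k => @uncons_rV n @^-1` (F k `*` G k)).
  apply/esym; rewrite -subTset => x _.
  have [i _ Fi] : (\bigcup_i F i) (x ord0 ord0) by rewrite -TF.
  have [j _ Gj] : (\bigcup_j G j) (uncons_rV x).2 by rewrite -TG.
  exists (maxn i j) => //; split.
    by move: Fi; exact/subsetPset/ndF/leq_maxl.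
  by move: Gj; exact/subsetPset/ndG/leq_maxr.
move=> k; have [mF Fk] := Foo k; have [mG Gk] := Goo k; split.
  rewrite -[X in measurable X]setTI; apply: measurable_uncons_rV => //.
  exact: measurableX.
rewrite /lebesgue_rV_step /pushforward -comp_preimage.
rewrite (_ : _ \o _ = id) ?preimage_id; last exact/funext/cons_rVK.
by rewrite product_measure1E// lte_mul_pinfty// ge0_fin_numE.
Qed.

HB.instance Definition _ := Measure_isSigmaFinite.Build _ _ _ lebesgue_rV_step
  step_sigma_finite.

End step.

(* Lebesgue measure on R^n, as the n-fold product of lebesgue_measure transported
   along R * 'rV[R]_n ~ 'rV[R]_n.+1; R^0 carries the unit mass at its point. *)
Fixpoint lebesgue_rV n : {sigma_finite_measure set 'rV[R]_n -> \bar R} :=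
  match n with
  | 0 => \d_(0 : 'rV[R]_0)
  | m.+1 => lebesgue_rV_step (lebesgue_rV m)
  end.

Lemma measurable_rV_box n (A : 'I_n -> set R) : (forall i, measurable (A i)) ->
  measurable [set x : 'rV[R]_n | forall i, A i (x ord0 i)].
Proof.
move=> mA; rewrite (_ : [set _ | _] =
    \bigcap_(i in [set: 'I_n]) (@rV_coord R n i @^-1` A i)).
  apply: fin_bigcap_measurable => // i _; rewrite -[X in measurable X]setTI.
  exact: measurable_rV_coord.
by apply/seteqP; split => x /= Ax i => [_|]; exact: Ax.
Qed.

Lemma lebesgue_rV_box n (A : 'I_n -> set R) : (forall i, measurable (A i)) ->
  lebesgue_rV n [set x | forall i, A i (x ord0 i)] =
  (\prod_(i < n) lebesgue_measure (A i))%E.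
Proof.
elim: n A => [|n IH] A mA.
  by rewrite big_ord0 /= diracE mem_set// => -[].
rewrite big_ord_recl -IH// -product_measure1E//; last first.
- exact: (@measurable_rV_box n (fun i => A (lift ord0 i))).
- exact: mA.
rewrite /= /lebesgue_rV_step /pushforward; congr (_ _).
apply/seteqP; split => [p /= Ap|p /= [Ap0 Ap] i].
  split; first by rewrite -cons_rV0; exact: Ap.
  by move=> i; have := Ap (lift ord0 i); rewrite -/(rV_coord _ _) cons_rVS.
case: (unliftP ord0 i) => [j ->|->]; rewrite -/(rV_coord _ _).
  by rewrite cons_rVS; exact: Ap.
by rewrite cons_rV0.
Qed.

End lebesgue_measure_rV.

(* The norm of the library on 'rV[R]_n is the sup norm. *)
Definition enorm (R : realType) n (x : 'rV[R]_n) : R :=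
  Num.sqrt (\sum_(i < n) x ord0 i ^+ 2).

Definition halfspace (R : realType) n : set 'rV[R]_n.+1 :=
  [set x | 0 < x ord0 ord_max].

(* Only the restriction of u to Omega matters: u : Omega -> R is represented by
   an arbitrary extension to R^n. *)
Definition Cc (R : realType) n (Omega : set 'rV[R]_n) (u : 'rV[R]_n -> R) : Prop :=
  let supp := closure (Omega `&` [set x | u x != 0]) in
  [/\ {within Omega, continuous u}, compact supp & supp `<=` Omega].

Definition spow (R : realType) (a t : R) : R := `|a| `^ t * Num.sg a.

Section gamma_beta.
Context {R : realType}.

Definition Gamma_integral (z : R) : R :=
  \int[lebesgue_measure]_(t in `]0, +oo[) (t `^ (z - 1) * expR (- t)).

(* For z <= 0, z + k with k = truncn (- z) + 1 is the first positive element of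
   z, z + 1, ..., and Gamma z is given by iterating Gamma (z + 1) = z Gamma z.
   At the poles 0, -1, -2, ... this is a division by 0, so Gamma z = 0. *)
Definition Gamma (z : R) : R :=
  if 0 < z then Gamma_integral z else
  let k := (Num.truncn (- z)).+1 in
  Gamma_integral (z + k%:R) / \prod_(i < k) (z + i%:R).

Definition Beta (a b : R) : R := Gamma a * Gamma b / Gamma (a + b).

(* For 0 < alpha < 2 and 1 < p, no pole of Gamma is met unless alpha = 1.  There
   the expression extends continuously by 0: as alpha -> 1 the two Beta terms
   tend to 1/p - 1 and - 1/p. *)
Definition hardy_bracket (alpha p : R) : R :=
  if alpha == 1 then 0 else
  Beta ((alpha - 1) / p + 1) (- alpha) +
  Beta (alpha - (alpha - 1) / p) (- alpha) + alpha^-1.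

Definition hardy_const (d : nat) (alpha p : R) : R :=
  - (2 * pi `^ ((d%:R - 1) / 2) * Gamma ((1 + alpha) / 2)
     / Gamma ((d%:R + alpha) / 2)) * hardy_bracket alpha p.

End gamma_beta.

(* Main.v *)
(* Ground state substitution, with ground state x_d^g, g = (alpha - 1) / p.  For a
   pair x, y put t = y_d / x_d.  Young's inequality bounds |u(x)|^p + |u(y)|^p by the
   Bregman integrand plus |u(x)|^p w(t) + |u(y)|^p w(1/t), where w is [hardy_weight].
   Integrated against the kernel over the pairs whose ratio t lies in a set invariant
   under t -> 1/t and bounded away from 0, 1 and +oo, all terms are finite; the
   coordinates other than x_d integrate out to a Gamma quotient, and what is left is
   the integral of (1 - w(t)) |1 - t|^(-1-alpha), which tends to minus the bracket of
   Beta values when the set of ratios grows.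

   The remainder comes from the pairs with t in [lam, 2 lam].  There the two Young
   deficits add up to a Bregman form, so that a term eta |u(x)|^p D(x) can be added on
   the left at the cost of 2 eta |u(y)|^p t^(1-alpha) D(x) on the right, where
   D(x) = x_d^tau / (x_(d-1)^2 + x_d^2)^(tau/2).  Seen from y, the point x is close to
   the boundary, where D is small: because tau < 1 + alpha, for lam large the cost is
   at most half of the gain. *)

Require Import Defs.
From mathcomp Require Import all_boot all_order all_algebra.
From mathcomp Require Import all_classical all_reals all_analysis.
From mathcomp Require Import measurable_realfun ring lra.

Set Implicit Arguments.
Unset Strict Implicit.
Unset Printing Implicit Defensive.

Import Order.TTheory GRing.Theory Num.Theory.
Import numFieldNormedType.Exports.

Local Open Scope classical_set_scope.
Local Open Scope ring_scope.

(** The kernel [|1 - t|^(-1-alpha)] is not integrable at [t = 1], so the sharp constant can only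
    appear as the limit of a difference of two diverging integrals. Writing the two halves of the
    truncation as [t = 1 + s] and [t = 1 / (1 + s)] makes the cancellation explicit: the
    contributions of [1 - w] add up to the product [((1+s)^g - 1) ((1+s)^g' - 1)] with
    [g' = alpha - 1 - g]. It is [O(s^2)] at 0, hence integrable against [s^(-1-alpha)] because
    [alpha < 2]. Expanded, it gives four integrals of [(1+s)^c s^(-1-alpha)], each divergent. Two
    integrations by parts turn them into convergent Beta integrals with second argument [2 - alpha],
    and the functional equation of Gamma carries these back to [-alpha]. The exponent
    [c = alpha - 1] produces the term [1 / alpha]; [c = 0] produces boundary terms only. The ratios
    [[lam, 2 lam]] and the gain [eta] stay fixed while the truncation grows, so the remainder
    survives the limit. *)

Section one_variable.
Context {R : realType}.
Local Notation leb := (@lebesgue_measure R).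

Lemma integral_is_derive (F f : R -> R) (a b : R) : a < b ->
  (forall x, a <= x <= b -> is_derive x 1 F (f x)) ->
  (forall x, a <= x <= b -> {for x, continuous f}) ->
  (\int[leb]_(x in `[a, b]) (f x)%:E = (F b - F a)%:E)%E.
Proof.
move=> ab dF cf.
have cF x : a <= x <= b -> {for x, continuous F}.
  move=> xab; apply/differentiable_continuous/derivable1_diffP.
  by have [] := dF x xab.
rewrite (@continuous_FTC2 _ f F)//.
- apply: continuous_in_subspaceT => x; rewrite inE/= in_itv/=; exact: cf.
- split.
  + by move=> x; rewrite in_itv/= => /andP[ax xb]; have [] := dF x; rewrite ?ltW.
  + by apply: cvg_at_right_filter; apply: cF; rewrite lexx ltW.
  + by apply: cvg_at_left_filter; apply: cF; rewrite lexx ltW.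
- move=> x; rewrite in_itv/= => /andP[ax xb]; rewrite derive1E.
  have [|_ ->//] := dF x; by rewrite !ltW.
Qed.

(** Lebesgue measure is [c] times its image under [x |-> c x + b], since the two agree on half-open
    intervals. No continuity of [f] is asked, so integrands cut off by an indicator are covered. *)
Lemma ge0_integral_affine (c b : R) (f : R -> \bar R) : 0 < c ->
  measurable_fun [set: R] f -> (forall x, (0 <= f x)%E) ->
  (\int[leb]_x f x = c%:E * \int[leb]_x f (c * x + b)%R)%E.
Proof.
move=> c0 mf f0.
pose phi : measurableTypeR R -> measurableTypeR R := fun x => c * x + b.
have mphi : measurable_fun setT phi.
  by apply: measurable_funD => //; exact: measurable_funM.
pose m : {measure set (measurableTypeR R) -> \bar R} :=
  measure_function_pushforward__canonical__measure_function_Measure leb mphi.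
pose m' : {measure set (measurableTypeR R) -> \bar R} :=  mscale (NngNum (ltW c0)) m.
have E A : measurable A -> leb A = m' A.
  apply: lebesgue_measure_unique => _ [[u v]] _ <-.
  rewrite /m' /m/= /mscale /= /pushforward.
  rewrite (_ : _ @^-1` _ = `](u - b) / c, (v - b) / c]%classic); last first.
    apply/seteqP; split => x /=; rewrite !in_itv/= /phi ltr_pdivrMr// ler_pdivlMr//;
    by rewrite ltrBlDr lerBrDr (mulrC x).
  rewrite !lebesgue_measure_itv/= !lte_fin ltr_pM2r ?invr_gt0// ltrD2r.
  case: ifPn => uv; last by rewrite mule0.
  by rewrite -EFinM -EFinB; congr EFin; field; rewrite gt_eqF.
rewrite (@eq_measure_integral _ _ _ _ m'); last by move=> A mA _; exact: E.
rewrite ge0_integral_mscale//; congr (_ * _)%E.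
by rewrite ge0_integral_pushforward// preimage_setT.
Qed.

End one_variable.

(** * Exhaustion of the half-line and elementary integrals on it *)

Section half_line.
Context {R : realType}.
Local Notation leb := (@lebesgue_measure R).

Lemma gt0_powRD (x r s : R) : 0 < x -> x `^ (r + s) = x `^ r * x `^ s.
Proof. by move=> x0; rewrite powRD// (gt_eqF x0) implybT. Qed.

Lemma continuous_powR (a x : R) : 0 < x -> {for x, continuous (fun t : R => t `^ a)}.
Proof.
move=> x0; apply/differentiable_continuous/derivable1_diffP.
by apply: derivable_powR; rewrite in_itv/= x0.
Qed.

Lemma invr_powR_cvg0 (c : R) : 0 < c -> ((k.+1%:R : R)^-1 `^ c) @[k --> \oo] --> (0 : R).
Proof.
move=> c0; have /cvg_at_rightP := powR_cvg0 c0.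
apply; split => [n|]; last exact: cvg_harmonic.
by rewrite invr_gt0 ltr0n.
Qed.

(** Compact exhaustion of the open half-line, stable under inversion. For [k = 0] it degenerates to
    the point 1, whence the conditions [0 < k] in the identities below. *)
Definition expanding_itv (k : nat) : set R := `[k.+1%:R^-1, k.+1%:R]%classic.

Lemma bigcup_expanding_itv : `]0, +oo[%classic =
  \bigcup_(k in setT) expanding_itv k.
Proof.
apply/seteqP; split => [x|x [k _]] /=; rewrite /expanding_itv/= !in_itv/= ?andbT; last first.
  by move=> /andP[+ _]; apply: lt_le_trans; rewrite invr_gt0 ltr0n.
move=> x0; pose y := x + x^-1; have y0 : 0 <= y by rewrite addr_ge0// ltW// invr_gt0.
exists (Num.trunc y) => //=; rewrite in_itv/=.
have /andP[_ /ltW yt] := trunc_itv y0.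
apply/andP; split; last by rewrite (le_trans _ yt)// lerDl invr_ge0 ltW.
rewrite -[leRHS]invrK lef_pV2 ?posrE ?invr_gt0 ?ltr0n//.
by rewrite (le_trans _ yt)// lerDr ltW.
Qed.

Lemma nondecreasing_expanding_itv : nondecreasing_seq expanding_itv.
Proof.
move=> m n mn; rewrite subsetEset => x /=; rewrite /expanding_itv/= !in_itv/= => /andP[a b].
rewrite (le_trans _ a) ?lef_pV2 ?posrE ?ltr0n// ?ler_nat ?ltnS//=.
by rewrite (le_trans b)// ler_nat ltnS.
Qed.

Lemma cvg_integral0y (f : R -> \bar R) :
  measurable_fun [set: R] f -> (forall x, 0 < x -> (0 <= f x)%E) ->
  (\int[leb]_(x in expanding_itv k) f x)%E @[k --> \oo] -->
   (\int[leb]_(x in `]0%R, +oo[) f x)%E.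
Proof.
move=> mf f0; rewrite bigcup_expanding_itv; apply: ge0_nondecreasing_set_cvg_integral => //.
- exact: nondecreasing_expanding_itv.
- by move=> i; exact: measurable_itv.
- by move=> i; exact: measurable_funTS.
- move=> i x; rewrite /expanding_itv/= in_itv/= => /andP[+ _] => ix; apply: f0.
  by apply: lt_le_trans ix; rewrite invr_gt0 ltr0n.
Qed.

(** Raise [t / (2 a) <= expR (t / (2 a))] to the power [a]. *)
Lemma powR_le_expR_half (a : R) : 0 <= a -> exists2 C : R, 0 < C &
  forall t, 0 < t -> t `^ a <= C * expR (t / 2).
Proof.
rewrite le_eqVlt => /predU1P[<-|a0].
  exists 1 => // t t0; rewrite powRr0 mul1r.
  by rewrite -expR0 ler_expR divr_ge0// ltW.
exists ((2 * a) `^ a); first by rewrite powR_gt0// mulr_gt0.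
move=> t t0; have -> : t = (2 * a) * (t / (2 * a)) by field; rewrite gt_eqF.
rewrite powRM ?divr_ge0 ?mulr_ge0 ?(ltW a0) ?(ltW t0)// ler_wpM2l ?powR_ge0//.
have -> : 2 * a * (t / (2 * a)) / 2 = t / (2 * a) * a by field; rewrite gt_eqF.
rewrite expRM ge0_ler_powR ?nnegrE ?expR_ge0 ?divr_ge0 ?mulr_ge0 ?(ltW a0) ?(ltW t0)//.
by rewrite (le_trans _ (expR_ge1Dx _))// lerDr.
Qed.

Lemma integral_expRN (c : R) : 0 < c ->
  (\int[leb]_(t in `]0%R, +oo[) (expR (- (c * t)))%:E = c^-1%:E)%E.
Proof.
move=> c0; rewrite integral_itv_obnd_cbnd; last first.
  apply/measurable_EFinP/measurable_funTS/measurableT_comp => //.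
  by apply: measurableT_comp => //; exact: measurable_funM.
have dF (x : R) : is_derive x 1 (fun t : R => - c^-1 * expR (- (c * t))) (expR (- (c * x))).
  have -> : expR (- (c * x)) = - c^-1 *: (expR (- (c * x)) * (- c)).
    by rewrite /GRing.scale/=; field; rewrite gt_eqF.
  apply: is_deriveZ; apply: (@is_derive1_comp _ expR (fun t => - (c * t))).
  have -> : - c = - (c *: 1) :> R by rewrite /GRing.scale/= mulr1.
  by apply: is_deriveN; exact: is_deriveZ.
have cf : continuous (fun t : R => expR (- (c * t))).
  move=> x; apply: continuous_comp; last exact: continuous_expR.
  by apply: cvgN; apply: cvgMl_tmp; exact: cvg_id.
rewrite (@ge0_continuous_FTC2y _ _ (fun t => - c^-1 * expR (- (c * t))) 0 0).
- by rewrite -EFinB mulr0 oppr0 expR0; congr EFin; lra.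
- by move=> x _; exact: expR_ge0.
- exact: continuous_subspaceT.
- rewrite -(mulr0 (- c^-1)); apply: cvgM; first exact: cvg_cst.
  apply: (cvg_comp (fun t : R => c * t) (fun t => expR (- t))); last exact: cvgr_expR.
  by rewrite (_ : (fun t : R => c * t) = (fun t => t * c)); [exact: gt0_cvgMly|apply/funext => t; rewrite mulrC].
- by move=> x _; have [] := dF x.
- by apply: cvg_at_right_filter; apply: cvgM; [exact: cvg_cst|exact: cf].
- by move=> x _; rewrite derive1E; have [_ ->] := dF x.
Qed.

End half_line.

(** * Euler's Gamma integral and its functional equation *)

Section gamma.
Context {R : realType}.
Local Notation leb := (@lebesgue_measure R).

(** The rate [A] is a parameter so that a power [A^(-s)] can be replaced by a Gamma integral and the
    order of integration exchanged afterwards. *)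
Definition gamma_fun (z A t : R) : R := t `^ (z - 1) * expR (- (A * t)).

Lemma measurable_gamma_fun z A : measurable_fun [set: R] (gamma_fun z A).
Proof.
apply: measurable_funM; first exact: measurable_powR.
by apply: measurableT_comp => //; apply: measurableT_comp => //; exact: measurable_funM.
Qed.

Lemma gamma_fun_ge0 z A t : 0 <= gamma_fun z A t.
Proof. by rewrite mulr_ge0 ?powR_ge0 ?expR_ge0. Qed.

(** Valued in the extended reals, so that the functional equation can be proved before finiteness;
    finiteness for [0 < z < 1] is then deduced from it. *)
Definition gammaI (z : R) : \bar R := (\int[leb]_(t in `]0%R, +oo[) (gamma_fun z 1 t)%:E)%E.

Lemma gammaI_ge0 z : (0 <= gammaI z)%E.
Proof. by apply: integral_ge0 => t _; rewrite lee_fin gamma_fun_ge0. Qed.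

Lemma gammaI_lty_ge1 z : 1 <= z -> (gammaI z < +oo)%E.
Proof.
rewrite -subr_ge0 => /powR_le_expR_half[C C0 hC].
apply: (@le_lt_trans _ _ (\int[leb]_(t in `]0%R, +oo[) (C%:E * (expR (- (2^-1 * t)))%:E))%E).
  apply: ge0_le_integral => //.
  - by move=> t _; rewrite lee_fin gamma_fun_ge0.
  - by apply/measurable_EFinP/measurable_funTS; exact: measurable_gamma_fun.
  - apply/measurable_EFinP/measurable_funTS; apply: measurable_funM => //.
    by apply: measurableT_comp => //; apply: measurableT_comp => //; exact: measurable_funM.
  - move=> t; rewrite /= in_itv/= andbT => t0; rewrite lee_fin /gamma_fun mul1r.
    rewrite (le_trans (ler_wpM2r (expR_ge0 _) (hC _ t0)))// -mulrA -expRD.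
    by rewrite (_ : _ + _ = - (2^-1 * t))//; field.
rewrite ge0_integralZl_EFin//; last 2 first.
- apply/measurable_EFinP/measurable_funTS.
  by apply: measurableT_comp => //; apply: measurableT_comp => //; exact: measurable_funM.
- exact: ltW.
by rewrite integral_expRN -?EFinM ?ltry// invr_gt0.
Qed.

Lemma gamma_boundary (z : R) : 0 < z ->
  (k.+1%:R `^ z * expR (- k.+1%:R) - k.+1%:R^-1 `^ z * expR (- k.+1%:R^-1) : R) @[k --> \oo] --> (0 : R).
Proof.
move=> z0; rewrite -[X in _ --> X](subr0 0); apply: cvgB; last first.
  apply: (@squeeze_cvgr _ _ _ _ (fun=> 0) (fun k => k.+1%:R^-1 `^ z)).
  - near=> k; rewrite mulr_ge0 ?powR_ge0 ?expR_ge0//=.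
    by rewrite ler_piMr ?powR_ge0// -expR0 ler_expR oppr_le0 invr_ge0 ler0n.
  - exact: cvg_cst.
  - exact: invr_powR_cvg0.
have [C C0 hC] := powR_le_expR_half (ltW z0).
apply: (@squeeze_cvgr _ _ _ _ (fun=> 0) (fun k => 2 * C * harmonic k)).
- near=> k; rewrite mulr_ge0 ?powR_ge0 ?expR_ge0//=.
  rewrite (le_trans (ler_wpM2r (expR_ge0 _) (hC _ _)))//.
  rewrite -(mulrA C) -expRD (_ : _ + _ = - (k.+1%:R / 2)); last by field.
  rewrite -(mulrA 2) mulrCA ler_wpM2l ?(ltW C0)//.
  rewrite expRN -[leRHS]invrK lef_pV2 ?posrE ?expR_gt0 ?invr_gt0 ?mulr_gt0 ?invr_gt0 ?ltr0n//.
  by rewrite invfM invrK mulrC (le_trans _ (expR_ge1Dx _))// lerDr.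
- exact: cvg_cst.
- by rewrite -(mulr0 (2 * C)); apply: cvgM; [exact: cvg_cst|exact: cvg_harmonic].
Unshelve. all: by end_near. Qed.

(** Integration by parts on the compact intervals of [expanding_itv], where everything is finite;
    both sides are then limits in the extended reals, and no finiteness of [gammaI] is assumed. *)
Lemma gammaI_add1 z : 0 < z -> gammaI (z + 1) = (z%:E * gammaI z)%E.
Proof.
move=> z0.
pose I w k := (\int[leb]_(t in expanding_itv k) (gamma_fun w 1 t)%:E)%E.
have cI w : I w k @[k --> \oo] --> gammaI w.
  apply: cvg_integral0y; first by apply/measurable_EFinP; exact: measurable_gamma_fun.
  by move=> x _; rewrite lee_fin gamma_fun_ge0.
have k0 k : 0 < k.+1%:R^-1 :> R by rewrite invr_gt0 ltr0n.
have cgam w (x : R) : 0 < x -> {for x, continuous (gamma_fun w 1)}.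
  move=> x0; apply: cvgM.
    exact: continuous_powR.
  apply: continuous_comp; last exact: continuous_expR.
  by apply: cvgN; apply: cvgMl_tmp; exact: cvg_id.
have iI w k : leb.-integrable (expanding_itv k) (EFin \o gamma_fun w 1).
  apply: continuous_compact_integrable; first exact: segment_compact.
  apply: continuous_in_subspaceT => x; rewrite inE /expanding_itv/= in_itv/= => /andP[kx _].
  by apply: cgam; exact: lt_le_trans kx.
have mI k : measurable (expanding_itv k : set (measurableTypeR R)) by exact: measurable_itv.
have fI w k : I w k \is a fin_num.
  by rewrite /I; apply: integrable_fin_num; [exact: mI|exact: iI].
pose B k : R := k.+1%:R `^ z * expR (- k.+1%:R) - k.+1%:R^-1 `^ z * expR (- k.+1%:R^-1).
have E k : (0 < k)%N -> (z%:E * I z k = I (z + 1)%R k + (B k)%:E)%E.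
  move=> k1; have dF (x : R) : k.+1%:R^-1 <= x <= k.+1%:R ->
      is_derive x 1 (fun t : R => t `^ z * expR (- t)) (z * gamma_fun z 1 x - gamma_fun (z + 1) 1 x).
    move=> /andP[kx _]; have x0 : 0 < x by exact: lt_le_trans kx.
    have d1 := is_derive1_powR z x0.
    have d2 : is_derive x 1 (fun t : R => expR (- t)) (expR (- x) * - 1).
      by apply: (@is_derive1_comp _ expR (fun t => - t)).
    apply: (is_derive_eq (is_deriveM d1 d2)).
    by rewrite /gamma_fun /GRing.scale/= addrK !mul1r; ring.
  have kk : k.+1%:R^-1 < k.+1%:R :> R.
    by rewrite (@lt_trans _ _ 1)// ?invf_lt1 ?ltr0n// ltr1n ltnS.
  have := integral_is_derive kk dF.
  have -> : k.+1%:R `^ z * expR (- k.+1%:R) - k.+1%:R^-1 `^ z * expR (- k.+1%:R^-1) = B k by [].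
  rewrite -/(expanding_itv k).
  have -> : (\int[leb]_(x in expanding_itv k) (z * gamma_fun z 1 x - gamma_fun (z + 1) 1 x)%:E
     = z%:E * I z k - I (z + 1)%R k)%E.
    under eq_integral do rewrite EFinB EFinM.
    rewrite integralB//; last 2 first.
    - by apply: integrableZl => //; exact: iI.
    - exact: iI.
    by rewrite integralZl//; exact: iI.
  move=> <-; first by rewrite addeC subeK.
  move=> x /andP[kx _]; have x0 : 0 < x by exact: lt_le_trans kx.
  apply: cvgB; last exact: cgam.
  by apply: cvgM; [exact: cvg_cst|exact: cgam].
have L1 : (z%:E * I z k @[k --> \oo] --> z%:E * gammaI z)%E.
  by apply: cvgeZl.
have L2 : (z%:E * I z k @[k --> \oo] --> gammaI (z + 1)%R)%E.
  rewrite -[X in _ --> X]adde0; apply: (@cvg_trans _ (I (z + 1)%R k + (B k)%:E @[k --> \oo])%E).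
    by apply: near_eq_cvg; near=> k; apply/esym/E; near: k; exists 1%N.
  apply: cvgeD; first by rewrite fin_num_adde_defl.
    exact: cI.
  by apply/fine_cvgP; split; [exact: nearW|exact: gamma_boundary].
by rewrite (cvg_unique _ L1 L2).
Unshelve. all: by end_near. Qed.

Lemma gammaI_lty z : 0 < z -> (gammaI z < +oo)%E.
Proof.
move=> z0; have := @gammaI_lty_ge1 (z + 1); rewrite lerDr => /(_ (ltW z0)).
rewrite gammaI_add1//; have := gammaI_ge0 z; case: (gammaI z) => [r _ _|_|//]; first exact: ltry.
by rewrite mulry gtr0_sg// mul1e.
Qed.

Lemma gammaIE z : 0 < z -> gammaI z = (Gamma z)%:E.
Proof.
move=> z0; rewrite /Gamma z0 /Gamma_integral /Rintegral fineK.
  by apply: eq_integral => t _; rewrite /gamma_fun mul1r.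
have <- : gammaI z = (\int[leb]_(x in `]0%R, +oo[) (x `^ (z - 1) * expR (- x))%:E)%E.
  by apply: eq_integral => t _; rewrite /gamma_fun mul1r.
by rewrite ge0_fin_numE ?gammaI_ge0// gammaI_lty.
Qed.

Lemma Gamma_add1 (z : R) : 0 < z -> Gamma (z + 1) = z * Gamma z.
Proof.
move=> z0; apply: EFin_inj; rewrite EFinM -!gammaIE ?gammaI_add1// addr_gt0//.
Qed.

Lemma Gamma_ge0 (z : R) : 0 < z -> 0 <= Gamma z.
Proof. by move=> z0; rewrite -lee_fin -gammaIE ?gammaI_ge0. Qed.

(** For [1 <= z] the integrand is at least [expR (-2)] on [[1, 2]]; smaller [z] are lifted to
    [z + 1]. *)
Lemma Gamma_gt0 (z : R) : 0 < z -> 0 < Gamma z.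
Proof.
wlog z1 : z / 1 <= z => [H|] z0.
  have [/H|z1] := leP 1 z; first exact.
  have : 0 < Gamma (z + 1) by apply: H; rewrite ?addr_gt0// lerDr ltW.
  by rewrite Gamma_add1// pmulr_rgt0.
rewrite -lte_fin -gammaIE//.
apply: (@lt_le_trans _ _ (expR (-2))%:E); first by rewrite lte_fin expR_gt0.
have -> : (expR (-2))%:E = (\int[leb]_(t in `[1%R, 2%R]) (cst (expR (-2))%:E t))%E.
  rewrite integral_cst//= lebesgue_measure_itv/= lte_fin ltr1n -EFinD -EFinM.
  by congr EFin; lra.
apply: (@le_trans _ _ (\int[leb]_(t in `[1%R, 2%R]) (gamma_fun z 1 t)%:E)%E).
  apply: ge0_le_integral => //.
  - by move=> t _; rewrite lee_fin expR_ge0.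
  - by apply/measurable_EFinP/measurable_funTS; exact: measurable_gamma_fun.
  - move=> t; rewrite /= in_itv/= => /andP[t1 t2]; rewrite lee_fin.
    rewrite -[leLHS]mul1r ler_pM ?expR_ge0//; last by rewrite ler_expR lerN2 mul1r.
    by rewrite -[leLHS](powRr0 t) ler_powR// subr_ge0.
apply: ge0_subset_integral => //.
- by apply/measurable_EFinP/measurable_funTS; exact: measurable_gamma_fun.
- by move=> t _; rewrite lee_fin gamma_fun_ge0.
- by move=> t /=; rewrite !in_itv/= andbT => /andP[+ _]; exact: lt_le_trans.
Qed.

Lemma Gamma1 : Gamma (1 : R) = 1.
Proof.
apply: EFin_inj; rewrite -gammaIE// -[in RHS]invr1 -(integral_expRN ltr01).
by apply: eq_integral => t _; rewrite /gamma_fun subrr powRr0 mul1r.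
Qed.

Lemma integral_gamma_fun (s A : R) : 0 < s -> 0 < A ->
  (\int[leb]_(t in `]0%R, +oo[) (gamma_fun s A t)%:E = (Gamma s * A `^ (- s))%:E)%E.
Proof.
move=> s0 A0; rewrite EFinM -gammaIE// /gammaI.
rewrite [in RHS]integral_mkcond; set g := (X in (\int[_]_x X x * _)%E).
have mg : measurable_fun [set: R] g.
  apply/(measurable_restrictT _ _).1 => //.
  by apply/measurable_EFinP/measurable_funTS; exact: measurable_gamma_fun.
have g0 x : (0 <= g x)%E by apply: erestrict_ge0 => y _; rewrite lee_fin gamma_fun_ge0.
rewrite (@ge0_integral_affine _ A 0)//.
rewrite muleC muleA -EFinM integral_mkcond -ge0_integralZl//; last 3 first.
- apply: (measurableT_comp (f := g) mg); apply: measurable_funD => //; exact: measurable_funM.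
- by move=> x _; exact: g0.
- by rewrite lee_fin mulr_ge0 ?powR_ge0 ?ltW.
apply: eq_integral => x _; rewrite /g !patchE addr0 !mem_setE/= !in_itv/= !andbT pmulr_rgt0//.
case: ifPn => x0; last by rewrite mule0.
rewrite -EFinM; congr EFin; rewrite /gamma_fun mul1r powRM ?ltW// !mulrA.
rewrite (_ : A `^ (- s) * A * A `^ (s - 1) = 1) ?mul1r//.
rewrite -[X in _ * X * _](powRr1 (ltW A0)) -!gt0_powRD// (_ : _ + _ = 0) ?powRr0//.
by ring.
Qed.

End gamma.

Section tonelli_on.
Local Open Scope ereal_scope.
Context d1 d2 (T1 : measurableType d1) (T2 : measurableType d2) (R : realType).
Variables (m1 : {sigma_finite_measure set T1 -> \bar R})
          (m2 : {sigma_finite_measure set T2 -> \bar R}).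

Lemma fubini_tonelli_in (D1 : set T1) (D2 : set T2) (f : T1 * T2 -> \bar R) :
  measurable D1 -> measurable D2 -> measurable_fun [set: T1 * T2] f ->
  (forall z, 0 <= f z) ->
  \int[m1]_(x in D1) \int[m2]_(y in D2) f (x, y) =
  \int[m2]_(y in D2) \int[m1]_(x in D1) f (x, y).
Proof.
move=> mD1 mD2 mf f0; pose g := f \_ (D1 `*` D2).
have mg : measurable_fun setT g.
  by apply/(measurable_restrictT _ _).1; [exact: measurableX|exact: measurable_funTS].
have g0 z : 0 <= g z by exact: erestrict_ge0.
transitivity (\int[m1]_x \int[m2]_y g (x, y)); last first.
  rewrite fubini_tonelli// [RHS]integral_mkcond; apply: eq_integral => y _.
  rewrite patchE; case: ifPn => yD.
    rewrite [RHS]integral_mkcond; apply: eq_integral => x _.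
    by rewrite /g !patchE in_setX/= yD andbT.
  by apply: integral0_eq => x _; rewrite /g patchE in_setX/= (negbTE yD) andbF.
rewrite [LHS]integral_mkcond; apply: eq_integral => x _.
rewrite patchE; case: ifPn => xD.
  rewrite [LHS]integral_mkcond; apply: eq_integral => y _.
  by rewrite /g !patchE in_setX/= xD.
by apply/esym/integral0_eq => y _; rewrite /g patchE in_setX/= (negbTE xD).
Qed.

End tonelli_on.

(** * Kernel and Beta integrals obtained from Gamma integrals *)

Section euler.
Context {R : realType}.
Local Notation leb := (@lebesgue_measure R).

Lemma integral_gaussZ (t : R) : 0 < t ->
  (\int[leb]_z (expR (- (t * z ^+ 2)))%:E = (Num.sqrt pi * t `^ (- 2^-1))%:E)%E.
Proof.
move=> t0; have s0 : 0 < Num.sqrt t by rewrite sqrtr_gt0.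
have : (\int[leb]_x (gauss_fun x)%:E = (Num.sqrt pi)%:E)%E by exact: integralT_gauss.
rewrite (@ge0_integral_affine _ (Num.sqrt t) 0)//; last 2 first.
- by apply/measurable_EFinP; exact: measurable_gauss_fun.
- by move=> x; rewrite lee_fin gauss_fun_ge0.
under eq_integral => z _ do rewrite /gauss_fun addr0 exprMn sqr_sqrtr ?(ltW t0)//.
rewrite powRN powR12_sqrt ?ltW// => H.
have -> : (Num.sqrt pi / Num.sqrt t)%:E = ((Num.sqrt t)^-1%:E * (Num.sqrt pi)%:E :> \bar R)%E.
  by rewrite -EFinM mulrC.
by rewrite -H muleA -EFinM mulVf ?gt_eqF// mul1e.
Qed.

Lemma measurable_gamma_fun2 (z : R) d (T : measurableType d) (A t : T -> R) :
  measurable_fun setT A -> measurable_fun setT t ->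
  measurable_fun setT (fun x => gamma_fun z (A x) (t x)).
Proof.
move=> mA mt; apply: measurable_funM.
  by apply: (measurableT_comp (measurable_powR (z - 1))).
apply: measurableT_comp => //; apply: measurableT_comp => //; exact: measurable_funM.
Qed.

(** [Gamma s * (A + z^2)^(-s)] is written as a Gamma integral over [t]; by Tonelli the integral over
    [z] comes first and is Gaussian, contributing the factor [t^(-1/2)] that lowers [s] by one
    half. *)
Lemma integral_kernel1 (s A : R) : 2^-1 < s -> 0 < A ->
  (\int[leb]_z ((A + z ^+ 2) `^ (- s))%:E =
   (Num.sqrt pi * Gamma (s - 2^-1) / Gamma s * A `^ (- (s - 2^-1)))%:E)%E.
Proof.
move=> s2 A0; have s0 : 0 < s by rewrite (lt_trans _ s2).
have G0 := Gamma_gt0 s0.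
suff H : ((Gamma s)%:E * \int[leb]_z ((A + z ^+ 2) `^ (- s))%:E =
    (Num.sqrt pi * Gamma (s - 2^-1) * A `^ (- (s - 2^-1)))%:E)%E.
  rewrite mulrAC mulrC EFinM -H muleA -EFinM mulVf ?gt_eqF// mul1e//.
rewrite -ge0_integralZl_EFin//; last 3 first.
- by move=> z _; rewrite lee_fin powR_ge0.
- apply/measurable_EFinP; apply: (measurableT_comp (measurable_powR (- s))).
  by apply: measurable_funD => //; exact: measurable_funX.
- exact: ltW.
under eq_integral => z _.
  rewrite -EFinM -integral_gamma_fun//; last by rewrite ltr_pwDl// sqr_ge0.
  over.
have mg : measurable_fun [set: R * R]%type (fun p => (gamma_fun s (A + p.1 ^+ 2) p.2)%:E).
  apply/measurable_EFinP; apply: measurable_gamma_fun2 => //.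
  by apply: measurable_funD => //; exact: measurable_funX.
rewrite (@fubini_tonelli_in _ _ _ _ _ leb leb setT `]0%R, +oo[%classic
  (fun p => (gamma_fun s (A + p.1 ^+ 2) p.2)%:E))//; last first.
  by move=> p; rewrite lee_fin gamma_fun_ge0.
transitivity (\int[leb]_(y in `]0%R, +oo[) ((Num.sqrt pi)%:E * (gamma_fun (s - 2^-1) A y)%:E))%E.
  apply: eq_integral => t; rewrite inE/= in_itv/= andbT => t0.
  under eq_integral => z _.
    rewrite (_ : gamma_fun _ _ _ = gamma_fun s A t * expR (- (t * z ^+ 2))); last first.
      by rewrite /gamma_fun -mulrA -expRD; congr (_ * expR _); ring.
    rewrite EFinM; over.
  rewrite ge0_integralZl_EFin//; last 2 first.
  - apply/measurable_EFinP; apply: measurableT_comp => //; apply: measurableT_comp => //.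
    by apply: measurable_funM => //; exact: measurable_funX.
  - exact: gamma_fun_ge0.
  rewrite integral_gaussZ// -!EFinM; congr EFin.
  rewrite /gamma_fun mulrCA; congr (_ * _); rewrite mulrAC -gt0_powRD//.
  by congr (_ `^ _ * _); ring.
rewrite ge0_integralZl_EFin//; last 2 first.
- by move=> z _; rewrite lee_fin gamma_fun_ge0.
- by apply/measurable_EFinP/measurable_funTS; exact: measurable_gamma_fun.
by rewrite integral_gamma_fun ?subr_gt0// -EFinM mulrA.
Qed.

(** Integrand of the Beta integral of the second kind, on the half-line: it has the powers of [s]
    and [1 + s] that arise from [t = 1 + s]. *)
Definition beta_fun (a b s : R) : R := s `^ (b - 1) * (1 + s) `^ (- (a + b)).

Lemma measurable_beta_fun a b : measurable_fun [set: R] (beta_fun a b).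
Proof.
apply: measurable_funM; first exact: measurable_powR.
by apply: (measurableT_comp (measurable_powR _)); exact: measurable_funD.
Qed.

Lemma beta_fun_ge0 a b s : 0 <= beta_fun a b s.
Proof. by rewrite mulr_ge0 ?powR_ge0. Qed.

(** [Gamma (a + b) * (1 + s)^(-(a + b))] is opened into a Gamma integral over [t], and the integral
    over [s] is taken first; it gives [Gamma b * t^(-b)]. *)
Lemma integral_beta_fun (a b : R) : 0 < a -> 0 < b ->
  (\int[leb]_(s in `]0%R, +oo[) (beta_fun a b s)%:E = (Beta a b)%:E)%E.
Proof.
move=> a0 b0; have ab0 : 0 < a + b by rewrite addr_gt0.
have G0 := Gamma_gt0 ab0.
suff H : ((Gamma (a + b))%:E * \int[leb]_(s in `]0%R, +oo[) (beta_fun a b s)%:E =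
    (Gamma a * Gamma b)%:E)%E.
  rewrite /Beta mulrC EFinM -H muleA -EFinM mulVf ?gt_eqF// mul1e//.
rewrite -ge0_integralZl_EFin//; last 3 first.
- by move=> z _; rewrite lee_fin beta_fun_ge0.
- by apply/measurable_EFinP/measurable_funTS; exact: measurable_beta_fun.
- exact: ltW.
pose F (p : R * R) := (p.1 `^ (b - 1) * gamma_fun (a + b) (1 + p.1) p.2)%:E.
transitivity (\int[leb]_(s in `]0%R, +oo[) \int[leb]_(t in `]0%R, +oo[) F (s, t))%E.
  apply: eq_integral => s; rewrite inE/= in_itv/= andbT => s0; rewrite /F/=.
  under [in RHS]eq_integral do rewrite EFinM.
  rewrite ge0_integralZl_EFin ?powR_ge0//; last 2 first.
  - by move=> z _; rewrite lee_fin gamma_fun_ge0.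
  - by apply/measurable_EFinP/measurable_funTS; exact: measurable_gamma_fun.
  by rewrite integral_gamma_fun ?addr_gt0// -!EFinM /beta_fun mulrCA.
have mF : measurable_fun [set: R * R]%type F.
  apply/measurable_EFinP; apply: measurable_funM.
    by apply: (measurableT_comp (measurable_powR _)).
  by apply: measurable_gamma_fun2 => //; exact: measurable_funD.
rewrite (@fubini_tonelli_in _ _ _ _ _ leb leb)//; last first.
  by move=> p; rewrite lee_fin mulr_ge0 ?powR_ge0// gamma_fun_ge0.
transitivity (\int[leb]_(t in `]0%R, +oo[) ((Gamma b)%:E * (gamma_fun a 1 t)%:E))%E.
  apply: eq_integral => t; rewrite inE/= in_itv/= andbT => t0; rewrite /F/=.
  under eq_integral => s _.
    rewrite (_ : _ * _ = gamma_fun (a + b) 1 t * gamma_fun b t s); last first.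
      have -> : gamma_fun (a + b) (1 + s) t = gamma_fun (a + b) 1 t * expR (- (t * s)).
        by rewrite /gamma_fun -mulrA -expRD; congr (_ * expR _); ring.
      by rewrite /gamma_fun; ring.
    rewrite EFinM; over.
  rewrite ge0_integralZl_EFin ?gamma_fun_ge0//; last 2 first.
  - by move=> z _; rewrite lee_fin gamma_fun_ge0.
  - by apply/measurable_EFinP/measurable_funTS; exact: measurable_gamma_fun.
  rewrite integral_gamma_fun// -!EFinM; congr EFin.
  rewrite /gamma_fun mulrCA; congr (_ * _); rewrite mulrAC -gt0_powRD//.
  by congr (_ `^ _ * _); ring.
rewrite ge0_integralZl_EFin ?Gamma_ge0//; last 2 first.
- by move=> z _; rewrite lee_fin gamma_fun_ge0.
- by apply/measurable_EFinP/measurable_funTS; exact: measurable_gamma_fun.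
by rewrite integral_gamma_fun// powR1 mulr1 -EFinM mulrC.
Qed.

End euler.

(** * Beta values at negative arguments, and integration by parts *)

Section bracket.
Context {R : realType}.
Local Notation leb := (@lebesgue_measure R).

(** Below 0 the definition of [Gamma] takes a single factor here, since [Num.truncn (- z) = 0]; as
    [z + 1] is positive, both sides refer to the same convergent integral. *)
Lemma Gamma_add1_neg (z : R) : -1 < z < 1 -> z != 0 -> Gamma (z + 1) = z * Gamma z.
Proof.
move=> /andP[z1 z2] z0; have [zp|zn] := ltP 0 z; first exact: Gamma_add1.
have zn' : z < 0 by rewrite lt_neqAle z0.
have zp1 : 0 < z + 1 by lra.
rewrite [in RHS]/Gamma ltNge zn/= (_ : Num.truncn (- z) = 0%N); last first.
  by apply/truncn_def; rewrite ?oppr_ge0// mulr1n; apply/andP; split; lra.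
rewrite big_ord1 addr0 /Gamma zp1 mulrC divfK//.
Qed.

Lemma Gamma_add2_neg (z : R) : -2 < z < 0 -> z != -1 -> Gamma (z + 2) = z * (z + 1) * Gamma z.
Proof.
move=> /andP[z1 z2] z0.
have zp2 : 0 < z + 2 by lra.
have [zp|zn] := ltP (-1) z.
  rewrite (_ : z + 2 = z + 1 + 1); last by ring.
  rewrite Gamma_add1 ?Gamma_add1_neg; first ring.
  - by apply/andP; split; lra.
  - by rewrite lt_eqF.
  - by lra.
have zn' : z < -1 by rewrite lt_neqAle z0.
rewrite [in RHS]/Gamma ltNge (ltW z2)/= (_ : Num.truncn (- z) = 1%N); last first.
  by apply/truncn_def; apply/andP; split; lra.
rewrite big_ord_recl big_ord1/= addr0 /Gamma zp2 /bump/= mulrC divfK//.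
by rewrite mulf_neq0 ?lt_eqF//; lra.
Qed.

(** Both [Gamma (- alpha)] and [Gamma (a - alpha) = Gamma (- b)] are moved two units to the right,
    where the Beta value is a convergent integral; [alpha != 1] and [b != 0] keep the poles away. *)
Lemma Beta_neg (a b alpha : R) : 0 < alpha < 2 -> alpha != 1 -> -1 < b < 1 -> b != 0 ->
  a = alpha - b -> 0 < a ->
  Beta a (- alpha) = Beta a (2 - alpha) * (b * (b - 1)) / (alpha * (alpha - 1)).
Proof.
move=> /andP[a0 a2] a1 /andP[b0 b1] bn0 ae ap; rewrite /Beta.
have -> : a - alpha = - b by lra.
have -> : a + (2 - alpha) = 1 - b + 1 by lra.
have b1p : 0 < 1 - b by lra.
rewrite Gamma_add1// [1 - b]addrC Gamma_add1_neg ?oppr_eq0//; last by apply/andP; split; lra.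
have a1' : - alpha != -1 by rewrite eqr_opp.
have := @Gamma_add2_neg (- alpha) _ a1'; rewrite [_ + 2]addrC => -> //; last by apply/andP; split; lra.
have Gb : Gamma (- b) != 0.
  have : 0 < Gamma (- b + 1) by apply: Gamma_gt0; lra.
  rewrite Gamma_add1_neg ?oppr_eq0//; last by apply/andP; split; lra.
  by apply: contraTN => /eqP ->; rewrite mulr0 ltxx.
have h1 : alpha - 1 != 0 by rewrite subr_eq0.
have h2 : alpha != 0 by rewrite gt_eqF.
have h3 : - b + 1 != 0 by rewrite gt_eqF// addrC.
by field; rewrite Gb bn0 h1 h2 h3.
Qed.

Lemma expanding_itv_gt0 k (x : R) : expanding_itv k x -> 0 < x.
Proof.
rewrite /expanding_itv/= in_itv/= => /andP[kx _]; apply: lt_le_trans kx.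
by rewrite invr_gt0 ltr0n.
Qed.

Lemma measurable_expanding_itv k : measurable (expanding_itv k : set (measurableTypeR R)).
Proof. exact: measurable_itv. Qed.

Lemma integrable_expanding_itv (f : R -> R) k :
  (forall x : R, 0 < x -> {for x, continuous f}) ->
  leb.-integrable (expanding_itv k) (EFin \o f).
Proof.
move=> cf; apply: continuous_compact_integrable; first exact: segment_compact.
apply: continuous_in_subspaceT => x; rewrite inE => /expanding_itv_gt0; exact: cf.
Qed.

Lemma is_derive_powR1D (c s : R) : 0 < s ->
  is_derive s 1 (fun t : R => (1 + t) `^ c) (c * (1 + s) `^ (c - 1)).
Proof.
move=> s0; have s1 : 0 < 1 + s by rewrite addr_gt0.
have d1 : is_derive s 1 (fun t : R => 1 + t) 1.
  have := is_deriveD (is_derive_cst (1 : R) s 1) (is_derive_id s 1); rewrite add0r; exact.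
by rewrite -[X in is_derive _ _ _ X]mulr1; apply: (is_derive1_comp (is_derive1_powR c s1) d1).
Qed.

Lemma continuous_powR1D (c s : R) : 0 < s -> {for s, continuous (fun t : R => (1 + t) `^ c)}.
Proof.
move=> s0; apply/differentiable_continuous/derivable1_diffP.
by have [] := is_derive_powR1D c s0.
Qed.

(* Two integrations by parts turn s^(-1-alpha), not integrable at 0, into
   s^(1-alpha); these are the boundary terms. *)
Definition bdry_term (alpha c s : R) : R :=
  - (alpha - 1) * (1 + s) `^ c * s `^ (- alpha) - c * (1 + s) `^ (c - 1) * s `^ (1 - alpha).

(** The two mixed terms [c (alpha - 1) (1 + s)^(c - 1) s^(-alpha)] cancel, which leaves the singular
    integrand and the Beta integrand. *)
Lemma is_derive_bdry_term (alpha c s : R) : 0 < s ->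
  is_derive s 1 (bdry_term alpha c)
    (alpha * (alpha - 1) * ((1 + s) `^ c * s `^ (- 1 - alpha)) -
     c * (c - 1) * beta_fun (alpha - c) (2 - alpha) s).
Proof.
move=> s0.
have D1 := is_deriveM (is_derive_powR1D c s0) (is_derive1_powR (- alpha) s0).
have D2 := is_deriveM (is_derive_powR1D (c - 1) s0) (is_derive1_powR (1 - alpha) s0).
have D := is_deriveB (is_deriveZ (- (alpha - 1)) D1) (is_deriveZ c D2).
have -> : bdry_term alpha c = (- (alpha - 1) \*: ((fun t : R => (1 + t) `^ c) * (fun t : R => t `^ (- alpha))))%R -
    (c \*: ((fun t : R => (1 + t) `^ (c - 1)) * (fun t : R => t `^ (1 - alpha)))%R).
  by apply/funext => t; rewrite /bdry_term /GRing.scale/= -!mulrA.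
apply: (is_derive_eq D).
rewrite /beta_fun /GRing.scale/=.
have -> : 2 - alpha - 1 = 1 - alpha by ring.
have -> : - (alpha - c + (2 - alpha)) = c - 1 - 1 by ring.
have -> : 1 - alpha - 1 = - alpha by ring.
have -> : - alpha - 1 = - 1 - alpha by ring.
by ring.
Qed.

Lemma integral_bdry_term (alpha c : R) k : (0 < k)%N ->
  alpha * (alpha - 1) * (\int[leb]_(s in expanding_itv k) ((1 + s) `^ c * s `^ (- 1 - alpha))) =
  c * (c - 1) * (\int[leb]_(s in expanding_itv k) beta_fun (alpha - c) (2 - alpha) s) +
  (bdry_term alpha c k.+1%:R - bdry_term alpha c k.+1%:R^-1).
Proof.
move=> k0; have kk : k.+1%:R^-1 < k.+1%:R :> R.
  by rewrite (@lt_trans _ _ 1)// ?invf_lt1 ?ltr0n// ltr1n ltnS.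
have c1 (x : R) : 0 < x -> {for x, continuous (fun s : R => (1 + s) `^ c * s `^ (- 1 - alpha))}.
  by move=> x0; apply: cvgM; [exact: continuous_powR1D|exact: continuous_powR].
have c2 (x : R) : 0 < x -> {for x, continuous (beta_fun (alpha - c) (2 - alpha))}.
  by move=> x0; apply: cvgM; [exact: continuous_powR|exact: continuous_powR1D].
have pos (x : R) : k.+1%:R^-1 <= x <= k.+1%:R -> 0 < x.
  by move=> H; apply: (@expanding_itv_gt0 k); rewrite /expanding_itv/= in_itv.
have := @integral_is_derive _ _ _ _ _ kk (fun x xk => is_derive_bdry_term alpha c (pos x xk)).
rewrite -/(expanding_itv k) => H.
have := congr1 fine (H _); rewrite /= => <-; last first.
  move=> x /pos x0; apply: cvgB; apply: cvgM; try exact: cvg_cst.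
    exact: c1.
  exact: c2.
rewrite -/(Rintegral _ _ _) RintegralB; last 3 first.
- exact: measurable_expanding_itv.
- by apply: integrable_expanding_itv => x x0; apply: cvgM; [exact: cvg_cst|exact: c1].
- by apply: integrable_expanding_itv => x x0; apply: cvgM; [exact: cvg_cst|exact: c2].
rewrite !RintegralZl; first ring.
- exact: measurable_expanding_itv.
- by apply: integrable_expanding_itv; exact: c2.
- exact: measurable_expanding_itv.
- by apply: integrable_expanding_itv; exact: c1.
Qed.

End bracket.

(** * Limits of the boundary terms at 0 and at infinity *)

Section bracket_limit.
Context {R : realType}.
Local Notation leb := (@lebesgue_measure R).

(** Squeeze [(1 + s)^c] between [(1 + s)^(-1)], which is at least [1 - s], and [1 + s]. *)
Lemma norm_powR1D_sub1 (c s : R) : -1 <= c <= 1 -> 0 < s -> `|(1 + s) `^ c - 1| <= s.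
Proof.
move=> /andP[c1 c2] s0; have s1 : 1 <= 1 + s by rewrite lerDl ltW.
have s2 : 0 < 1 + s by exact: lt_le_trans s1.
have h1 : (1 + s) `^ c <= 1 + s by exact: ler1_powR.
have h2 : (1 + s)^-1 <= (1 + s) `^ c by rewrite -(powR_inv1 (ltW s2)) ler_powR.
have h3 : 1 - s <= (1 + s)^-1.
  by rewrite -[(1 + s)^-1]mul1r ler_pdivlMr//; nra.
by rewrite ler_norml; apply/andP; split; lra.
Qed.

(** For the ground state exponent [g] and [g' = alpha - 1 - g], this is the sum of [1 - w] at the
    ratio [1 + s] and of [1 - w] at [1 / (1 + s)] weighted by [(1 + s)^(alpha - 1)]; see
    [trunc_hardy_diff]. *)
Definition hardy_fun (g g' s : R) : R := ((1 + s) `^ g - 1) * ((1 + s) `^ g' - 1).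

(* Each boundary term is unbounded as s -> 0; the combination factors through
   differences (1 + s)^g - 1 = O(s). *)
Lemma bdry_combination (alpha g g' s : R) : g + g' = alpha - 1 -> 0 < s ->
  bdry_term alpha (alpha - 1) s - bdry_term alpha g s - bdry_term alpha g' s + bdry_term alpha 0 s =
  - (alpha - 1) * hardy_fun g g' s * s `^ (- alpha) -
  (g * (1 + s) `^ (g - 1) * ((1 + s) `^ g' - 1) + g' * (1 + s) `^ (g' - 1) * ((1 + s) `^ g - 1))
  * s `^ (1 - alpha).
Proof.
move=> gg s0; have s1 : 0 < 1 + s by rewrite addr_gt0.
rewrite /bdry_term /hardy_fun powRr0 -gg.
have -> : g + g' - 1 = g - 1 + g' by ring.
rewrite (gt0_powRD (g - 1) g' s1) (gt0_powRD g g' s1).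
have e : (1 + s) `^ (g - 1) * (1 + s) `^ g' = (1 + s) `^ g * (1 + s) `^ (g' - 1).
  by rewrite -!gt0_powRD//; congr (_ `^ _); ring.
rewrite [(_ + _) * (_ * _)]mulrDl {2}e; ring.
Qed.

(** [harmonic k] is the left end of [expanding_itv k]. By [norm_powR1D_sub1] the first term is at
    most [s^(2-alpha)] and the other two together at most twice that. *)
Lemma bdry_combination_cvg0 (alpha g g' : R) : 0 < alpha < 2 -> g + g' = alpha - 1 ->
  -1 <= g <= 1 -> -1 <= g' <= 1 ->
  (bdry_term alpha (alpha - 1) (harmonic k) - bdry_term alpha g (harmonic k)
    - bdry_term alpha g' (harmonic k) + bdry_term alpha 0 (harmonic k)) @[k --> \oo] --> (0 : R).
Proof.
move=> /andP[a0 a2] gg gb gb'; apply/norm_cvg0P.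
have a1 : `|- (alpha - 1)| <= 1 by rewrite normrN ler_norml; apply/andP; split; lra.
apply: (@squeeze_cvgr _ _ _ _ (fun=> 0) (fun k => 3 * k.+1%:R^-1 `^ (2 - alpha))).
- near=> k; rewrite normr_ge0/=.
  set s : R := harmonic k; have s0 : 0 < s by rewrite invr_gt0.
  rewrite bdry_combination//.
  have s1 : 1 <= 1 + s by rewrite lerDl ltW.
  have B1 := norm_powR1D_sub1 gb s0; have B2 := norm_powR1D_sub1 gb' s0.
  have le1 c : c <= 1 -> (1 + s) `^ (c - 1) <= 1.
    by move=> c1; rewrite -[leRHS](powRr0 (1 + s)) ler_powR//; lra.
  have E1 : s ^+ 2 * s `^ (- alpha) = s `^ (2 - alpha).
    by rewrite gt0_powRD// -powR_mulrn// ltW.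
  have E2 : s * s `^ (1 - alpha) = s `^ (2 - alpha).
    rewrite -[X in X * _](powRr1 (ltW s0)) -gt0_powRD//; congr (_ `^ _); ring.
  rewrite (_ : 3 * _ = s `^ (2 - alpha) + 2 * s `^ (2 - alpha)); last by rewrite /s/=; ring.
  rewrite (le_trans (ler_normB _ _))// lerD//.
    rewrite normrM (ger0_norm (powR_ge0 _ _)) -E1 ler_wpM2r ?powR_ge0//.
    rewrite normrM -[leRHS]mul1r ler_pM// /hardy_fun normrM expr2 ler_pM//.
  rewrite normrM (ger0_norm (powR_ge0 _ _)) -E2 mulrA ler_wpM2r ?powR_ge0//.
  rewrite (le_trans (ler_normD _ _))// mulr_natl mulr2n lerD//.
    rewrite normrM -[leRHS]mul1r ler_pM// normrM (ger0_norm (powR_ge0 _ _)).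
    rewrite -[leRHS]mul1r ler_pM ?powR_ge0// ?le1 ?ler_norml//.
    by case/andP: gb.
  rewrite normrM -[leRHS]mul1r ler_pM// normrM (ger0_norm (powR_ge0 _ _)).
  rewrite -[leRHS]mul1r ler_pM ?powR_ge0// ?le1 ?ler_norml//.
  by case/andP: gb'.
- exact: cvg_cst.
- rewrite -(mulr0 3); apply: cvgM; first exact: cvg_cst.
  by apply: invr_powR_cvg0; lra.
Unshelve. all: by end_near. Qed.

(** The nonnegative majorant [c'] gives the decay [K^(c' - alpha)] for every [c <= c'], negative
    ones included, so one choice of [c'] serves all exponents of the bracket. *)
Lemma bdry_term_cvg0 (alpha c c' : R) : 0 < alpha < 2 -> c' < alpha -> 0 <= c' <= 1 ->
  c <= c' -> -1 <= c <= 1 -> bdry_term alpha c k.+1%:R @[k --> \oo] --> (0 : R).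
Proof.
move=> /andP[a0 a2] ca /andP[c0 c1] cc cb; apply/norm_cvg0P.
have a1 : `|- (alpha - 1)| <= 1 by rewrite normrN ler_norml; apply/andP; split; lra.
apply: (@squeeze_cvgr _ _ _ _ (fun=> 0) (fun k => 3 * k.+1%:R^-1 `^ (alpha - c'))).
- near=> k; rewrite normr_ge0/=.
  set K : R := k.+1%:R; have K1 : 1 <= K by rewrite /K ler1n.
  have K0 : 0 < K by exact: lt_le_trans K1.
  have K2 : 0 < 1 + K by rewrite addr_gt0.
  have -> : K^-1 `^ (alpha - c') = K `^ (c' - alpha).
    by rewrite -(powR_inv1 (ltW K0)) -powRrM; congr (_ `^ _); ring.
  have B1 : (1 + K) `^ c <= 2 * K `^ c'.
    apply: (@le_trans _ _ ((1 + K) `^ c')); first by rewrite ler_powR// lerDl ltW.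
    apply: (@le_trans _ _ ((2 * K) `^ c')).
      by apply: ge0_ler_powR => //; rewrite ?nnegrE ?mulr_ge0 ?(ltW K0) ?(ltW K2)//; lra.
    by rewrite powRM ?(ltW K0)// ler_wpM2r ?powR_ge0// ler1_powR// ler1n.
  have B2 : (1 + K) `^ (c - 1) <= K `^ (c' - 1).
    apply: (@le_trans _ _ ((1 + K) `^ (c' - 1))); first by rewrite ler_powR ?lerDl ?(ltW K0)//; lra.
    rewrite -[c' - 1]opprB !powRN lef_pV2 ?posrE ?powR_gt0//.
    by apply: ge0_ler_powR => //; rewrite ?nnegrE ?(ltW K0) ?(ltW K2)//; lra.
  rewrite (_ : 3 * _ = 2 * K `^ (c' - alpha) + K `^ (c' - alpha)); last by ring.
  rewrite (le_trans (ler_normB _ _))// lerD//.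
    rewrite normrM (ger0_norm (powR_ge0 _ _)) gt0_powRD// mulrA ler_wpM2r ?powR_ge0//.
    by rewrite normrM (ger0_norm (powR_ge0 _ _)) -[leRHS]mul1r ler_pM ?powR_ge0.
  rewrite normrM (ger0_norm (powR_ge0 _ _)).
  have -> : c' - alpha = (c' - 1) + (1 - alpha) by ring.
  rewrite (gt0_powRD (c' - 1) (1 - alpha) K0) ler_wpM2r ?powR_ge0//.
  by rewrite normrM (ger0_norm (powR_ge0 _ _)) -[leRHS]mul1r ler_pM ?powR_ge0// ler_norml.
- exact: cvg_cst.
- rewrite -(mulr0 3); apply: cvgM; first exact: cvg_cst.
  by apply: invr_powR_cvg0; lra.
Unshelve. all: by end_near. Qed.

Lemma Rintegral_beta_fun_cvg (a b : R) : 0 < a -> 0 < b ->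
  (\int[leb]_(s in expanding_itv k) beta_fun a b s) @[k --> \oo] --> Beta a b.
Proof.
move=> a0 b0.
have H : (\int[leb]_(s in expanding_itv k) (beta_fun a b s)%:E)%E @[k --> \oo] --> (Beta a b)%:E.
  rewrite -integral_beta_fun//; apply: cvg_integral0y.
    by apply/measurable_EFinP; exact: measurable_beta_fun.
  by move=> x _; rewrite lee_fin beta_fun_ge0.
by have /fine_cvgP[_] := H.
Qed.

End bracket_limit.

(** * The bracket of Beta values as a limit of truncated integrals *)

Section bracket_cvg.
Context {R : realType}.
Local Notation leb := (@lebesgue_measure R).

Definition hardy_exp (alpha p : R) : R := (alpha - 1) / p.

(** [g] and [g'] split [alpha - 1] in the proportions [1 / p] and [1 - 1 / p]; both lie between 0
    and [alpha - 1], and they vanish only if it does. *)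
Lemma hardy_exp_bounds (alpha p : R) : 0 < alpha < 2 -> 1 < p ->
  let g := hardy_exp alpha p in let g' := alpha - 1 - g in
  [/\ -1 < g < 1, -1 < g' < 1, g < alpha, g' < alpha & alpha != 1 -> g != 0 /\ g' != 0].
Proof.
move=> /andP[a0 a2] p1 g g'.
have p0 : 0 < p by exact: lt_trans p1.
have q0 : 0 < p^-1 by rewrite invr_gt0.
have q1 : p^-1 < 1 by rewrite invf_lt1.
rewrite /g' /g /hardy_exp; split.
- by apply/andP; split; nra.
- by apply/andP; split; nra.
- nra.
- nra.
- rewrite -subr_eq0 => an0; split; first by rewrite mulf_neq0// gt_eqF.
  rewrite (_ : _ - _ = (alpha - 1) * (1 - p^-1)); last by ring.
  by rewrite mulf_neq0// subr_eq0 gt_eqF.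
Qed.

(** [Beta_neg] is applied with [b = g'], since [(alpha - 1) / p + 1 = alpha - g'], and with [b = g].
    The first summand is the term [1 / alpha] in disguise:
    [Beta 1 (2 - alpha) = 1 / (2 - alpha)]. *)
Lemma hardy_bracketE (alpha p : R) : 0 < alpha < 2 -> 1 < p -> alpha != 1 ->
  let g := hardy_exp alpha p in let g' := alpha - 1 - g in
  alpha * (alpha - 1) * - hardy_bracket alpha p =
  (alpha - 1) * (alpha - 1 - 1) * Beta (alpha - (alpha - 1)) (2 - alpha) -
  g * (g - 1) * Beta (alpha - g) (2 - alpha) -
  g' * (g' - 1) * Beta (alpha - g') (2 - alpha).
Proof.
move=> a02 p1 a1 g g'; have [gb gb' ga ga' /(_ a1)[g0 g0']] := hardy_exp_bounds a02 p1.
rewrite -/g -/g' in gb gb' ga ga' g0 g0'.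
have /andP[a0 a2] := a02.
rewrite /hardy_bracket (negbTE a1) -/(hardy_exp alpha p) -/g.
rewrite (@Beta_neg _ (g + 1) g' alpha)//; [|by rewrite /g'; ring|by case/andP: gb; lra].
rewrite (@Beta_neg _ (alpha - g) g alpha)//; last by rewrite subr_gt0.
have -> : alpha - g' = g + 1 by rewrite /g'; ring.
have -> : alpha - (alpha - 1) = 1 by ring.
have -> : Beta 1 (2 - alpha) = (2 - alpha)^-1.
  rewrite /Beta Gamma1 mul1r [1 + _]addrC Gamma_add1; last by lra.
  have := @Gamma_gt0 _ (2 - alpha); rewrite subr_gt0 => /(_ a2) G0.
  by rewrite invfM mulrCA divff ?mulr1// gt_eqF.
field.
have -> : alpha - 1 != 0 by rewrite subr_eq0.
by rewrite !gt_eqF// subr_gt0.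
Qed.

(** Each power [c = alpha - 1, g, g', 0] of [1 + s] is integrated by parts on [expanding_itv k]. The
    boundary terms at the right end vanish one by one in the limit, those at the left end only in
    combination. *)
Lemma hardy_bracket_cvg (alpha p : R) : 0 < alpha < 2 -> 1 < p ->
  let g := hardy_exp alpha p in let g' := alpha - 1 - g in
  (\int[leb]_(s in expanding_itv k) (hardy_fun g g' s * s `^ (- 1 - alpha))) @[k --> \oo]
  --> - hardy_bracket alpha p.
Proof.
have distr (A a b c d : R) : A * (a - b - c + d) = A * a - A * b - A * c + A * d by ring.
have regroup (a b c k1 k2 k3 k4 h1 h2 h3 h4 : R) :
    a + (k1 - h1) - (b + (k2 - h2)) - (c + (k3 - h3)) + (0 + (k4 - h4)) =
    a - b - c + (k1 - k2 - k3 + k4) - (h1 - h2 - h3 + h4) by ring.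
move=> a02 p1 g g'; have [gb gb' ga ga' gn0] := hardy_exp_bounds a02 p1.
rewrite -/g -/g' in gb gb' ga ga' gn0.
have /andP[a0 a2] := a02.
have [a1|a1] := eqVneq alpha 1.
  (* At [alpha = 1] the exponent [g] is 0, so the integrand vanishes identically, in agreement with
     the value assigned to the bracket. *)
  have -> : hardy_bracket alpha p = 0 by rewrite /hardy_bracket a1 eqxx.
  rewrite oppr0 (_ : (fun k => _) = cst 0); first exact: cvg_cst.
  apply/funext => k; rewrite /Rintegral integral0_eq//= => s _.
  by rewrite /hardy_fun /g /hardy_exp a1 subrr mul0r powRr0 subrr !mul0r.
have [g0 g0'] := gn0 a1.
have gg : g + g' = alpha - 1 by rewrite /g'; ring.
have aa : alpha * (alpha - 1) != 0 by rewrite mulf_neq0 ?subr_eq0// gt_eqF.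
pose J c k := \int[leb]_(s in expanding_itv k) ((1 + s) `^ c * s `^ (- 1 - alpha)).
pose I c k := \int[leb]_(s in expanding_itv k) beta_fun (alpha - c) (2 - alpha) s.
pose V k := \int[leb]_(s in expanding_itv k) (hardy_fun g g' s * s `^ (- 1 - alpha)).
have cJ c (x : R) : 0 < x -> {for x, continuous (fun s : R => (1 + s) `^ c * s `^ (- 1 - alpha))}.
  by move=> x0; apply: cvgM; [exact: continuous_powR1D|exact: continuous_powR].
have iJ c k : leb.-integrable (expanding_itv k) (EFin \o (fun s => (1 + s) `^ c * s `^ (- 1 - alpha))).
  by apply: integrable_expanding_itv; exact: cJ.
have mE := @measurable_expanding_itv R.
have VE k : V k = J (alpha - 1) k - J g k - J g' k + J 0 k.
  rewrite /J -RintegralB// -RintegralB//; last first.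
    by apply: integrable_expanding_itv => x x0; apply: cvgB; exact: cJ.
  rewrite -RintegralD//; last first.
    by apply: integrable_expanding_itv => x x0; apply: cvgB; [apply: cvgB|]; exact: cJ.
  apply: eq_Rintegral => s; rewrite inE => /expanding_itv_gt0 s0.
  have s1 : 0 < 1 + s by rewrite addr_gt0.
  by rewrite /hardy_fun -gg gt0_powRD// powRr0; ring.
pose B c (s : R) := bdry_term alpha c s.
have E k : (0 < k)%N -> V k = (alpha * (alpha - 1))^-1 *
    (((alpha - 1) * (alpha - 1 - 1) * I (alpha - 1) k - g * (g - 1) * I g k - g' * (g' - 1) * I g' k)
     + (B (alpha - 1) k.+1%:R - B g k.+1%:R - B g' k.+1%:R + B 0 k.+1%:R)
     - (B (alpha - 1) k.+1%:R^-1 - B g k.+1%:R^-1 - B g' k.+1%:R^-1 + B 0 k.+1%:R^-1)).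
  move=> k0; apply: (mulfI aa); rewrite mulVKf// VE.
  have JE c : alpha * (alpha - 1) * J c k = c * (c - 1) * I c k + (B c k.+1%:R - B c k.+1%:R^-1).
    exact: integral_bdry_term.
  by rewrite distr !JE (mul0r (0 - 1)) (mul0r (I 0 k)); exact: regroup.
have LI c : c < alpha -> I c k @[k --> \oo] --> Beta (alpha - c) (2 - alpha).
  by move=> ca; apply: Rintegral_beta_fun_cvg; rewrite subr_gt0.
(* A common bound below [alpha] for the four exponents, as [bdry_term_cvg0] requires. *)
pose c' := Num.max 0 (alpha - 1).
have c'0 : 0 <= c' by rewrite le_max lexx.
have c'1 : alpha - 1 <= c' by rewrite le_max lexx orbT.
have c'b : c' <= 1 by rewrite ge_max ler01/=; lra.
have c'a : c' < alpha by rewrite gt_max a0/=; lra.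
have p0 : 0 < p by exact: lt_trans p1.
have q0 : 0 < p^-1 by rewrite invr_gt0.
have q1 : p^-1 < 1 by rewrite invf_lt1.
have c'g : g <= c'.
  by rewrite le_max /g /hardy_exp; have [h|h] := leP alpha 1; apply/orP; [left|right]; nra.
have c'g' : g' <= c'.
  by rewrite le_max /g' /g /hardy_exp; have [h|h] := leP alpha 1; apply/orP; [left|right]; nra.
have gc : -1 <= g <= 1 by case/andP: gb => *; rewrite !ltW.
have gc' : -1 <= g' <= 1 by case/andP: gb' => *; rewrite !ltW.
have LB c : c <= c' -> -1 <= c <= 1 -> B c k.+1%:R @[k --> \oo] --> (0 : R).
  by move=> cc cb; apply: (@bdry_term_cvg0 _ alpha c c') => //; apply/andP.
apply: (@cvg_trans _ _ _ _ (near_eq_cvg _)).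
  near=> k; apply/esym/E; near: k; exact: nbhs_infty_gt.
have -> : - hardy_bracket alpha p = (alpha * (alpha - 1))^-1 *
    (((alpha - 1) * (alpha - 1 - 1) * Beta (alpha - (alpha - 1)) (2 - alpha)
      - g * (g - 1) * Beta (alpha - g) (2 - alpha) - g' * (g' - 1) * Beta (alpha - g') (2 - alpha))
     + (0 - 0 - 0 + 0) - 0).
  by apply: (mulfI aa); rewrite mulVKf// hardy_bracketE// -/g -/g'; ring.
apply: cvgM; first exact: cvg_cst.
apply: cvgB; last exact: (bdry_combination_cvg0 a02 gg gc gc').
have am : alpha - 1 < alpha by lra.
apply: cvgD.
  apply: cvgB; [apply: cvgB|]; (apply: cvgM; [exact: cvg_cst|exact: LI]).
apply: cvgD; [apply: cvgB; [apply: cvgB|]|]; apply: LB => //.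
- by apply/andP; split; lra.
- by apply/andP; split; lra.
Unshelve. all: by end_near. Qed.

End bracket_cvg.

(** * Integration over row vectors, one coordinate at a time *)

Section space.
Context {R : realType}.
Local Notation leb := (@lebesgue_measure R).

(** The squared Euclidean distance is kept without the root: it is additive when a coordinate is
    split off. *)
Definition sqdist n (x y : 'rV[R]_n) : R := \sum_(i < n) (x ord0 i - y ord0 i) ^+ 2.

Lemma sqdist_ge0 n (x y : 'rV[R]_n) : 0 <= sqdist x y.
Proof. by apply: sumr_ge0 => i _; exact: sqr_ge0. Qed.

Lemma sqdistC n (x y : 'rV[R]_n) : sqdist x y = sqdist y x.
Proof. by apply: eq_bigr => i _; rewrite -sqrrN opprB. Qed.

Lemma sqdist_cons n (a b : R) (x y : 'rV[R]_n) :
  sqdist (cons_rV (a, x)) (cons_rV (b, y)) = (a - b) ^+ 2 + sqdist x y.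
Proof.
rewrite /sqdist big_ord_recl; congr (_ + _); first by rewrite -!/(rV_coord _ _) !cons_rV0.
by apply: eq_bigr => i _; rewrite -!/(rV_coord _ _) !cons_rVS.
Qed.

Lemma sqdist_gt0 n (x y : 'rV[R]_n) i : x ord0 i != y ord0 i -> 0 < sqdist x y.
Proof.
move=> xy; rewrite /sqdist (bigD1 i)//= ltr_pwDl//; last by apply: sumr_ge0 => j _; exact: sqr_ge0.
by rewrite exprn_even_gt0//= subr_eq0.
Qed.

Lemma measurable_coord n (i : 'I_n) d (T : measurableType d) (f : T -> 'rV[R]_n) :
  measurable_fun setT f -> measurable_fun setT (fun t => f t ord0 i).
Proof. by move=> mf; apply: (measurableT_comp (measurable_rV_coord i)). Qed.

Lemma measurable_sqdist n d (T : measurableType d) (f g : T -> 'rV[R]_n) :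
  measurable_fun setT f -> measurable_fun setT g ->
  measurable_fun setT (fun t => sqdist (f t) (g t)).
Proof.
move=> mf mg; apply: measurable_sum => i; apply: measurable_funX.
by apply: measurable_funB; exact: measurable_coord.
Qed.

(** The first coordinate becomes the inner variable, so repeated use removes coordinates from the
    front and leaves [x_(d-1)] and [x_d]. *)
Lemma integral_rV_cons n (F : 'rV[R]_n.+1 -> \bar R) :
  measurable_fun setT F -> (forall x, (0 <= F x)%E) ->
  (\int[lebesgue_rV n.+1]_x F x =
   \int[lebesgue_rV n]_y \int[leb]_a F (cons_rV (a, y)))%E.
Proof.
move=> mF F0; rewrite /= /lebesgue_rV_step ge0_integral_pushforward//; last exact: measurable_cons_rV.
rewrite preimage_setT.
have mFc : measurable_fun setT (F \o @cons_rV R n).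
  by apply: measurableT_comp => //; exact: measurable_cons_rV.
by rewrite (@fubini_tonelli2 _ _ _ _ _ leb (lebesgue_rV n) (F \o @cons_rV R n) mFc) => [//|p]; exact: F0.
Qed.

Lemma integral_rV_cons2 (F : 'rV[R]_2 -> \bar R) :
  measurable_fun setT F -> (forall x, (0 <= F x)%E) ->
  (\int[lebesgue_rV 2]_x F x =
   \int[leb]_b \int[leb]_a F (cons_rV (a, cons_rV (b, 0%R : 'rV[R]_0))))%E.
Proof.
move=> mF F0; rewrite integral_rV_cons//.
have mFc : measurable_fun setT (F \o @cons_rV R 1).
  by apply: measurableT_comp => //; exact: measurable_cons_rV.
have mG := @measurable_fun_fubini_tonelli_G _ _ _ _ _ leb (F \o @cons_rV R 1) mFc (fun=> F0 _).
rewrite (@integral_rV_cons 0)//; last by move=> x; apply: integral_ge0 => a _; exact: F0.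
rewrite /= integral_dirac//; last first.
  have mGc : measurable_fun setT ((fubini_G leb (F \o @cons_rV R 1)) \o @cons_rV R 0).
    by apply: measurableT_comp => //; exact: measurable_cons_rV.
  apply: (@measurable_fun_fubini_tonelli_G _ _ _ _ _ leb _ mGc) => p.
  by rewrite /= /fubini_G; apply: integral_ge0 => a _; exact: F0.
by rewrite diracT mul1e.
Qed.

End space.

Section kernel.
Context {R : realType}.
Local Notation leb := (@lebesgue_measure R).

Definition last_coord n (x : 'rV[R]_n.+2) : R := x ord0 ord_max.
Definition penult_coord n (x : 'rV[R]_n.+2) : R := x ord0 (inord n).

Lemma last_coord_cons n (a : R) (x : 'rV[R]_n.+2) : last_coord (cons_rV (a, x)) = last_coord x.
Proof.
rewrite /last_coord (_ : ord_max = lift ord0 ord_max); last exact/val_inj.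
by rewrite -/(rV_coord _ _) cons_rVS.
Qed.

Lemma penult_coord_cons n (a : R) (x : 'rV[R]_n.+2) :
  penult_coord (cons_rV (a, x)) = penult_coord x.
Proof.
rewrite /penult_coord (_ : inord n.+1 = lift ord0 (inord n)).
  by rewrite -/(rV_coord _ _) cons_rVS.
by apply/val_inj; rewrite /= /bump/= !inordK.
Qed.

Lemma last_coord2 (a b : R) : last_coord (cons_rV (a, cons_rV (b, 0 : 'rV[R]_0))) = b.
Proof.
rewrite /last_coord (_ : ord_max = lift ord0 ord0); last exact/val_inj.
by rewrite -/(rV_coord _ _) cons_rVS cons_rV0.
Qed.

Lemma penult_coord2 (a b : R) : penult_coord (cons_rV (a, cons_rV (b, 0 : 'rV[R]_0))) = a.
Proof.
rewrite /penult_coord (_ : inord 0 = ord0); last by apply/val_inj; rewrite /= inordK.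
by rewrite -/(rV_coord _ _) cons_rV0.
Qed.

Lemma sqdist2 (x : 'rV[R]_2) (a b : R) : sqdist x (cons_rV (a, cons_rV (b, 0 : 'rV[R]_0))) =
  (penult_coord x - a) ^+ 2 + (last_coord x - b) ^+ 2.
Proof.
rewrite -[x]uncons_rVK /uncons_rV sqdist_cons; set x' := (\row_i _).
rewrite -[x']uncons_rVK /uncons_rV sqdist_cons /sqdist big_ord0 addr0.
rewrite [X in cons_rV (x' _ _, X)](_ : _ = 0); last by apply/rowP => -[].
by rewrite last_coord2 penult_coord2.
Qed.

Lemma integral_kernel1_shift (s A c : R) : 2^-1 < s -> 0 < A ->
  (\int[leb]_a (((c - a) ^+ 2 + A) `^ (- s))%:E =
   (Num.sqrt pi * Gamma (s - 2^-1) / Gamma s * A `^ (- (s - 2^-1)))%:E)%E.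
Proof.
move=> s2 A0; rewrite -integral_kernel1//.
have mf : measurable_fun [set: R] (fun z => (((A + z ^+ 2) `^ (- s))%:E : \bar R)).
  apply/measurable_EFinP; apply: (measurableT_comp (measurable_powR (- s))).
  by apply: measurable_funD => //; exact: measurable_funX.
rewrite [RHS](@ge0_integral_affine _ 1 (- c))//; last by move=> x; rewrite lee_fin powR_ge0.
rewrite mul1e; apply: eq_integral => a _; congr (_ `^ _)%:E.
by rewrite mul1r addrC; congr (_ + _); rewrite -sqrrN opprB.
Qed.

(** Induction on the number of coordinates to remove: each one costs the factor
    [sqrt pi * Gamma (s - 1/2) / Gamma s] and lowers [s] by one half, and the product telescopes.
    The weight must vanish at the height of [x], because [integral_kernel1_shift] needs a positive
    distance in the remaining coordinates. *)
Lemma integral_kernel n (s : R) (x : 'rV[R]_n.+2) (G : R * R -> R) :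
  n%:R / 2 < s -> measurable_fun [set: R * R]%type G -> (forall p, 0 <= G p) ->
  (forall a, G (a, last_coord x) = 0) ->
  (\int[lebesgue_rV n.+2]_y (G (penult_coord y, last_coord y) * sqdist x y `^ (- s))%:E =
   (pi `^ (n%:R / 2) * Gamma (s - n%:R / 2) / Gamma s)%:E *
   \int[leb]_b \int[leb]_a (G (a, b) *
     ((penult_coord x - a) ^+ 2 + (last_coord x - b) ^+ 2) `^ (- (s - n%:R / 2)))%:E)%E.
Proof.
move=> + mG G0.
have mF m (z : 'rV[R]_m.+2) r : measurable_fun [set: 'rV[R]_m.+2]
    (fun y => (G (penult_coord y, last_coord y) * sqdist z y `^ (- r))%:E).
  apply/measurable_EFinP/measurable_funM.
    apply: (measurableT_comp mG); apply: measurable_fun_pair; exact: measurable_rV_coord.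
  by apply: (measurableT_comp (measurable_powR _)); exact: measurable_sqdist.
have F0 m (z y : 'rV[R]_m.+2) r : (0 <= (G (penult_coord y, last_coord y) * sqdist z y `^ (- r))%:E)%E.
  by rewrite lee_fin mulr_ge0 ?powR_ge0.
elim: n s x => [|n IH] s x ns Gx.
  rewrite mul0r subr0 powRr0 mul1r divff ?mul1e; last first.
    by rewrite gt_eqF// Gamma_gt0//; rewrite mul0r in ns.
  rewrite (integral_rV_cons2 (mF 0 x s) (fun y => F0 0 x y s)).
  apply: eq_integral => b _; apply: eq_integral => a _.
  by rewrite last_coord2 penult_coord2 sqdist2.
move: Gx; rewrite -[x]uncons_rVK; case: (uncons_rV x) => {x} x0 x'; set x := cons_rV _ => Gx.
rewrite (integral_rV_cons (mF n.+1 x s) (fun y => F0 n.+1 x y s)); move: ns; rewrite -natr1 => ns.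
have s2 : 2^-1 < s by rewrite (le_lt_trans _ ns)// mulrDl mul1r lerDr divr_ge0.
have s0 : 0 < s by rewrite (lt_trans _ s2).
transitivity (\int[lebesgue_rV n.+2]_y ((Num.sqrt pi * Gamma (s - 2^-1) / Gamma s)%:E *
    (G (penult_coord y, last_coord y) * sqdist x' y `^ (- (s - 2^-1)))%:E))%E.
  apply: eq_integral => y _.
  under eq_integral do rewrite last_coord_cons penult_coord_cons /x sqdist_cons EFinM.
  rewrite ge0_integralZl_EFin//; last 2 first.
  - by move=> a _; rewrite lee_fin powR_ge0.
  - apply/measurable_EFinP; apply: (measurableT_comp (measurable_powR _)).
    by apply: measurable_funD => //; apply: measurable_funX; exact: measurable_funB.
  have [yx|yx] := eqVneq (last_coord y) (last_coord x).
    by rewrite yx Gx mul0r !mule0 mul0e.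
  rewrite integral_kernel1_shift//; last first.
    apply: (@sqdist_gt0 _ _ _ _ ord_max); rewrite -!/(last_coord _) eq_sym.
    by rewrite /x last_coord_cons in yx.
  by rewrite -!EFinM mulrCA.
rewrite ge0_integralZl_EFin//; last 2 first.
- exact: mF.
- by rewrite !mulr_ge0// ?invr_ge0 Gamma_ge0// subr_gt0.
have xl : last_coord x = last_coord x' by rewrite /x last_coord_cons.
have xp : penult_coord x = penult_coord x' by rewrite /x penult_coord_cons.
rewrite IH; last 2 first.
- by move: ns; rewrite mulrDl mul1r; lra.
- by move=> a; rewrite -xl.
rewrite muleA -EFinM -xl -xp.
have -> : s - 2^-1 - n%:R / 2 = s - (n%:R + 1) / 2 by field.
congr (_%:E * _)%E.
have -> : (n%:R + 1) / 2 = n%:R / 2 + 2^-1 :> R by field.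
rewrite gt0_powRD ?pi_gt0// powR12_sqrt ?pi_ge0//.
have G1 : Gamma (s - 2^-1) != 0 by rewrite gt_eqF// Gamma_gt0// subr_gt0.
have G2 : Gamma s != 0 by rewrite gt_eqF// Gamma_gt0.
by field; rewrite G1 G2.
Qed.

End kernel.

(** * Measurability and bounds for continuous functions of compact support *)

Section topology_rV.
Context {R : realType}.
Local Notation leb := (@lebesgue_measure R).

(** Balls of the sup norm are boxes, so an open set is the countable union of the boxes with
    rational centre and radius [1 / (k + 1)] that it contains. *)
Lemma open_measurable_rV n (U : set 'rV[R]_n) : open U -> measurable U.
Proof.
move=> oU.
pose B (q : 'rV[rat]_n * nat) : set 'rV[R]_n :=
  [set x | forall i, ball (ratr (q.1 ord0 i) : R) q.2.+1%:R^-1 (x ord0 i)].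
have mB q : measurable (B q).
  apply: (@measurable_rV_box R n (fun i => ball (ratr (q.1 ord0 i) : R) q.2.+1%:R^-1)) => i.
  exact: measurable_ball.
have -> : U = \bigcup_q (if `[< B q `<=` U >] then B q else set0).
  apply/seteqP; split => [x Ux|x [q _]]; last first.
    by case: ifPn => // /asboolP; apply.
  have [e/= e0 xeU] : exists2 e : R, 0 < e & ball x e `<=` U.
    by move: oU; rewrite openE => /(_ x Ux) /nbhs_ballP[e /= e0 eU]; exists e.
  (* With radius below [e / 2], a box whose centre is within one radius of [x] lies in the ball of
     radius [e] around [x]. *)
  pose k := Num.trunc (2 / e).
  have ke : k.+1%:R^-1 < e / 2 :> R.
    rewrite -[e / 2]invrK ltf_pV2 ?posrE ?invr_gt0 ?divr_gt0// invf_div.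
    by have /andP[] := @trunc_itv _ (2 / e) (ltW (divr_gt0 (@ltr0n R 2) e0)).
  have k0 : 0 < k.+1%:R^-1 :> R by rewrite invr_gt0.
  have [r rE] : exists r : R, r = k.+1%:R^-1 by exists k.+1%:R^-1.
  rewrite -rE in ke k0.
  have /choice[q qx] : forall i, exists q : rat, `|ratr q - x ord0 i| < r.
    move=> i; have /rat_in_itvoo[q] : x ord0 i - r < x ord0 i + r by lra.
    rewrite in_itv/= => /andP[h1 h2]; exists q; rewrite ltr_norml; apply/andP; split; lra.
  exists (\row_i q i, k) => //.
  have BU : B (\row_i q i, k) `<=` U.
    move=> y By; apply: xeU; split => // i j; rewrite ord1 /ball/=.
    have := By j; rewrite /ball/= mxE -rE => h1; have h2 := qx j.
    rewrite (_ : x ord0 j - y ord0 j = (ratr (q j) - y ord0 j) - (ratr (q j) - x ord0 j)); last by ring.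
    by rewrite (le_lt_trans (ler_normB _ _))//; lra.
  by case: asboolP => // _ i; rewrite /ball/= mxE -rE.
apply: countable_bigcupT_measurable; first exact: countableP.
by move=> q; case: ifP.
Qed.

Lemma within_continuous_measurable_rV n (D : set 'rV[R]_n) (f : 'rV[R]_n -> R) :
  open D -> {within D, continuous f} -> measurable_fun D f.
Proof.
move=> oD /continuousP cf; apply: (measurability _ (RGenOpens.measurableE R)).
move=> _ [_ [a [b ->] <-]].
have /cf /open_subspaceP [V oV VD] : open (`]a, b[%classic : set R) by exact: interval_open.
have -> : D `&` f @^-1` `]a, b[%classic = V `&` D by rewrite setIC -VD.
by apply: measurableI; exact: open_measurable_rV.
Qed.

Lemma compact_continuous_bounded (T : topologicalType) (K : set T) (f : T -> R) :
  compact K -> {within K, continuous f} -> exists2 M : R, 0 <= M & forall x, K x -> `|f x| <= M.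
Proof.
move=> cK cf; have /compact_bounded [M [_ HM]] := continuous_compact cf cK.
exists (`|M| + 1); first by rewrite addr_ge0.
move=> x Kx; apply: (HM (`|M| + 1)); last by exists x.
by rewrite (le_lt_trans (ler_norm _))// ltrDl.
Qed.

Lemma coord_continuous_rV n (i : 'I_n) : continuous (fun x : 'rV[R]_n => x ord0 i).
Proof. exact: coord_continuous. Qed.

Lemma open_halfspace n : open (@halfspace R n).
Proof.
rewrite (_ : @halfspace R n = (fun x : 'rV[R]_n.+1 => x ord0 ord_max) @^-1` [set t : R | 0 < t])//.
apply: open_comp; last exact: open_gt.
by move=> x _; exact: coord_continuous_rV.
Qed.

Lemma Cc_bounded n (Om : set 'rV[R]_n) (u : 'rV[R]_n -> R) : Cc Om u ->
  exists2 M : R, 0 <= M & forall x, Om x -> `|u x| <= M.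
Proof.
move=> [cu cK KO].
have cuK := continuous_subspaceW KO cu.
have [M M0 HM] := compact_continuous_bounded cK cuK; exists M => // x Ox.
have [->|ux] := eqVneq (u x) 0; first by rewrite normr0.
by apply: HM; apply: subset_closure.
Qed.

Lemma Cc_coord_bounded n (Om : set 'rV[R]_n) (u : 'rV[R]_n -> R) : Cc Om u ->
  exists2 B : R, 0 < B & forall x, Om x -> u x != 0 -> forall i, `|x ord0 i| <= B.
Proof.
move=> [_ cK KO].
have /choice[b Hb] : forall i, exists M : R, 0 <= M /\
    forall x, closure (Om `&` [set x | u x != 0]) x -> `|x ord0 i| <= M.
  move=> i; have [|M M0 HM] := @compact_continuous_bounded _ _ (fun x : 'rV[R]_n => x ord0 i) cK.
    by apply: continuous_subspaceT; exact: coord_continuous_rV.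
  by exists M.
exists (1 + \sum_i b i); first by rewrite ltr_pwDl// sumr_ge0// => i _; have [] := Hb i.
move=> x Ox ux i; have [bi /(_ x)] := Hb i.
move=> /(_ (@subset_closure _ _ _ (conj Ox ux))) /le_trans; apply.
rewrite (bigD1 i)//= addrCA lerDl addr_ge0//; apply: sumr_ge0 => j _; by have [] := Hb j.
Qed.

(** The support is a compact subset of the open half-space, so [1 / x_d] is continuous and bounded
    on it. *)
Lemma Cc_halfspace_away n (u : 'rV[R]_n.+1 -> R) : Cc (@halfspace R n) u ->
  exists2 m : R, 0 < m & forall x, @halfspace R n x -> u x != 0 -> m <= x ord0 ord_max.
Proof.
move=> [_ cK KO].
have [|M M0 HM] := @compact_continuous_bounded _ _ (fun x : 'rV[R]_n.+1 => (x ord0 ord_max)^-1) cK.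
  apply: continuous_in_subspaceT => x; rewrite inE => /KO xO.
  apply: (@continuous_comp _ _ _ (fun x : 'rV[R]_n.+1 => x ord0 ord_max) (fun t : R => t^-1)).
    exact: coord_continuous_rV.
  by apply: inv_continuous; rewrite gt_eqF.
exists (M + 1)^-1; first by rewrite invr_gt0 ltr_pwDr.
move=> x xO ux; have := HM x (@subset_closure _ _ _ (conj xO ux)).
have x0 : 0 < x ord0 ord_max := xO.
rewrite ger0_norm ?invr_ge0 ?(ltW x0)// => h.
rewrite -[leRHS]invrK lef_pV2 ?posrE ?invr_gt0 ?ltr_pwDr//.
by rewrite (le_trans h)// lerDl.
Qed.

End topology_rV.

(** * Pointwise Young and Bregman inequalities *)

Section pointwise.
Context {R : realType}.
Variables (p : R) (p1 : 1 < p).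

Let p0 : 0 < p. Proof. exact: lt_trans p1. Qed.

Lemma mul_spow (a : R) : a * spow a (p - 1) = `|a| `^ p.
Proof.
rewrite /spow mulrCA [a * _]mulrC -normrEsg mulrC; exact: mulr_powRB1.
Qed.

Lemma norm_spow (a : R) : `|spow a (p - 1)| = `|a| `^ (p - 1).
Proof.
rewrite /spow normrM normr_sg (ger0_norm (powR_ge0 _ _)).
have [->|a0] := eqVneq a 0; last by rewrite mulr1.
by rewrite mulr0 normr0 powR0// gt_eqF// subr_gt0.
Qed.

Lemma spowZ (s a : R) : 0 < s -> spow (s * a) (p - 1) = s `^ (p - 1) * spow a (p - 1).
Proof.
move=> s0; rewrite /spow normrM (gtr0_norm s0) sgrM (gtr0_sg s0) mul1r.
by rewrite powRM ?(ltW s0)// mulrA.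
Qed.

(** Young's inequality with exponents [p] and [p / (p - 1)] for [|b|] and [|a|^(p-1)]. *)
Lemma young_spow (a b : R) : b * spow a (p - 1) <= `|b| `^ p / p + (1 - p^-1) * `|a| `^ p.
Proof.
apply: (le_trans (ler_norm _)); rewrite normrM norm_spow.
have q0 : 0 < p / (p - 1) by rewrite divr_gt0// subr_gt0.
have pn : p - 1 != 0 by rewrite subr_eq0 gt_eqF.
have pn0 : p != 0 by rewrite gt_eqF.
have := @conjugate_powR _ `|b| (`|a| `^ (p - 1)) _ _ (normr_ge0 _) (powR_ge0 _ _) p0 q0.
rewrite -powRrM (_ : (p - 1) * _ = p); last by field; rewrite pn.
rewrite invf_div (_ : p^-1 + _ = 1); last by field; rewrite pn0.
move=> /(_ erefl) /le_trans; apply; rewrite lerD2l mulrC ler_wpM2r ?powR_ge0//.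
by rewrite (_ : _ / p = 1 - p^-1)//; field.
Qed.

Let theta : R := 2 `^ (- p^-1).

(* |a|^p > 2 |b|^p means |b| < theta |a|. *)
Definition bregman_cst : R := (1 - theta) * (1 - theta `^ (p - 1)).

Let theta_gt0 : 0 < theta. Proof. by rewrite powR_gt0. Qed.

Let theta_lt1 : theta < 1.
Proof.
rewrite /theta powRN invf_lt1 ?powR_gt0//.
have := @gt0_ltr_powR R p^-1; rewrite invr_gt0 => /(_ p0 1 2).
by rewrite powR1 !nnegrE; apply=> //; rewrite ltr1n.
Qed.

Lemma bregman_cst_gt0 : 0 < bregman_cst.
Proof.
rewrite mulr_gt0 ?subr_gt0//.
have := @gt0_ltr_powR R (p - 1); rewrite subr_gt0 => /(_ p1 theta 1).
by rewrite powR1 !nnegrE; apply => //; exact: ltW.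
Qed.

(** Passing to absolute values keeps the diagonal terms and can only increase the cross terms, which
    are subtracted. *)
Lemma sobolev_bregman_ge_norm (a b : R) :
  (`|a| - `|b|) * (`|a| `^ (p - 1) - `|b| `^ (p - 1)) <=
  (a - b) * (spow a (p - 1) - spow b (p - 1)).
Proof.
rewrite !mulrBl !mulrBr !mul_spow !mulr_powRB1//.
have h1 : a * spow b (p - 1) <= `|a| * `|b| `^ (p - 1).
  by apply: (le_trans (ler_norm _)); rewrite normrM norm_spow.
have h2 : b * spow a (p - 1) <= `|b| * `|a| `^ (p - 1).
  by apply: (le_trans (ler_norm _)); rewrite normrM norm_spow.
by lra.
Qed.

Lemma sobolev_bregman_ge0 (a b : R) : 0 <= (a - b) * (spow a (p - 1) - spow b (p - 1)).
Proof.
apply: (le_trans _ (sobolev_bregman_ge_norm a b)).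
have p1' : 0 <= p - 1 by rewrite subr_ge0 ltW.
have [h|/ltW h] := leP `|b| `|a|.
  by rewrite mulr_ge0 ?subr_ge0//; apply: ge0_ler_powR.
by rewrite mulr_le0 ?subr_le0//; apply: ge0_ler_powR.
Qed.

(** The form vanishes at [a = b], so no positive multiple of [|a|^p] alone bounds it from below.
    Subtracting [2 |b|^p] leaves something to prove only if [|b|] is less than a fixed fraction of
    [|a|], and then both factors are comparable to their values at [b = 0]. *)
Lemma sobolev_bregman_ge (a b : R) :
  bregman_cst * (`|a| `^ p - 2 * `|b| `^ p) <= (a - b) * (spow a (p - 1) - spow b (p - 1)).
Proof.
have c0 := ltW bregman_cst_gt0.
have [h|h] := leP (`|a| `^ p) (2 * `|b| `^ p).
  by apply: le_trans (sobolev_bregman_ge0 a b); rewrite mulr_ge0_le0// subr_le0.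
have ba : `|b| <= theta * `|a|.
  rewrite leNgt; apply/negP => hb.
  have := @gt0_ltr_powR R p p0 (theta * `|a|) `|b|.
  rewrite !nnegrE => /(_ (mulr_ge0 (ltW theta_gt0) (normr_ge0 _)) (normr_ge0 _) hb).
  rewrite powRM ?(ltW theta_gt0)// /theta -powRrM mulNr mulVf ?gt_eqF//.
  by rewrite powR_inv1//; lra.
have p1' : 0 <= p - 1 by rewrite subr_ge0 ltW.
have ba' : `|b| `^ (p - 1) <= theta `^ (p - 1) * `|a| `^ (p - 1).
  rewrite -powRM ?(ltW theta_gt0)//; apply: ge0_ler_powR => //.
  by rewrite nnegrE mulr_ge0// ltW.
apply: (le_trans _ (sobolev_bregman_ge_norm a b)).
apply: (@le_trans _ _ (bregman_cst * `|a| `^ p)).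
  by rewrite ler_wpM2l// gerBl mulr_ge0// powR_ge0.
rewrite -(mulr_powRB1 (normr_ge0 a) p0) /bregman_cst mulrACA.
have t1 : theta `^ (p - 1) <= 1.
  have := @ge0_ler_powR R (p - 1) p1' theta 1.
  by rewrite powR1 !nnegrE; apply => //; exact: ltW.
apply: ler_pM.
- by rewrite mulr_ge0// subr_ge0 ltW.
- by rewrite mulr_ge0 ?powR_ge0// subr_ge0.
- by rewrite mulrBl mul1r lerD2l lerN2.
- by rewrite mulrBl mul1r lerD2l lerN2.
Qed.

(** The coefficient that [|a|^p] receives from the two weighted Young inequalities; the coefficient
    of [|t|^p] is [s^p] times the same function at [1 / s]. *)
Definition young_weight (s : R) : R := (1 - p^-1) * s + s `^ (p - 1) / p.

(* With b = s t this is Young's inequality for (t, a) and for (a, t), weighted by s and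
   s^(p-1); the two deficits add up to the Bregman form at (a, t). *)
Lemma ground_state_pointwise (s eta a b : R) : 0 < s -> 0 <= eta ->
  eta <= bregman_cst * s -> eta <= bregman_cst * s `^ (p - 1) ->
  `|a| `^ p + `|b| `^ p + eta * `|a| `^ p <=
  (a - b) * (spow a (p - 1) - spow b (p - 1)) + `|a| `^ p * young_weight s +
  `|b| `^ p * young_weight s^-1 + 2 * eta * (`|b| `^ p * s `^ (- p)).
Proof.
move=> s0 e0 e1 e2; pose t := b / s.
have bE : b = s * t by rewrite /t mulrC divfK// gt_eqF.
have c0 := bregman_cst_gt0.
have r0 : 0 < s `^ (p - 1) by rewrite powR_gt0.
have sp : s `^ p = s * s `^ (p - 1) by rewrite mulr_powRB1// ltW.
have bp : `|b| `^ p = s `^ p * `|t| `^ p.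
  by rewrite bE normrM (gtr0_norm s0) powRM// ltW.
have -> : `|b| `^ p * s `^ (- p) = `|t| `^ p.
  by rewrite bp mulrAC powRN divff ?mul1r// gt_eqF// powR_gt0.
have -> : `|b| `^ p * young_weight s^-1 =
    `|t| `^ p * ((1 - p^-1) * s `^ (p - 1) + s / p).
  have e : s^-1 `^ (p - 1) = (s `^ (p - 1))^-1.
    by rewrite -(powR_inv1 (ltW s0)) -powRrM mulN1r powRN.
  rewrite bp /young_weight e sp; move: (s `^ (p - 1)) r0 => r r0.
  by field; rewrite !gt_eqF.
have -> : (a - b) * (spow a (p - 1) - spow b (p - 1)) =
    `|a| `^ p + `|b| `^ p - s * (t * spow a (p - 1)) - s `^ (p - 1) * (a * spow t (p - 1)).
  rewrite mulrBl !mulrBr !mul_spow bE (spowZ t s0); ring.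
have Y1 := young_spow a t; have Y2 := young_spow t a.
have D := sobolev_bregman_ge a t.
rewrite mulrBl !mulrBr !mul_spow in D.
rewrite /young_weight.
set r := s `^ (p - 1) in r0 e2 *.
set A := `|a| `^ p in Y1 Y2 D *; set T := `|t| `^ p in Y1 Y2 D *.
set x := t * _ in Y1 D *; set y := a * _ in Y2 D *.
pose G1 := T / p + (1 - p^-1) * A - x; pose G2 := A / p + (1 - p^-1) * T - y.
have G10 : 0 <= G1 by rewrite subr_ge0.
have G20 : 0 <= G2 by rewrite subr_ge0.
have GD : bregman_cst * (A - 2 * T) <= G1 + G2.
  by rewrite mulrBr; apply: le_trans D _; rewrite le_eqVlt; apply/orP; left; apply/eqP; rewrite /G1 /G2; ring.
(* [G1] and [G2] are the Young deficits. The smaller of their weights [s] and [r] can be put on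
   both, and [eta] is at most [bregman_cst] times either weight. *)
suff H : eta * (A - 2 * T) <= s * G1 + r * G2.
  rewrite -subr_ge0; move: H; rewrite -subr_ge0 => /le_trans; apply.
  by rewrite le_eqVlt; apply/orP; left; apply/eqP; rewrite /G1 /G2; ring.
have [h|h] := leP (A - 2 * T) 0.
  apply: (@le_trans _ _ 0); first by rewrite mulr_ge0_le0.
  by rewrite addr_ge0// mulr_ge0// ltW.
have h0 := ltW h.
have [sr|sr] := leP s r.
  apply: (@le_trans _ _ (s * (G1 + G2))).
    apply: (@le_trans _ _ (bregman_cst * s * (A - 2 * T))); first by rewrite ler_wpM2r.
    by rewrite mulrAC mulrC ler_wpM2l// ltW.
  by rewrite mulrDr lerD2l ler_wpM2r.
apply: (@le_trans _ _ (r * (G1 + G2))).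
  apply: (@le_trans _ _ (bregman_cst * r * (A - 2 * T))); first by rewrite ler_wpM2r.
  by rewrite mulrAC mulrC ler_wpM2l// ltW.
by rewrite mulrDr lerD2r ler_wpM2r// ltW.
Qed.

End pointwise.

(** * Reduction to the ratio of the last coordinates *)

Section transverse.
Context {R : realType}.
Local Notation leb := (@lebesgue_measure R).
Variable alpha : R.
Hypothesis a02 : 0 < alpha < 2.

Let a0 : 0 < alpha. Proof. by case/andP: a02. Qed.

(* |1 - t|^(-1-alpha) *)
Definition jump_kernel (t : R) : R := ((1 - t) ^+ 2) `^ (- ((1 + alpha) / 2)).

Definition slice_cst : R :=
  Num.sqrt pi * Gamma ((1 + alpha) / 2) / Gamma (1 + alpha / 2).

Lemma slice_cst_gt0 : 0 < slice_cst.
Proof. by rewrite mulr_gt0 ?invr_gt0 ?mulr_gt0 ?sqrtr_gt0 ?pi_gt0 ?Gamma_gt0 ?divr_gt0 ?addr_gt0 ?divr_gt0. Qed.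

Lemma measurable_jump_kernel : measurable_fun [set: R] jump_kernel.
Proof.
apply: (measurableT_comp (measurable_powR _)); apply: measurable_funX.
exact: measurable_funB.
Qed.

Lemma integral_slice (c A : R) : 0 < A ->
  (\int[leb]_a (((c - a) ^+ 2 + A) `^ (- (1 + alpha / 2)))%:E =
   (slice_cst * A `^ (- ((1 + alpha) / 2)))%:E)%E.
Proof.
move=> A0; rewrite integral_kernel1_shift//; last by rewrite ltr_pwDr ?divr_gt0// ltW// invf_lt1// ltr1n.
by rewrite (_ : 1 + alpha / 2 - 2^-1 = (1 + alpha) / 2)//; field.
Qed.

(* g 1 = 0 discards the line b = X, where the slice integral diverges. *)
Lemma integral_transverse (X c : R) (g : R -> R) : 0 < X ->
  measurable_fun [set: R] g -> (forall t, 0 <= g t) -> g 1 = 0 ->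
  (\int[leb]_b \int[leb]_a (g (b / X) * ((c - a) ^+ 2 + (X - b) ^+ 2) `^ (- (1 + alpha / 2)))%:E =
   (slice_cst * X `^ (- alpha))%:E * \int[leb]_t (g t * jump_kernel t)%:E)%E.
Proof.
move=> X0 mg g0 g1.
move: slice_cst slice_cst_gt0 integral_slice => C C0 slice.
have mh : measurable_fun [set: R] (fun b => ((g (b / X) * ((X - b) ^+ 2) `^ (- ((1 + alpha) / 2)))%:E : \bar R)).
  apply/measurable_EFinP/measurable_funM.
    by apply: (measurableT_comp mg); exact: measurable_funM.
  apply: (measurableT_comp (measurable_powR _)); apply: measurable_funX; exact: measurable_funB.
have h0 (b : R) : (0 <= (g (b / X) * ((X - b) ^+ 2) `^ (- ((1 + alpha) / 2)))%:E :> \bar R)%E.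
  by rewrite lee_fin mulr_ge0 ?powR_ge0.
transitivity (\int[leb]_b (C%:E * (g (b / X) * ((X - b) ^+ 2) `^ (- ((1 + alpha) / 2)))%:E))%E.
  apply: eq_integral => b _.
  under eq_integral do rewrite EFinM.
  rewrite ge0_integralZl_EFin//; last 2 first.
  - by move=> a _; rewrite lee_fin powR_ge0.
  - apply/measurable_EFinP; apply: (measurableT_comp (measurable_powR _)).
    by apply: measurable_funD => //; apply: measurable_funX; exact: measurable_funB.
  have [->|bX] := eqVneq b X.
    by rewrite divff ?gt_eqF// g1 mul0r mule0 mul0e.
  rewrite slice; last by rewrite exprn_even_gt0//= subr_eq0 eq_sym.
  by rewrite -!EFinM mulrCA.
have mj : measurable_fun [set: R] (fun t => ((g t * jump_kernel t)%:E : \bar R)).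
  by apply/measurable_EFinP; apply: measurable_funM => //; exact: measurable_jump_kernel.
have j0 (t : R) : (0 <= (g t * jump_kernel t)%:E :> \bar R)%E.
  by rewrite lee_fin mulr_ge0 ?powR_ge0.
rewrite ge0_integralZl_EFin; [|exact: measurableT|by move=> b _; exact: h0|exact: mh|exact: ltW].
(* Substitution [b = X t]: the factor [X] from the measure and [X^(-1-alpha)] from the kernel make
   [X^(-alpha)]. *)
have e := @ge0_integral_affine _ X 0 _ X0 mh h0.
apply: (eq_trans (f_equal (fun z => C%:E * z)%E e)); rewrite (EFinM C) -muleA; congr (_ * _)%E.
rewrite -[in RHS]ge0_integralZl_EFin; [|exact: measurableT|by move=> b _; exact: j0|exact: mj|exact: powR_ge0].
rewrite -[in LHS]ge0_integralZl_EFin; [|exact: measurableT|by move=> b _; exact: h0| |exact: ltW]; last first.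
  by apply: (measurableT_comp mh); apply: measurable_funD; [exact: measurable_funM|exact: measurable_cst].
apply: eq_integral => t _; rewrite addr0 -!EFinM; congr EFin.
rewrite [X * t]mulrC mulfK ?gt_eqF// /jump_kernel.
rewrite (_ : (X - t * X) ^+ 2 = X ^+ 2 * (1 - t) ^+ 2); last by ring.
rewrite powRM ?sqr_ge0// -powR_mulrn ?(ltW X0)// -powRrM.
rewrite (_ : 2%:R * _ = - alpha - 1); last by field.
rewrite mulrCA [RHS]mulrCA; congr (_ * _); rewrite mulrA; congr (_ * _).
rewrite -{1}(powRr1 (ltW X0)) -gt0_powRD//; congr (_ `^ _); ring.
Qed.

Lemma jump_kernel1D (s : R) : 0 < s -> jump_kernel (1 + s) = s `^ (- 1 - alpha).
Proof.
move=> s0; rewrite /jump_kernel (_ : (1 - (1 + s)) ^+ 2 = s ^+ 2); last by ring.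
by rewrite -powR_mulrn ?(ltW s0)// -powRrM; congr (_ `^ _); field.
Qed.

Lemma jump_kernelV (s : R) : 0 < s ->
  jump_kernel (1 + s)^-1 = s `^ (- 1 - alpha) * (1 + s) `^ (1 + alpha).
Proof.
move=> s0; have s1 : 0 < 1 + s by rewrite addr_gt0.
rewrite /jump_kernel (_ : (1 - (1 + s)^-1) ^+ 2 = s ^+ 2 * (1 + s) ^- 2); last first.
  by field; rewrite gt_eqF.
rewrite powRM ?sqr_ge0 ?invr_ge0 ?sqr_ge0//; congr (_ * _).
  by rewrite -powR_mulrn ?(ltW s0)// -powRrM; congr (_ `^ _); field.
by rewrite -powR_invn ?(ltW s1)// -powRrM; congr (_ `^ _); field.
Qed.

(** Image of [expanding_itv k] under [s |-> 1 + s]; [inner_itv] is its image under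
    [s |-> 1 / (1 + s)], and inversion exchanges the two. *)
Definition outer_itv k : set R := `[1 + k.+1%:R^-1, 1 + k.+1%:R]%classic.
Definition inner_itv k : set R := `[(1 + k.+1%:R)^-1, (1 + k.+1%:R^-1)^-1]%classic.

Lemma mem_inner_itv k (t : R) : 0 < t -> inner_itv k t <-> outer_itv k t^-1.
Proof.
move=> t0; rewrite /inner_itv /outer_itv/= !in_itv/=.
have h1 : 0 < 1 + k.+1%:R^-1 :> R by rewrite addr_gt0.
have h2 : 0 < 1 + k.+1%:R :> R by rewrite addr_gt0.
rewrite -[X in _ <= X <= _]invrK !lef_pV2 ?posrE ?invr_gt0//.
by split=> /andP[? ?]; apply/andP.
Qed.

Lemma outer_itv_gt1 k (t : R) : outer_itv k t -> 1 < t.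
Proof. by rewrite /outer_itv/= in_itv/= => /andP[+ _]; apply: lt_le_trans; rewrite ltrDl. Qed.

Lemma inner_itv_gt0 k (t : R) : inner_itv k t -> 0 < t.
Proof. by rewrite /inner_itv/= in_itv/= => /andP[+ _]; apply: lt_le_trans; rewrite invr_gt0 addr_gt0. Qed.

Lemma inner_itv_lt1 k (t : R) : inner_itv k t -> t < 1.
Proof.
rewrite /inner_itv/= in_itv/= => /andP[_]; move=> /le_lt_trans; apply.
by rewrite invf_lt1 ?ltrDl// addr_gt0.
Qed.

Lemma integral_outer_itv k (g : R -> R) : measurable_fun [set: R] g -> (forall t, 0 <= g t) ->
  (\int[leb]_(t in outer_itv k) (g t * jump_kernel t)%:E =
   \int[leb]_(s in expanding_itv k) (g (1 + s) * s `^ (- 1 - alpha))%:E)%E.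
Proof.
move=> mg g0; rewrite integral_mkcond [RHS]integral_mkcond.
set f := (X in (\int[_]_x X x)%E).
have mf : measurable_fun [set: R] f.
  apply/(measurable_restrictT _ _).1; first exact: measurable_itv.
  apply/measurable_EFinP/measurable_funTS/measurable_funM => //; exact: measurable_jump_kernel.
have f0 x : (0 <= f x)%E.
  by apply: erestrict_ge0 => y _; rewrite lee_fin mulr_ge0 ?powR_ge0.
rewrite (@ge0_integral_affine _ 1 1 _ ltr01 mf f0) mul1e; apply: eq_integral => s _.
rewrite /f !patchE mul1r [s + 1]addrC.
have -> : (1 + s \in outer_itv k) = (s \in expanding_itv k).
  by apply/idP/idP; rewrite !inE /outer_itv /expanding_itv/= !in_itv/= !lerD2l.
case: ifPn => //; rewrite inE => /expanding_itv_gt0 s0.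
by rewrite jump_kernel1D.
Qed.

(** Substitution [t = 1 / (1 + s)]: the kernel contributes [(1 + s)^(1 + alpha)] and the Jacobian
    [(1 + s)^(-2)], hence the weight [(1 + s)^(alpha - 1)]. *)
Lemma integral_inner_itv k (g : R -> R) : (0 < k)%N ->
  (forall t : R, 0 < t -> {for t, continuous g}) ->
  (\int[leb]_(t in inner_itv k) (g t * jump_kernel t)%:E =
   \int[leb]_(s in expanding_itv k) (g (1 + s)^-1 * (1 + s) `^ (alpha - 1) * s `^ (- 1 - alpha))%:E)%E.
Proof.
move=> k0 cg; have kk : k.+1%:R^-1 < k.+1%:R :> R.
  by rewrite (@lt_trans _ _ 1)// ?invf_lt1 ?ltr0n// ltr1n ltnS.
pose F (s : R) := (1 + s)^-1.
have E0 (s : R) : s \in `[k.+1%:R^-1, k.+1%:R] -> 0 < s.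
  by move=> sE; apply: (@expanding_itv_gt0 _ k).
have dF (s : R) : 0 < s -> is_derive s 1 F (- (1 + s) ^- 2).
  move=> s0; have s1 : 1 + s != 0 by rewrite gt_eqF// addr_gt0.
  have d1 : is_derive s 1 (fun t : R => 1 + t) 1.
    have := is_deriveD (is_derive_cst (1 : R) s 1) (is_derive_id s 1); rewrite add0r; exact.
  have := is_deriveV s1 d1.
  by move=> H; apply: (is_derive_eq H); rewrite /GRing.scale/= mulr1.
have cF2 (s : R) : 0 < s -> {for s, continuous (fun s : R => - (1 + s) ^- 2)}.
  move=> s0; apply: cvgN; apply: (@continuous_comp _ _ _ (fun s : R => (1 + s) ^+ 2) (fun t => t^-1)).
    apply: (@continuous_comp _ _ _ (fun s : R => 1 + s) (fun t => t ^+ 2)); last exact: exprn_continuous.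
    by apply: cvgD; [exact: cvg_cst|exact: cvg_id].
  by apply: inv_continuous; rewrite gt_eqF// exprn_gt0// addr_gt0.
have F'E (s : R) : 0 < s -> F^`()%classic s = - (1 + s) ^- 2.
  by move=> s0; rewrite derive1E; have [_ ->] := dF s s0.
have cF (s : R) : 0 < s -> {for s, continuous F}.
  by move=> s0; apply/differentiable_continuous/derivable1_diffP; have [] := dF s s0.
have cF' (s : R) : 0 < s -> {for s, continuous F^`()%classic}.
  move=> s0; rewrite /prop_for /continuous_at F'E//; apply: cvg_trans (cF2 s s0).
  by apply: near_eq_cvg; near=> t; rewrite F'E//; near: t; exact: lt_nbhsr.
have K0 : 0 < k.+1%:R^-1 :> R by rewrite invr_gt0.
have K0' : 0 < k.+1%:R :> R by [].
rewrite /inner_itv -/(F k.+1%:R) -/(F k.+1%:R^-1).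
rewrite (@integration_by_substitution_decreasing _ F (fun t => g t * jump_kernel t))//.
- apply: eq_integral => s; rewrite inE/= => /E0 s0; congr EFin.
  transitivity (g (F s) * jump_kernel (F s) * - F^`()%classic s); first by [].
  rewrite F'E// /F jump_kernelV// opprK -powR_invn; last by rewrite addr_ge0// ltW.
  rewrite (_ : alpha - 1 = (1 + alpha) + - 2%:R); last by ring.
  by rewrite (@gt0_powRD _ _ (1 + alpha) (- 2%:R)) ?addr_gt0//; ring.
- exact: ltW.
- move=> x y /E0 x0 /E0 y0 xy; rewrite /F ltf_pV2 ?posrE ?addr_gt0// ltrD2l//.
- move=> x; rewrite in_itv/= => /andP[kx _]; apply: cF'; exact: lt_trans kx.
- apply/cvg_ex; exists (F^`()%classic k.+1%:R^-1); apply: cvg_at_right_filter; exact: cF'.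
- apply/cvg_ex; exists (F^`()%classic k.+1%:R); apply: cvg_at_left_filter; exact: cF'.
- split.
  + by move=> x; rewrite in_itv/= => /andP[kx _]; have [] := dF x (lt_trans K0 kx).
  + by apply: cvg_at_right_filter; exact: cF.
  + by apply: cvg_at_left_filter; exact: cF.
- apply: continuous_in_subspaceT => t; rewrite inE/= => tk.
  have t0 : 0 < t by apply: (@inner_itv_gt0 k).
  have t1 : t < 1 by apply: (@inner_itv_lt1 k).
  apply: cvgM; first exact: cg.
  apply: (@continuous_comp _ _ _ (fun t : R => (1 - t) ^+ 2) (fun t => t `^ _)).
    apply: (@continuous_comp _ _ _ (fun s : R => 1 - s) (fun t => t ^+ 2)); last exact: exprn_continuous.
    by apply: cvgB; [exact: cvg_cst|exact: cvg_id].
  by apply: continuous_powR; rewrite exprn_even_gt0//= subr_eq0 gt_eqF.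
Unshelve. all: by end_near. Qed.

End transverse.

(** * Truncated integrals of the Hardy weight *)

Section truncated.
Context {R : realType}.
Local Notation leb := (@lebesgue_measure R).

(** The product [f * (f^2)^(-1)] is built from measurable operations; at a zero of [f] it agrees
    with the convention that the inverse of 0 is 0. *)
Lemma measurable_funV d (T : measurableType d) (f : T -> R) :
  measurable_fun setT f -> measurable_fun setT (fun t => (f t)^-1).
Proof.
move=> mf; rewrite (_ : (fun t => _) = (fun t => f t * (f t ^+ 2) `^ (- 1))).
  apply: measurable_funM => //; apply: (measurableT_comp (measurable_powR _)).
  exact: measurable_funX.
apply/funext => t; rewrite powR_inv1 ?sqr_ge0//.
have [->|f0] := eqVneq (f t) 0; first by rewrite invr0 mul0r.
by field.
Qed.

Lemma powR_anti (x y c : R) : 0 <= c -> 0 < x -> x <= y -> y `^ (- c) <= x `^ (- c).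
Proof.
move=> c0 x0 xy; have y0 : 0 < y by exact: lt_le_trans xy.
rewrite !powRN lef_pV2 ?posrE ?powR_gt0//.
by apply: ge0_ler_powR => //; rewrite nnegrE ltW.
Qed.

Lemma integral_indicM (A : set R) (f : R -> R) : measurable A ->
  (\int[leb]_t (\1_A t * f t)%:E = \int[leb]_(t in A) (f t)%:E)%E.
Proof.
move=> mA; rewrite [RHS]integral_mkcond; apply: eq_integral => t _.
by rewrite patchE indicE; case: ifPn => _; rewrite ?mul1r ?mul0r.
Qed.

(** The two sets are disjoint, so this is the indicator of their union; the sum form lets integrals
    split into the two halves. *)
Definition trunc (k : nat) (t : R) : R := \1_(outer_itv k) t + \1_(inner_itv k) t.

Lemma measurable_trunc k : measurable_fun [set: R] (trunc k).
Proof. by apply: measurable_funD; apply: measurable_indic; exact: measurable_itv. Qed.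

Lemma trunc_ge0 k t : 0 <= trunc k t.
Proof. by rewrite addr_ge0// indicE. Qed.

Variable alpha : R.
Hypothesis a02 : 0 < alpha < 2.

Lemma integral_trunc k (g : R -> R) : (0 < k)%N -> measurable_fun [set: R] g ->
  (forall t, 0 <= g t) -> (forall t : R, 0 < t -> {for t, continuous g}) ->
  (\int[leb]_t (trunc k t * g t * jump_kernel alpha t)%:E =
   (\int[leb]_(s in expanding_itv k)
     ((g (1 + s) + g (1 + s)^-1 * (1 + s) `^ (alpha - 1)) * s `^ (- 1 - alpha)))%:E)%E.
Proof.
move=> k0 mg g0 cg.
have mf : measurable_fun [set: R] (fun t => g t * jump_kernel alpha t).
  by apply: measurable_funM; [exact: mg|exact: measurable_jump_kernel].
have f0 t : 0 <= g t * jump_kernel alpha t by rewrite mulr_ge0 ?powR_ge0.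
transitivity (\int[leb]_t ((\1_(outer_itv k) t * (g t * jump_kernel alpha t))%:E +
   (\1_(inner_itv k) t * (g t * jump_kernel alpha t))%:E))%E.
  by apply: eq_integral => t _; rewrite -EFinD -mulrDl mulrA.
have mi : measurable (inner_itv k : set R) by exact: measurable_itv.
have mo : measurable (outer_itv k : set R) by exact: measurable_itv.
rewrite ge0_integralD; [|exact: measurableT| | | |]; first last.
- by apply/measurable_EFinP; apply: measurable_funM; [exact: measurable_indic|exact: mf].
- by move=> t _; rewrite lee_fin mulr_ge0// indicE.
- by apply/measurable_EFinP; apply: measurable_funM; [exact: measurable_indic|exact: mf].
- by move=> t _; rewrite lee_fin mulr_ge0// indicE.
rewrite !integral_indicM// integral_outer_itv// integral_inner_itv//.
have c1 (s : R) : 0 < s -> {for s, continuous (fun s : R => g (1 + s) * s `^ (- 1 - alpha))}.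
  move=> s0; apply: cvgM; last exact: continuous_powR.
  apply: (@continuous_comp _ _ _ (fun s : R => 1 + s) g); last by apply: cg; rewrite addr_gt0.
  by apply: cvgD; [exact: cvg_cst|exact: cvg_id].
have c2 (s : R) : 0 < s ->
    {for s, continuous (fun s : R => g (1 + s)^-1 * (1 + s) `^ (alpha - 1) * s `^ (- 1 - alpha))}.
  move=> s0; have s1 : 0 < 1 + s by rewrite addr_gt0.
  apply: cvgM; last exact: continuous_powR.
  apply: cvgM; last exact: continuous_powR1D.
  apply: (@continuous_comp _ _ _ (fun s : R => (1 + s)^-1) g); last by apply: cg; rewrite invr_gt0.
  apply: (@continuous_comp _ _ _ (fun s : R => 1 + s) (fun s => s^-1)); last by apply: inv_continuous; rewrite gt_eqF.
  by apply: cvgD; [exact: cvg_cst|exact: cvg_id].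
have i1 := integrable_expanding_itv k c1; have i2 := integrable_expanding_itv k c2.
have mE := measurable_expanding_itv (R := R) k.
transitivity (\int[leb]_(s in expanding_itv k) (g (1 + s) * s `^ (- 1 - alpha)) +
  \int[leb]_(s in expanding_itv k) (g (1 + s)^-1 * (1 + s) `^ (alpha - 1) * s `^ (- 1 - alpha)))%:E.
  by rewrite EFinD /Rintegral !fineK//; exact: integrable_fin_num.
by rewrite -RintegralD//; congr EFin; apply: eq_Rintegral => s _; rewrite -mulrDl.
Qed.

(** The Young weight at [s = t^g], the ratio of the ground states at the two points; the second
    exponent [g (p - 1)] equals [alpha - 1 - g]. *)
Definition hardy_weight (p t : R) : R :=
  let g := hardy_exp alpha p in (1 - p^-1) * t `^ g + t `^ (alpha - 1 - g) / p.

Lemma hardy_weightE (p t : R) : 1 < p -> hardy_weight p t = young_weight p (t `^ hardy_exp alpha p).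
Proof.
move=> p1; rewrite /hardy_weight /young_weight -powRrM; congr (_ + _ `^ _ / _).
by rewrite /hardy_exp; field; rewrite gt_eqF// (lt_trans _ p1).
Qed.

Lemma hardy_weight_ge0 (p t : R) : 1 < p -> 0 <= hardy_weight p t.
Proof.
move=> p1; have p0 : 0 < p by exact: lt_trans p1.
rewrite addr_ge0 ?mulr_ge0 ?powR_ge0 ?invr_ge0 ?(ltW p0)// subr_ge0.
by rewrite invf_le1// ltW.
Qed.

Lemma measurable_hardy_weight (p : R) : measurable_fun [set: R] (hardy_weight p).
Proof.
apply: measurable_funD; apply: measurable_funM => //; exact: measurable_powR.
Qed.

Lemma continuous_hardy_weight (p t : R) : 0 < t -> {for t, continuous (hardy_weight p)}.
Proof.
move=> t0; apply: cvgD; apply: cvgM; try exact: cvg_cst; exact: continuous_powR.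
Qed.

(** With [A = (1+s)^g] and [B = (1+s)^g'], the weight at [1 + s] and the weight at [1 / (1 + s)]
    times [(1+s)^(alpha-1) = A B] add up to [A + B]: the coefficients [1 - 1/p] and [1/p] recombine
    to 1. Hence the difference is the integral of [1 + A B - A - B]. *)
Lemma trunc_hardy_diff (p : R) k : 1 < p -> (0 < k)%N -> exists Zp Zm : R,
  [/\ (\int[leb]_t (trunc k t * 1 * jump_kernel alpha t)%:E = Zp%:E)%E,
      (\int[leb]_t (trunc k t * hardy_weight p t * jump_kernel alpha t)%:E = Zm%:E)%E &
      Zp - Zm = \int[leb]_(s in expanding_itv k)
        (hardy_fun (hardy_exp alpha p) (alpha - 1 - hardy_exp alpha p) s * s `^ (- 1 - alpha))].
Proof.
move=> p1 k0; have p0 : 0 < p by exact: lt_trans p1.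
have cw (s : R) : 0 < s -> {for s, continuous (fun s : R => hardy_weight p (1 + s))}.
  move=> s0; apply: (@continuous_comp _ _ _ (fun s : R => 1 + s) (hardy_weight p)).
    by apply: cvgD; [exact: cvg_cst|exact: cvg_id].
  by apply: continuous_hardy_weight; rewrite addr_gt0.
have cv (s : R) : 0 < s -> {for s, continuous (fun s : R => hardy_weight p (1 + s)^-1)}.
  move=> s0; have s1 : 0 < 1 + s by rewrite addr_gt0.
  apply: (@continuous_comp _ _ _ (fun s : R => (1 + s)^-1) (hardy_weight p)); last first.
    by apply: continuous_hardy_weight; rewrite invr_gt0.
  apply: (@continuous_comp _ _ _ (fun s : R => 1 + s) (fun s => s^-1)); last by apply: inv_continuous; rewrite gt_eqF.
  by apply: cvgD; [exact: cvg_cst|exact: cvg_id].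
do 2 eexists; split.
- by apply: (@integral_trunc k (fun=> 1)) => // t _; exact: cvg_cst.
- apply: (@integral_trunc k (hardy_weight p)) => //.
  + exact: measurable_hardy_weight.
  + by move=> t; exact: hardy_weight_ge0.
  + by move=> t t0; exact: continuous_hardy_weight.
rewrite -RintegralB; first last.
- apply: integrable_expanding_itv => s s0; apply: cvgM; last exact: continuous_powR.
  apply: cvgD; first exact: cw.
  by apply: cvgM; [exact: cv|exact: continuous_powR1D].
- apply: integrable_expanding_itv => s s0; apply: cvgM; last exact: continuous_powR.
  apply: cvgD; first exact: cvg_cst.
  by apply: cvgM; [exact: cvg_cst|exact: continuous_powR1D].
- exact: measurable_expanding_itv.
apply: eq_Rintegral => s; rewrite inE => /expanding_itv_gt0 s0.
have s1 : 0 < 1 + s by rewrite addr_gt0.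
rewrite -mulrBl; congr (_ * _).
rewrite /hardy_fun /hardy_weight; set g := hardy_exp alpha p; set g' := alpha - 1 - g.
have vE c : (1 + s)^-1 `^ c = (1 + s) `^ (- c).
  by rewrite -(powR_inv1 (ltW s1)) -powRrM mulN1r.
rewrite !vE (_ : alpha - 1 = g + g'); last by rewrite /g'; ring.
have e1 : (1 + s) `^ (- g) * (1 + s) `^ (g + g') = (1 + s) `^ g'.
  by rewrite -gt0_powRD//; congr (_ `^ _); ring.
have e2 : (1 + s) `^ (- g') * (1 + s) `^ (g + g') = (1 + s) `^ g.
  by rewrite -gt0_powRD//; congr (_ `^ _); ring.
have e3 := gt0_powRD g g' s1.
rewrite (mulrDl (_ * _) (_ / p)) -[(1 - p^-1) * _ * _]mulrA e1.
rewrite [(1 + s) `^ (- g') / p * _]mulrAC e2 e3.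
by move: ((1 + s) `^ g) ((1 + s) `^ g') => A B; field; rewrite gt_eqF.
Qed.

End truncated.

(** * The remainder weight and the cost of the added gain *)

Section depth.
Context {R : realType}.
Local Notation leb := (@lebesgue_measure R).
Variables (alpha tau : R).
Hypothesis a02 : 0 < alpha < 2.
Hypothesis ht : 0 < tau < 1 + alpha.

Let a0 : 0 < alpha. Proof. by case/andP: a02. Qed.
Let a2 : alpha < 2. Proof. by case/andP: a02. Qed.
Let t0 : 0 < tau. Proof. by case/andP: ht. Qed.
Let t1 : tau < 1 + alpha. Proof. by case/andP: ht. Qed.

(** The quotient of the remainder weight by the Hardy weight. For [b > 0] it is the power [tau] of
    the sine of the angle between [(a, b)] and the boundary, hence homogeneous of degree 0. *)
Definition depth (a b : R) : R := b `^ tau / (a ^+ 2 + b ^+ 2) `^ (tau / 2).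

Lemma depth_ge0 a b : 0 <= depth a b.
Proof. by rewrite divr_ge0// powR_ge0. Qed.

Lemma sqr_powR_half (b c : R) : 0 <= b -> (b ^+ 2) `^ (c / 2) = b `^ c.
Proof. by move=> b0; rewrite -powR_mulrn// -powRrM; congr (_ `^ _); field. Qed.

Lemma depth_le1 a b : 0 < b -> depth a b <= 1.
Proof.
move=> b0; rewrite /depth -(sqr_powR_half _ (ltW b0)) ler_pdivrMr ?mul1r; last first.
  by rewrite powR_gt0// ltr_pwDr ?sqr_ge0// exprn_gt0.
by apply: ge0_ler_powR; rewrite ?nnegrE ?sqr_ge0 ?addr_ge0 ?sqr_ge0 ?divr_ge0 ?(ltW t0)// lerDr sqr_ge0.
Qed.

Lemma measurable_depth d (T : measurableType d) (f g : T -> R) :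
  measurable_fun setT f -> measurable_fun setT g ->
  measurable_fun setT (fun x => depth (f x) (g x)).
Proof.
move=> mf mg; rewrite /depth; under eq_fun do rewrite -powRN.
apply: measurable_funM; first by apply: (measurableT_comp (measurable_powR _)).
apply: (measurableT_comp (measurable_powR _)).
by apply: measurable_funD; apply: measurable_funX.
Qed.

Definition jump_itv (lam : R) : set R := `[lam, 2 * lam]%classic.

(* Either a is at least h times the norm of (Y, X), and then depth a b is small, or
   (a, b) stays away from (Y, X). *)
Lemma depth_pointwise (X Y h lam a b : R) : 0 < X -> 0 < h -> h <= 4^-1 -> 2 <= lam ->
  0 < b -> b <= X / lam ->
  depth a b * ((Y - a) ^+ 2 + (X - b) ^+ 2) `^ (- (1 + alpha / 2)) <=
  depth Y X * (lam * h) `^ (- tau) * ((Y - a) ^+ 2 + (X - b) ^+ 2) `^ (- (1 + alpha / 2)) +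
  \1_(`[- (h * Num.sqrt (Y ^+ 2 + X ^+ 2)), h * Num.sqrt (Y ^+ 2 + X ^+ 2)]%classic) a *
    ((Y ^+ 2 + X ^+ 2) / 8) `^ (- (1 + alpha / 2)).
Proof.
have A0 : 0 < alpha := a0.
move=> X0 h0 h4 l2 b0 bX.
have l0 : 0 < lam by lra.
have r20 : 0 < Y ^+ 2 + X ^+ 2 by rewrite ltr_pwDr ?sqr_ge0// exprn_gt0.
set rho := Num.sqrt _; have rho0 : 0 < rho by rewrite sqrtr_gt0.
have rhoE : Y ^+ 2 + X ^+ 2 = rho ^+ 2 by rewrite sqr_sqrtr// ltW.
have bX2 : b <= X / 2 by rewrite (le_trans bX)// ler_pM2l// lef_pV2 ?posrE.
have [ha|ha] := leP `|a| (h * rho).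
  rewrite indicE mem_set; last by rewrite /= in_itv/= -ler_norml.
  rewrite mul1r -[leLHS]add0r lerD//.
    by rewrite mulr_ge0 ?powR_ge0// mulr_ge0 ?powR_ge0 ?depth_ge0.
  rewrite -[leRHS]mul1r ler_pM ?depth_ge0 ?powR_ge0 ?depth_le1//.
  apply: powR_anti; [lra|by rewrite divr_gt0|].
  (* Here [|a| <= rho / 4] and [b <= X / 2], so the squared distance to [(Y, X)] is at least
     [Y^2 / 2 + X^2 / 4 - rho^2 / 16], which exceeds [rho^2 / 8]. *)
  have ha2 : a ^+ 2 <= (Y ^+ 2 + X ^+ 2) / 16.
    rewrite rhoE -[a ^+ 2]real_normK ?num_real//.
    have -> : rho ^+ 2 / 16 = (4^-1 * rho) ^+ 2 by field.
    rewrite lerXn2r ?nnegrE ?mulr_ge0 ?(ltW rho0)//.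
    by rewrite (le_trans ha)// ler_wpM2r// ltW.
  have hb : X ^+ 2 / 4 <= (X - b) ^+ 2 by nra.
  have hY : Y ^+ 2 / 2 - a ^+ 2 <= (Y - a) ^+ 2.
    have := sqr_ge0 (Y / 2 - a); have := sqr_ge0 (Y - 2 * a); nra.
  have X20 := sqr_ge0 X; have Y20 := sqr_ge0 Y; lra.
apply: (@le_trans _ _ (depth Y X * (lam * h) `^ (- tau) *
  ((Y - a) ^+ 2 + (X - b) ^+ 2) `^ (- (1 + alpha / 2)))); last first.
  by rewrite lerDl mulr_ge0 ?powR_ge0// indicE.
(* For [|a| > h rho] the numerator of the depth is at most [(X / lam)^tau] and its denominator at
   least [(h rho)^tau]; compared with the depth at [(Y, X)] this is the factor [(lam h)^(-tau)]. *)
rewrite ler_wpM2r ?powR_ge0// /depth rhoE sqr_powR_half ?(ltW rho0)//.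
have hr0 : 0 < h * rho by rewrite mulr_gt0.
have d1 : (h * rho) `^ tau <= (a ^+ 2 + b ^+ 2) `^ (tau / 2).
  rewrite -(sqr_powR_half _ (ltW hr0)); apply: ge0_ler_powR.
  - by rewrite divr_ge0// ltW.
  - by rewrite nnegrE sqr_ge0.
  - by rewrite nnegrE addr_ge0 ?sqr_ge0.
  have : (h * rho) ^+ 2 <= a ^+ 2 by rewrite -[a ^+ 2]real_normK ?num_real// lerXn2r ?nnegrE ?(ltW hr0)// ltW.
  by move=> /le_trans; apply; rewrite lerDl sqr_ge0.
have d2 : b `^ tau <= (X / lam) `^ tau.
  by apply: ge0_ler_powR; rewrite ?nnegrE ?divr_ge0 ?(ltW X0) ?(ltW l0) ?(ltW b0) ?(ltW t0).
have -> : X `^ tau / rho `^ tau * (lam * h) `^ (- tau) = (X / lam) `^ tau / (h * rho) `^ tau.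
  have -> : X / lam = X * lam `^ (- 1) by rewrite powR_inv1// ltW.
  rewrite (powRM tau (ltW X0) (powR_ge0 _ _)) (powRM tau (ltW h0) (ltW rho0)).
  rewrite (powRM (- tau) (ltW l0) (ltW h0)) -powRrM mulN1r !powRN.
  by field; rewrite !gt_eqF// powR_gt0.
have r1 : 0 < (h * rho) `^ tau by exact: powR_gt0.
have r2 : 0 < (a ^+ 2 + b ^+ 2) `^ (tau / 2) by exact: lt_le_trans d1.
apply: ler_pM => //; [exact: powR_ge0|by rewrite invr_ge0 ltW|].
by rewrite lef_pV2.
Qed.

(** Integral over [a] of [depth_pointwise]. The far part is a full slice of the kernel with
    [X - b >= X / 2]; the near part is a constant on an interval of length [2 h rho], of order
    [h rho^(-1-alpha)] in total. *)
Lemma depth_slice (X Y h lam b : R) (C : R) : 0 < X -> 0 < h -> h <= 4^-1 -> 2 <= lam ->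
  0 < b -> b <= X / lam -> 0 < C ->
  (forall c A : R, 0 < A -> (\int[leb]_a (((c - a) ^+ 2 + A) `^ (- (1 + alpha / 2)))%:E =
    (C * A `^ (- ((1 + alpha) / 2)))%:E)%E) ->
  (\int[leb]_a (depth a b * ((Y - a) ^+ 2 + (X - b) ^+ 2) `^ (- (1 + alpha / 2)))%:E <=
  (X `^ (- 1 - alpha) * depth Y X *
    (C * 2 `^ (1 + alpha) * (lam * h) `^ (- tau) + 2 * h * 8 `^ (1 + alpha / 2)))%:E)%E.
Proof.
have A0 : 0 < alpha := a0.
move=> X0 h0 h4 l2 b0 bX C0 slice.
have l0 : 0 < lam by lra.
have r20 : 0 < Y ^+ 2 + X ^+ 2 by rewrite ltr_pwDr ?sqr_ge0// exprn_gt0.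
set rho := Num.sqrt (Y ^+ 2 + X ^+ 2); have rho0 : 0 < rho by rewrite sqrtr_gt0.
have rhoE : Y ^+ 2 + X ^+ 2 = rho ^+ 2 by rewrite sqr_sqrtr// ltW.
have bX2 : b <= X / 2 by rewrite (le_trans bX)// ler_pM2l// lef_pV2 ?posrE.
pose ker a := ((Y - a) ^+ 2 + (X - b) ^+ 2) `^ (- (1 + alpha / 2)).
have mker : measurable_fun [set: R] ker.
  apply: (measurableT_comp (measurable_powR _)); apply: measurable_funD => //.
  by apply: measurable_funX; exact: measurable_funB.
have ker0 a : 0 <= ker a by exact: powR_ge0.
pose I : set R := `[- (h * rho), h * rho]%classic.
have mI : measurable I by exact: measurable_itv.
pose E1 := depth Y X * (lam * h) `^ (- tau).
have E10 : 0 <= E1 by rewrite mulr_ge0 ?depth_ge0 ?powR_ge0.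
pose E2 := (rho ^+ 2 / 8) `^ (- (1 + alpha / 2)).
have E20 : 0 <= E2 by exact: powR_ge0.
apply: (@le_trans _ _ (\int[leb]_a ((E1 * ker a)%:E + (\1_I a * E2)%:E))%E).
  apply: ge0_le_integral.
  - exact: measurableT.
  - by move=> a _; rewrite lee_fin mulr_ge0 ?depth_ge0 ?powR_ge0.
  - apply/measurable_EFinP/measurable_funM; last exact: mker.
    by apply: measurable_depth => //; exact: measurable_cst.
  - by apply/measurable_EFinP/measurable_funD; apply: measurable_funM => //; exact: measurable_indic.
  - by move=> a _; rewrite -EFinD lee_fin /E2 -rhoE; exact: depth_pointwise.
rewrite ge0_integralD; [|exact: measurableT| | | |]; first last.
- by apply/measurable_EFinP; apply: measurable_funM; [exact: measurable_indic|exact: measurable_cst].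
- by move=> t _; rewrite lee_fin mulr_ge0// indicE.
- by apply/measurable_EFinP; apply: measurable_funM; [exact: measurable_cst|exact: mker].
- by move=> t _; rewrite lee_fin mulr_ge0.
rewrite integral_indicM// integral_cst//.
under eq_integral do rewrite EFinM.
rewrite ge0_integralZl_EFin; [|exact: measurableT|by move=> a _; rewrite lee_fin|exact/measurable_EFinP|exact: E10].
rewrite /ker slice; last by rewrite exprn_even_gt0//= subr_eq0 gt_eqF//; lra.
have hr0 : 0 < h * rho by rewrite mulr_gt0.
have LI : leb I = (h * rho - - (h * rho))%:E.
  by rewrite /I lebesgue_measure_itv/= lte_fin (_ : - _ < _) ?EFinB//; lra.
rewrite [X in (E2%:E * X)%E](_ : _ = (h * rho - - (h * rho))%:E); last exact: LI.
rewrite -!EFinM -EFinD lee_fin [leRHS]mulrDr; apply: lerD.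
  rewrite /E1 (_ : X `^ _ * depth Y X * _ =
    depth Y X * (lam * h) `^ (- tau) * (C * (X `^ (-1 - alpha) * 2 `^ (1 + alpha)))); last by ring.
  rewrite ler_wpM2l// ler_wpM2l ?(ltW C0)//.
  have -> : X `^ (-1 - alpha) * 2 `^ (1 + alpha) = ((X / 2) ^+ 2) `^ (- ((1 + alpha) / 2)).
    have X2 : 0 < X / 2 by lra.
    rewrite -mulNr sqr_powR_half ?(ltW X2)// powRM ?(ltW X0)//.
    rewrite -[2^-1](powR_inv1 (ler0n _ 2)) -powRrM.
    by congr (_ `^ _ * _ `^ _); ring.
  apply: powR_anti; [lra|by rewrite exprn_gt0//; lra|].
  by rewrite lerXn2r ?nnegrE//; lra.
have -> : E2 * (h * rho - - (h * rho)) = 2 * h * 8 `^ (1 + alpha / 2) * (rho * rho `^ (- (2 + alpha))).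
  rewrite /E2 powRM ?sqr_ge0// -[8^-1](powR_inv1 (ler0n _ 8)) -powRrM.
  rewrite (_ : -1 * - (1 + alpha / 2) = 1 + alpha / 2); last by ring.
  rewrite (_ : - (1 + alpha / 2) = - (2 + alpha) / 2); last by field.
  by rewrite sqr_powR_half ?(ltW rho0)//; ring.
rewrite [leRHS]mulrC ler_wpM2l ?mulr_ge0 ?powR_ge0 ?(ltW h0)//.
(* The hypothesis [tau < 1 + alpha] enters here: of [rho^(-1-alpha)], the part [rho^(-tau)] belongs
   to the depth, and the rest is a negative power, bounded by the same power of [X <= rho]. *)
have -> : rho * rho `^ (- (2 + alpha)) = rho `^ (- tau) * rho `^ (- (1 + alpha - tau)).
  by rewrite -{1}(powRr1 (ltW rho0)) -!gt0_powRD//; congr (_ `^ _); ring.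
have -> : X `^ (-1 - alpha) * depth Y X = rho `^ (- tau) * X `^ (- (1 + alpha - tau)).
  rewrite /depth rhoE sqr_powR_half ?(ltW rho0)// powRN mulrA mulrC; congr (_ * _).
  by rewrite -gt0_powRD//; congr (_ `^ _); ring.
rewrite ler_wpM2l ?powR_ge0//; apply: powR_anti => //; first by rewrite subr_ge0 ltW.
by rewrite -[leLHS](ger0_norm (ltW X0)) -sqrtr_sqr; apply: ler_wsqrtr; rewrite lerDr sqr_ge0.
Qed.

(** On the interval [|1 - t|] is at most [2 lam], and the length is [lam]. *)
Lemma jump_itv_mass (lam : R) : 2 <= lam ->
  ((2 `^ (- 1 - alpha) * lam `^ (- alpha))%:E <=
   \int[leb]_t (\1_(jump_itv lam) t * jump_kernel alpha t)%:E)%E.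
Proof.
have A0 : 0 < alpha := a0.
move=> l2; have l0 : 0 < lam by lra.
have mI : measurable (jump_itv lam : set R) by exact: measurable_itv.
rewrite integral_indicM//.
have -> : (2 `^ (- 1 - alpha) * lam `^ (- alpha))%:E =
    (\int[leb]_(t in jump_itv lam) (cst ((2 * lam) `^ (- (1 + alpha)))%:E t))%E.
  rewrite integral_cst//.
  have LI : leb (jump_itv lam) = (2 * lam - lam)%:E.
    by rewrite /jump_itv lebesgue_measure_itv/= lte_fin (_ : lam < _) ?EFinB//; lra.
  rewrite [X in (_ = _ * X)%E](_ : _ = (2 * lam - lam)%:E); last exact: LI.
  rewrite -EFinM; congr EFin; rewrite powRM ?(ltW l0)//.
  rewrite (_ : 2 * lam - lam = lam `^ 1); last by rewrite powRr1 ?(ltW l0)//; ring.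
  by rewrite -mulrA -gt0_powRD//; congr (_ `^ _ * _ `^ _); ring.
apply: ge0_le_integral => //.
- by move=> t _; rewrite lee_fin powR_ge0.
- by apply/measurable_EFinP/measurable_funTS; exact: measurable_jump_kernel.
move=> t; rewrite /jump_itv/= in_itv/= => /andP[lt tl]; rewrite lee_fin /jump_kernel.
rewrite -(sqr_powR_half _ (_ : 0 <= 2 * lam)); last by lra.
rewrite mulNr; apply: powR_anti; [by lra|by rewrite exprn_even_gt0//= subr_eq0 lt_eqF//; lra|].
by nra.
Qed.

(** As [X / b] lies in [[lam, 2 lam]], [b] runs over an interval of length [X / (2 lam)], where
    [(X / b)^(1-alpha) <= 2 lam^(1-alpha)] whatever the sign of [1 - alpha]. The product has the
    order [lam^(-alpha)] of [jump_itv_mass], so the small factor [2 dl] from [depth_slice]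
    decides. *)
Lemma depth_bound : exists2 lam : R, 2 <= lam & forall X Y : R, 0 < X ->
  (\int[leb]_b \int[leb]_a (\1_(jump_itv lam) (X / b) * (X / b) `^ (1 - alpha) * depth a b *
     ((Y - a) ^+ 2 + (X - b) ^+ 2) `^ (- (1 + alpha / 2)))%:E <=
   (4^-1 * slice_cst alpha * X `^ (- alpha) * depth Y X)%:E *
   \int[leb]_t (\1_(jump_itv lam) t * jump_kernel alpha t)%:E)%E.
Proof.
have A0 : 0 < alpha := a0. have A2 : alpha < 2 := a2. have T0 : 0 < tau := t0.
move: (slice_cst alpha) (slice_cst_gt0 a02) (integral_slice a02) => C C0 slice.
have P0 : 0 < 2 `^ (- 1 - alpha) :> R by rewrite powR_gt0.
have Q0 : 0 < 2 `^ (1 + alpha) :> R by rewrite powR_gt0.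
have S0 : 0 < 8 `^ (1 + alpha / 2) :> R by rewrite powR_gt0.
(* [2 dl] is one quarter of [C * 2^(-1-alpha)], where the power comes from [jump_itv_mass]. Each of
   the two terms of [depth_slice] is made at most [dl]: the near one by [h], then the far one by
   [lam], which depends on [h]. *)
pose dl := 8^-1 * (C * 2 `^ (- 1 - alpha)).
have dl0 : 0 < dl by rewrite mulr_gt0// mulr_gt0.
pose h := Num.min 4^-1 (dl / (2 * 8 `^ (1 + alpha / 2))).
have h0 : 0 < h by rewrite lt_min invr_gt0 ltr0n divr_gt0// mulr_gt0.
have h4 : h <= 4^-1 by rewrite ge_min lexx.
have hS : 2 * h * 8 `^ (1 + alpha / 2) <= dl.
  have : h <= dl / (2 * 8 `^ (1 + alpha / 2)) by rewrite ge_min lexx orbT.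
  by rewrite ler_pdivlMr ?mulr_gt0// mulrCA mulrA.
pose M := (dl / (C * 2 `^ (1 + alpha))) `^ (- tau^-1).
have M0 : 0 < M by rewrite powR_gt0// divr_gt0// mulr_gt0.
pose lam := Num.max 2 (M / h).
have l2 : 2 <= lam by rewrite le_max lexx.
have l0 : 0 < lam by lra.
have lh : C * 2 `^ (1 + alpha) * (lam * h) `^ (- tau) <= dl.
  have lM : M <= lam * h by rewrite -ler_pdivrMr// le_max lexx orbT.
  have := powR_anti (ltW T0) M0 lM; rewrite {1}/M -powRrM.
  rewrite (_ : - tau^-1 * - tau = 1); last by field; rewrite gt_eqF.
  by rewrite powRr1 ?divr_ge0 ?mulr_ge0 ?(ltW dl0) ?(ltW C0) ?(ltW Q0)// ler_pdivlMr ?mulr_gt0// mulrC.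
exists lam => // X Y X0.
have D0 := depth_ge0 Y X.
pose J : set R := `[X / (2 * lam), X / lam]%classic.
have mJ : measurable J by exact: measurable_itv.
have mI : measurable (jump_itv lam : set R) by exact: measurable_itv.
pose W := 2 * lam `^ (1 - alpha) * (X `^ (- 1 - alpha) * depth Y X * (2 * dl)).
have W1 : 0 <= X `^ (- 1 - alpha) * depth Y X * (2 * dl).
  by apply: mulr_ge0; [exact: (mulr_ge0 (powR_ge0 _ _) D0)|rewrite mulr_ge0// ltW].
have W0 : 0 <= W by apply: mulr_ge0 => //; rewrite mulr_ge0 ?powR_ge0.
pose q b := \1_(jump_itv lam) (X / b) * (X / b) `^ (1 - alpha).
have mdiv : measurable_fun [set: R] (fun b => X / b).
  by apply: measurable_funM => //; exact: measurable_funV.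
have mq : measurable_fun [set: R] q.
  apply: measurable_funM.
    by apply: (measurableT_comp _ mdiv); exact: measurable_indic.
  by apply: (measurableT_comp (measurable_powR _)).
have q0 b : 0 <= q b by rewrite mulr_ge0 ?powR_ge0// indicE.
pose k2 (z : R * R) := depth z.2 z.1 * ((Y - z.2) ^+ 2 + (X - z.1) ^+ 2) `^ (- (1 + alpha / 2)).
have mk2 : measurable_fun [set: R * R]%type k2.
  apply: measurable_funM; first exact: measurable_depth.
  apply: (measurableT_comp (measurable_powR _)).
  by apply: measurable_funD; apply: measurable_funX; exact: measurable_funB.
have k20 z : 0 <= k2 z by rewrite mulr_ge0 ?depth_ge0 ?powR_ge0.
pose F (z : R * R) : \bar R := (q z.1 * k2 z)%:E.
have mF : measurable_fun [set: R * R]%type F.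
  apply/measurable_EFinP; apply: measurable_funM => //.
  by apply: (measurableT_comp mq).
have F0 z : (0 <= F z)%E by rewrite lee_fin mulr_ge0.
apply: (@le_trans _ _ (\int[leb]_b (\1_J b * W)%:E)%E).
  apply: (@le_trans _ _ (\int[leb]_b \int[leb]_a F (b, a))%E).
    rewrite le_eqVlt; apply/orP; left; apply/eqP.
    by apply: eq_integral => b _; apply: eq_integral => a _; rewrite /F /q /k2/= -!mulrA.
  apply: ge0_le_integral.
  - exact: measurableT.
  - by move=> b _; apply: integral_ge0 => a _.
  - exact: (@measurable_fun_fubini_tonelli_F _ _ _ _ _ leb F mF F0).
  - by apply/measurable_EFinP; apply: measurable_funM; [exact: measurable_indic|exact: measurable_cst].
  move=> b _; rewrite /F/=.
  have [bI|bI] := boolP (X / b \in jump_itv lam); last first.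
    rewrite integral0_eq => [|a _]; last by rewrite /q indicE (negbTE bI) !mul0r.
    by rewrite lee_fin mulr_ge0// indicE.
  have : jump_itv lam (X / b) by rewrite inE in bI.
  rewrite /jump_itv/= in_itv/= => /andP[b1 b2].
  have b0 : 0 < b.
    have : 0 < X / b by lra.
    by rewrite pmulr_rgt0// invr_gt0.
  have b3 : b <= X / lam by rewrite ler_pdivlMr// mulrC -ler_pdivlMr.
  have b4 : X / (2 * lam) <= b by rewrite ler_pdivrMr ?mulr_gt0// mulrC -ler_pdivrMr.
  have bJ : b \in J by rewrite inE /J/= in_itv/= b3 b4.
  under eq_integral do rewrite EFinM.
  have mk : measurable_fun [set: R] (fun a => k2 (b, a)).
    by apply: (measurableT_comp mk2); exact: pair1_measurable.
  rewrite ge0_integralZl_EFin; [|exact: measurableT|by move=> a _; rewrite lee_fin|exact/measurable_EFinP|exact: q0].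
  have := depth_slice Y X0 h0 h4 l2 b0 b3 C0 slice => H.
  apply: (@le_trans _ _ ((q b)%:E * (X `^ (- 1 - alpha) * depth Y X * (2 * dl))%:E)%E).
    rewrite lee_wpmul2l ?lee_fin//; apply: (le_trans H); rewrite lee_fin.
    apply: ler_wpM2l; first exact: (mulr_ge0 (powR_ge0 _ _) D0).
    by rewrite [leRHS]mulr_natl mulr2n; apply: lerD.
  rewrite -EFinM lee_fin indicE bJ mul1r /W; apply: ler_wpM2r; first exact: W1.
  rewrite /q indicE bI mul1r.
  have x0 : 0 < X / b by lra.
  have [al|al] := leP alpha 1.
    apply: (@le_trans _ _ ((2 * lam) `^ (1 - alpha))).
      by apply: ge0_ler_powR => //; rewrite ?nnegrE; lra.
    rewrite powRM ?(ltW l0)// ler_wpM2r ?powR_ge0//.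
    by rewrite ler1_powR ?ler1n//; lra.
  apply: (@le_trans _ _ (lam `^ (1 - alpha))).
    by rewrite -opprB; apply: powR_anti => //; lra.
  by rewrite ler_peMl ?powR_ge0// ler1n.
rewrite integral_indicM// integral_cst//.
have LJ : leb J = (X / lam - X / (2 * lam))%:E.
  rewrite /J lebesgue_measure_itv/= lte_fin (_ : X / (2 * lam) < X / lam) ?EFinB//.
  by rewrite ltr_pM2l// ltf_pV2 ?posrE ?mulr_gt0//; lra.
rewrite [X in (_ * X <= _)%E](_ : _ = (X / lam - X / (2 * lam))%:E); last exact: LJ.
apply: (@le_trans _ _ ((4^-1 * C * X `^ (- alpha) * depth Y X)%:E *
  (2 `^ (- 1 - alpha) * lam `^ (- alpha))%:E)%E); last first.
  apply: lee_wpmul2l; last exact: jump_itv_mass.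
  rewrite lee_fin; apply: mulr_ge0 D0; rewrite mulr_ge0 ?powR_ge0// mulr_ge0// ltW//.
rewrite -!EFinM lee_fin le_eqVlt; apply/orP; left; apply/eqP.
rewrite /W /dl.
have -> : X `^ (- alpha) = X * X `^ (-1 - alpha).
  by rewrite -{2}(powRr1 (ltW X0)) -gt0_powRD//; congr (_ `^ _); ring.
have -> : lam `^ (1 - alpha) = lam * lam `^ (- alpha).
  by rewrite -{2}(powRr1 (ltW l0)) -gt0_powRD.
by field; rewrite gt_eqF.
Qed.

End depth.

(** * Integrability near the boundary *)

Section finiteness.
Context {R : realType}.
Local Notation leb := (@lebesgue_measure R).

(** On []0, B]] the power [t^(-beta)] is at most [expR B * t^(-beta) * expR (- t)], a multiple of
    the Gamma integrand with parameter [1 - beta > 0]. *)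
Lemma integral_powR_itv_fin (B beta : R) : 0 < B -> beta < 1 ->
  (\int[leb]_b (\1_(`]0%R, B]%classic) b * b `^ (- beta))%:E < +oo)%E.
Proof.
move=> B0 b1; have mI : measurable (`]0, B]%classic : set R) by exact: measurable_itv.
rewrite integral_indicM//.
have mg : measurable_fun [set: R] (fun t => (expR B * gamma_fun (1 - beta) 1 t)%:E : \bar R).
  by apply/measurable_EFinP/measurable_funM => //; exact: measurable_gamma_fun.
apply: (@le_lt_trans _ _ (\int[leb]_(t in `]0%R, +oo[) (expR B * gamma_fun (1 - beta) 1 t)%:E)%E).
  apply: (@le_trans _ _ (\int[leb]_(t in `]0%R, B]) (expR B * gamma_fun (1 - beta) 1 t)%:E)%E).
    apply: ge0_le_integral => //.
    - by move=> t _; rewrite lee_fin powR_ge0.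
    - by apply/measurable_EFinP/measurable_funTS; exact: measurable_powR.
    - exact: measurable_funTS.
    move=> t; rewrite /= in_itv/= => /andP[t0 tB]; rewrite lee_fin /gamma_fun.
    rewrite (_ : 1 - beta - 1 = - beta); last by ring.
    by rewrite mulrCA -expRD mul1r ler_peMr ?powR_ge0// -[leLHS]expR0 ler_expR subr_ge0.
  apply: ge0_subset_integral => //.
  - exact: measurable_funTS.
  - by move=> t _; rewrite lee_fin mulr_ge0 ?expR_ge0// gamma_fun_ge0.
  - by move=> t /=; rewrite !in_itv/= andbT => /andP[].
under eq_integral do rewrite EFinM.
rewrite ge0_integralZl_EFin ?expR_ge0//; last 2 first.
- by move=> t _; rewrite lee_fin gamma_fun_ge0.
- by apply/measurable_EFinP/measurable_funTS; exact: measurable_gamma_fun.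
by rewrite integral_gamma_fun ?subr_gt0// -EFinM ltry.
Qed.

(* On a bounded set the kernel with pole below the half-space is bounded from below,
   so [integral_kernel] reduces the claim to one variable. *)
Lemma dominated_integral_fin n (f : 'rV[R]_n.+2 -> R) (M B beta : R) :
  measurable_fun [set: 'rV[R]_n.+2] f -> (forall x, 0 <= f x) -> 0 <= M -> 0 < B -> beta < 1 ->
  (forall x, f x != 0 -> [/\ 0 < last_coord x, forall i, `|x ord0 i| <= B &
     f x <= M * last_coord x `^ (- beta)]) ->
  (\int[lebesgue_rV n.+2]_x (f x)%:E < +oo)%E.
Proof.
move=> mf f0 M0 B0 b1 Hf.
(* Once [n] coordinates are removed the exponent is 1, above the threshold 1/2 for integrating one
   more. The pole [x0] has height -1, hence is at distance more than 1 from the points where [f] is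
   nonzero; [D] bounds the squared distance to them from above. *)
pose s : R := n%:R / 2 + 1.
pose x0 : 'rV[R]_n.+2 := \row_i (if i == ord_max then -1 else 0).
have x0l : last_coord x0 = -1 by rewrite /last_coord mxE eqxx.
pose D : R := n.+2%:R * (1 + B) ^+ 2.
have D0 : 0 < D by rewrite mulr_gt0// exprn_gt0// addr_gt0.
pose G (z : R * R) := \1_(`]0%R, B]%classic) z.2 * z.2 `^ (- beta).
have mI : measurable (`]0, B]%classic : set R) by exact: measurable_itv.
have mG : measurable_fun [set: R * R]%type G.
  apply: measurable_funM; last by apply: (measurableT_comp (measurable_powR _)).
  by apply: (measurableT_comp (f := (\1_(`]0%R, B]%classic) : R -> R))) => //; exact: measurable_indic.
have G0 z : 0 <= G z by rewrite mulr_ge0 ?powR_ge0// indicE.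
have s0 : 0 <= s by rewrite addr_ge0// divr_ge0.
have ns : n%:R / 2 < s by rewrite ltrDl.
have MD : 0 <= M * D `^ s by rewrite mulr_ge0 ?powR_ge0.
have mk : measurable_fun setT (fun y => (G (penult_coord y, last_coord y) * sqdist x0 y `^ (- s))%:E : \bar R).
  apply/measurable_EFinP/measurable_funM.
    apply: (measurableT_comp mG); apply: measurable_fun_pair; exact: measurable_rV_coord.
  by apply: (measurableT_comp (measurable_powR _)); exact: measurable_sqdist.
have k0 y : (0 <= (G (penult_coord y, last_coord y) * sqdist x0 y `^ (- s))%:E :> \bar R)%E.
  by rewrite lee_fin mulr_ge0 ?powR_ge0.
apply: (@le_lt_trans _ _ (\int[lebesgue_rV n.+2]_x ((M * D `^ s)%:E *
   (G (penult_coord x, last_coord x) * sqdist x0 x `^ (- s))%:E))%E).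
  apply: ge0_le_integral.
  - exact: measurableT.
  - by move=> x _; rewrite lee_fin.
  - exact/measurable_EFinP.
  - by apply: measurable_funeM.
  move=> x _; rewrite -EFinM lee_fin.
  have [->|fx] := eqVneq (f x) 0; first by rewrite mulr_ge0// mulr_ge0 ?powR_ge0.
  have [xl xB fM] := Hf x fx.
  have xI : last_coord x \in (`]0, B]%classic : set R).
    rewrite inE/= in_itv/= xl/=; apply: le_trans (xB ord_max); exact: ler_norm.
  rewrite /G/= indicE xI mul1r.
  apply: (le_trans fM); rewrite -mulrA ler_wpM2l// mulrCA ler_peMr ?powR_ge0//.
  have sq0 : 0 < sqdist x0 x.
    apply: (@sqdist_gt0 _ _ _ _ ord_max); rewrite -!/(last_coord _) x0l lt_eqF//.
    by rewrite (lt_trans _ xl)// oppr_lt0.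
  rewrite powRN ler_pdivlMr ?powR_gt0// mul1r.
  apply: ge0_ler_powR => //; rewrite ?nnegrE ?(ltW D0) ?(ltW sq0)//.
  apply: (@le_trans _ _ (\sum_(i < n.+2) (1 + B) ^+ 2)); last first.
    by rewrite sumr_const card_ord /D mulr_natl.
  apply: ler_sum => i _; rewrite -[leLHS]real_normK ?num_real//.
  rewrite lerXn2r ?nnegrE ?addr_ge0 ?(ltW B0)//.
  rewrite (le_trans (ler_normB _ _))// lerD// mxE; case: ifP => _; rewrite ?normrN ?normr1 ?normr0//.
rewrite ge0_integralZl_EFin; [|exact: measurableT|by move=> x _; exact: k0|exact: mk|exact: MD].
have Gx a : G (a, last_coord x0) = 0.
  rewrite /G/= x0l indicE memNset ?mul0r//=.
  by rewrite in_itv/= => /andP[+ _]; rewrite oppr_gt0 ltr10.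
rewrite (integral_kernel ns mG G0 Gx).
rewrite muleA -EFinM; set K := (X in (X%:E * _ < _)%E).
have K0 : 0 <= K.
  by rewrite mulr_ge0// !mulr_ge0 ?powR_ge0 ?invr_ge0 ?Gamma_ge0 ?subr_gt0// (le_lt_trans _ ns)// divr_ge0.
have e1 : s - n%:R / 2 = 1 by rewrite /s; ring.
rewrite e1.
have C0 := integral_kernel1_shift (penult_coord x0) (_ : 2^-1 < 1).
set C := Num.sqrt pi * Gamma (1 - 2^-1) / Gamma 1 : R.
have CC0 : 0 <= C by rewrite /C Gamma1 divr1 mulr_ge0 ?sqrtr_ge0// Gamma_ge0// subr_gt0 invf_lt1// ltr1n.
apply: (@le_lt_trans _ _ (K%:E * (C%:E * \int[leb]_b (\1_(`]0%R, B]%classic) b * b `^ (- beta))%:E))%E); last first.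
  have := integral_powR_itv_fin B0 b1.
  have : (0 <= \int[leb]_b (\1_(`]0%R, B]%classic) b * b `^ (- beta))%:E)%E.
    by apply: integral_ge0 => b _; rewrite lee_fin mulr_ge0 ?powR_ge0// indicE.
  by case: (\int[leb]_b _)%E => // r _ _; rewrite -!EFinM ltry.
rewrite lee_wpmul2l ?lee_fin//.
have mb : measurable_fun [set: R] (fun b => (\1_(`]0%R, B]%classic) b * b `^ (- beta))%:E : \bar R).
  by apply/measurable_EFinP/measurable_funM; [exact: measurable_indic|exact: measurable_powR].
have b0 b : (0 <= (\1_(`]0%R, B]%classic) b * b `^ (- beta))%:E :> \bar R)%E.
  by rewrite lee_fin mulr_ge0 ?powR_ge0// indicE.
rewrite -ge0_integralZl_EFin; [|exact: measurableT|by move=> x _; exact: b0|exact: mb|exact: CC0].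
pose F (z : R * R) : \bar R := (G (z.2, z.1) *
  ((penult_coord x0 - z.2) ^+ 2 + (last_coord x0 - z.1) ^+ 2) `^ (- 1))%:E.
have mF : measurable_fun [set: R * R]%type F.
  apply/measurable_EFinP/measurable_funM.
    by apply: (measurableT_comp mG); apply: measurable_fun_pair.
  apply: (measurableT_comp (measurable_powR _)).
  by apply: measurable_funD; apply: measurable_funX; exact: measurable_funB.
have F0 z : (0 <= F z)%E by rewrite lee_fin mulr_ge0 ?powR_ge0.
apply: ge0_le_integral.
- exact: measurableT.
- by move=> b _; apply: integral_ge0 => a _; exact: (F0 (b, a)).
- exact: (@measurable_fun_fubini_tonelli_F _ _ _ _ _ leb F mF F0).
- exact: measurable_funeM.
move=> b _; rewrite /G/=.
under eq_integral do rewrite EFinM.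
rewrite ge0_integralZl_EFin;
  [|exact: measurableT|by move=> a _; rewrite lee_fin powR_ge0| |exact: (G0 (0, b))]; last first.
  apply/measurable_EFinP; apply: (measurableT_comp (measurable_powR _)).
  by apply: measurable_funD => //; apply: measurable_funX; exact: measurable_funB.
have [bI|bI] := boolP (b \in (`]0, B]%classic : set R)); last first.
  by rewrite indicE (negbTE bI) !mul0r mul0e mule0.
have bp : 0 < b by move: bI; rewrite inE/= in_itv/= => /andP[].
rewrite C0 ?invf_lt1 ?ltr1n//; last by rewrite x0l exprn_even_gt0//= lt_eqF//; lra.
rewrite -!EFinM lee_fin -/C [leRHS]mulrC ler_wpM2l ?(G0 (0, b))//.
rewrite ler_piMr// x0l.
have := @powR_anti R 1 ((-1 - b) ^+ 2) (1 - 2^-1).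
by rewrite powR1; apply => //; [lra|nra].
Qed.

End finiteness.

(** * Symmetrized integrals and the bound for a pair of points *)

Section comparison.
Local Open Scope ereal_scope.
Context d (T : measurableType d) (R : realType).
Variable m : {sigma_finite_measure set T -> \bar R}.

(* P and Q are added rather than subtracted, so that no integrability is needed. *)
Lemma symmetrized_integral_le (f P Q : T * T -> \bar R) :
  measurable_fun setT f -> measurable_fun setT P -> measurable_fun setT Q ->
  (forall z, 0 <= f z) -> (forall z, 0 <= P z) -> (forall z, 0 <= Q z) ->
  (forall x y, Q (x, y) + Q (y, x) <= f (x, y) + (P (x, y) + P (y, x))) ->
  \int[m]_x \int[m]_y Q (x, y) + \int[m]_x \int[m]_y Q (x, y) <=
  \int[m]_x \int[m]_y f (x, y) +
  (\int[m]_x \int[m]_y P (x, y) + \int[m]_x \int[m]_y P (x, y)).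
Proof.
move=> mf mP mQ f0 P0 Q0 H.
pose sw (z : T * T) := (z.2, z.1).
have msw : measurable_fun setT sw by exact: measurable_fun_pair.
have mS (h : T * T -> \bar R) : measurable_fun setT h -> measurable_fun setT (h \o sw).
  by move=> mh; exact: measurableT_comp.
have E (h : T * T -> \bar R) : measurable_fun setT h -> (forall z, 0 <= h z) ->
    \int[m]_x \int[m]_y h (x, y) = \int[m \x m]_z h z.
  by move=> mh h0; rewrite fubini_tonelli1.
(* Each of [P] and [Q] is integrated once as it stands and once with the variables exchanged, so
   that the hypothesis, which couples both orders, is integrated as a single inequality. *)
have ES (h : T * T -> \bar R) : measurable_fun setT h -> (forall z, 0 <= h z) ->
    \int[m]_x \int[m]_y h (x, y) = \int[m \x m]_z (h \o sw) z.
  move=> mh h0; rewrite (@fubini_tonelli2 _ _ _ _ _ m m (h \o sw) (mS _ mh))//.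
  by move=> z; exact: h0.
rewrite {1}(E Q)// (ES Q)// (E f)// {1}(E P)// (ES P)//.
rewrite -!ge0_integralD//; first last.
- exact: mS.
- by move=> z _; exact: Q0.
- exact: mS.
- by move=> z _; exact: P0.
- by apply: emeasurable_funD => //; exact: mS.
- by move=> z _; apply: adde_ge0; exact: P0.
apply: ge0_le_integral => //.
- by move=> z _; apply: adde_ge0; exact: Q0.
- by apply: emeasurable_funD => //; exact: mS.
- by apply: emeasurable_funD => //; apply: emeasurable_funD => //; exact: mS.
- by move=> [x y] _; exact: H.
Qed.

End comparison.

Section pair.
Context {R : realType}.
Variables (alpha p : R).
Hypotheses (a02 : 0 < alpha < 2) (p1 : 1 < p).
Local Notation g := (hardy_exp alpha p).

Lemma truncV k (t : R) : 0 < t -> trunc k t^-1 = trunc k t.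
Proof.
move=> t0; have tv : 0 < t^-1 by rewrite invr_gt0.
rewrite /trunc !indicE addrC; congr ((_ : bool)%:R + (_ : bool)%:R).
  apply/idP/idP; rewrite !inE => h.
    by move/(mem_inner_itv _ tv) : h; rewrite invrK.
  by apply/(mem_inner_itv _ tv); rewrite invrK.
apply/idP/idP; rewrite !inE => h; first exact/(mem_inner_itv _ t0).
exact/(mem_inner_itv _ t0).
Qed.

Lemma trunc_01 k (t : R) : trunc k t = 0 \/ trunc k t = 1.
Proof.
rewrite /trunc !indicE; have [h1|h1] := boolP (t \in outer_itv k); last first.
  by case: (t \in inner_itv k); rewrite add0r; [right|left].
rewrite (_ : t \in inner_itv k = false) ?addr0; first by right.
apply/negP; rewrite inE => /inner_itv_lt1; rewrite inE in h1.
by move/outer_itv_gt1 : h1 => /ltW; rewrite leNgt => /negP.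
Qed.

Lemma jump_itv_trunc k (lam t : R) : 2 <= lam -> 2 * lam <= k.+1%:R -> jump_itv lam t -> trunc k t = 1.
Proof.
move=> l2 lk; rewrite /jump_itv/= in_itv/= => /andP[lt tl].
have ot : outer_itv k t.
  rewrite /outer_itv/= in_itv/=; apply/andP; split; last first.
    by rewrite (le_trans tl)// (le_trans lk)// lerDr.
  have : k.+1%:R^-1 <= 1 :> R by rewrite invf_le1// ler1n.
  by move: (k.+1%:R^-1) => w w1; lra.
have [h|//] := trunc_01 k t; move: h.
by rewrite /trunc !indicE mem_set// mulr1n => /eqP; rewrite paddr_eq0// oner_eq0.
Qed.

Lemma exp_weightV (t : R) : 0 < t -> t^-1 `^ g = (t `^ g)^-1.
Proof. by move=> t0; rewrite -(powR_inv1 (ltW t0)) -powRrM mulN1r powRN. Qed.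

(** In the two orderings of the pair the ratio is [t] and [1 / t]. As [lam >= 2], at most one of
    them lies in [[lam, 2 lam]]; the gain then sits on one side only, and [ground_state_pointwise]
    applies with [s = t^g]. *)
Lemma ground_state_pair k (lam eta ex ey t a b : R) : 2 <= lam -> 2 * lam <= k.+1%:R -> 0 < t ->
  0 <= eta -> eta <= bregman_cst p / (2 * lam) -> 0 <= ex <= 1 -> 0 <= ey <= 1 ->
  `|a| `^ p * (trunc k t + eta * ex * \1_(jump_itv lam) t) +
  `|b| `^ p * (trunc k t^-1 + eta * ey * \1_(jump_itv lam) t^-1) <=
  (a - b) * (spow a (p - 1) - spow b (p - 1)) +
  (`|a| `^ p * (trunc k t * hardy_weight alpha p t +
      2 * eta * (ey * \1_(jump_itv lam) t^-1 * t^-1 `^ (1 - alpha))) +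
   `|b| `^ p * (trunc k t^-1 * hardy_weight alpha p t^-1 +
      2 * eta * (ex * \1_(jump_itv lam) t * t `^ (1 - alpha)))).
Proof.
wlog tS : a b t ex ey / t^-1 \notin jump_itv lam => [H|].
  move=> l2 lk t0 e0 e1 hx hy.
  have [tS|tS] := boolP (t^-1 \in jump_itv lam); last exact: H.
  have tn : t \notin jump_itv lam.
    apply/negP => ts; move: tS ts; rewrite !inE /jump_itv/= !in_itv/= => /andP[h1 _] /andP[h2 _].
    have : 1 < t by lra.
    rewrite -invf_lt1// => h; lra.
  have tv : 0 < t^-1 by rewrite invr_gt0.
  have := H b a t^-1 ey ex; rewrite invrK => /(_ tn l2 lk tv e0 e1 hy hx).
  rewrite addrC => /le_trans; apply; rewrite le_eqVlt; apply/orP; left; apply/eqP.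
  by rewrite [in RHS]addrC [in LHS](addrC (`|b| `^ p * _)) [LHS]addrC; congr (_ + _); ring.
move=> l2 lk t0 e0 e1 /andP[x0 x1] /andP[y0 y1].
have Sv : \1_(jump_itv lam) t^-1 = 0 :> R by rewrite indicE (negbTE tS).
rewrite Sv !mulr0 !mul0r !mulr0 !addr0 truncV//.
(* Outside the truncation the indicator of [[lam, 2 lam]] is 0 as well, and only the nonnegativity
   of the Bregman form is left. *)
have [T0|T1] := trunc_01 k t.
  have -> : \1_(jump_itv lam) t = 0 :> R.
    rewrite indicE memNset// => /(jump_itv_trunc l2 lk); rewrite T0 => /esym/eqP.
    by rewrite oner_eq0.
  by rewrite T0 !mulr0 !mul0r !mulr0 !addr0 !mulr0 !addr0; exact: sobolev_bregman_ge0.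
rewrite T1 !mul1r !hardy_weightE// exp_weightV//.
have s0 : 0 < t `^ g by rewrite powR_gt0.
have p0 : 0 < p by exact: lt_trans p1.
(* Since [g p = alpha - 1], this is the factor [t^(1-alpha)] of the cost. *)
have sp : (t `^ g) `^ (- p) = t `^ (1 - alpha).
  by rewrite -powRrM; congr (_ `^ _); rewrite /hardy_exp; field; rewrite gt_eqF.
have c0 := bregman_cst_gt0 p1.
have l0 : 0 < lam by lra.
set e := eta * ex * \1_(jump_itv lam) t.
have ee : 0 <= e by rewrite mulr_ge0 ?mulr_ge0// indicE.
(* The exponents [g] and [g (p - 1)] exceed -1, so for [1 <= t <= 2 lam] both powers are at least
   [1 / (2 lam)]; this is the origin of the bound on [eta]. *)
have main : e <= bregman_cst p * t `^ g /\ e <= bregman_cst p * (t `^ g) `^ (p - 1).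
  rewrite /e indicE; case: (boolP (t \in _)) => [|_]; last first.
    by rewrite mulr0; split; apply: mulr_ge0; rewrite ?powR_ge0// ltW.
  rewrite inE /jump_itv/= in_itv/= => /andP[lt tl]; rewrite mulr1.
  have t1 : 1 <= t by lra.
  have low c : -1 <= c -> (2 * lam)^-1 <= t `^ c.
    move=> c1; apply: (@le_trans _ _ (t `^ (-1))); last exact: ler_powR.
    by rewrite powR_inv1 ?(ltW t0)// lef_pV2 ?posrE ?mulr_gt0.
  have ex1 : eta * ex <= bregman_cst p * (2 * lam)^-1.
    by apply: le_trans e1; rewrite ler_piMr.
  have [gb gb' _ _ _] := hardy_exp_bounds a02 p1.
  split; apply: (le_trans ex1); rewrite ler_wpM2l ?(ltW c0)//.
    by apply: low; case/andP: gb => /ltW.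
  rewrite -powRrM (_ : g * (p - 1) = alpha - 1 - g); last by rewrite /hardy_exp; field; rewrite gt_eqF.
  by apply: low; case/andP: gb' => /ltW.
have [m1 m2] := main.
have := ground_state_pointwise p1 a b s0 ee m1 m2.
rewrite sp => H.
have -> : 2 * eta * (ex * \1_(jump_itv lam) t * t `^ (1 - alpha)) = 2 * e * t `^ (1 - alpha).
  by rewrite /e; ring.
move: H; set A := `|a| `^ p; set B := `|b| `^ p; set Y1 := young_weight _ _; set Y2 := young_weight _ _.
rewrite -subr_ge0 => H; rewrite -subr_ge0; apply: (le_trans H).
by rewrite le_eqVlt; apply/orP; left; apply/eqP; ring.
Qed.

End pair.

Section linear_combination.
Context d (T : measurableType d) (R : realType).
Variable m : {measure set T -> \bar R}.

Lemma ge0_integral_lincomb (i j : T -> R) (c1 c2 I J : R) :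
  measurable_fun setT i -> measurable_fun setT j -> (forall x, 0 <= i x) -> (forall x, 0 <= j x) ->
  0 <= c1 -> 0 <= c2 ->
  (\int[m]_x (i x)%:E = I%:E)%E -> (\int[m]_x (j x)%:E = J%:E)%E ->
  (\int[m]_x (c1 * i x + c2 * j x)%:E = (c1 * I + c2 * J)%:E)%E.
Proof.
move=> mi mj i0 j0 c10 c20 iI jJ.
under eq_integral do rewrite EFinD !EFinM.
have mi' : measurable_fun setT (fun x => (i x)%:E) by exact/measurable_EFinP.
have mj' : measurable_fun setT (fun x => (j x)%:E) by exact/measurable_EFinP.
rewrite ge0_integralD; [|exact: measurableT| | | |]; first last.
- exact: measurable_funeM.
- by move=> x _; rewrite -EFinM lee_fin mulr_ge0.
- exact: measurable_funeM.
- by move=> x _; rewrite -EFinM lee_fin mulr_ge0.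
rewrite ge0_integralZl_EFin; [|exact: measurableT|by move=> x _; rewrite lee_fin|exact: mi'|exact: c10].
rewrite ge0_integralZl_EFin; [|exact: measurableT|by move=> x _; rewrite lee_fin|exact: mj'|exact: c20].
by rewrite iI jJ EFinD !EFinM.
Qed.

End linear_combination.

(** * Weights depending on the ratio, integrated against the kernel *)

Section halfspace_integrals.
Context {R : realType}.
Local Notation leb := (@lebesgue_measure R).
Variable alpha : R.
Hypothesis a02 : 0 < alpha < 2.

Definition kernel_exp n : R := (n.+2%:R + alpha) / 2.

(** Half of the prefactor of [hardy_const], up to sign; the factor 2 comes back from counting both
    orderings of a pair. *)
Definition dim_cst n : R :=
  pi `^ ((n%:R + 1) / 2) * Gamma ((1 + alpha) / 2) / Gamma (kernel_exp n).

Lemma kernel_exp_gt n : n%:R / 2 < kernel_exp n.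
Proof.
have A0 : 0 < alpha by case/andP: a02.
rewrite /kernel_exp ltr_pM2r ?invr_gt0// -[n.+2]addn2 natrD -addrA ltrDl; lra.
Qed.

Lemma kernel_expE n : kernel_exp n - n%:R / 2 = 1 + alpha / 2.
Proof. by rewrite /kernel_exp -[n.+2]addn2 natrD; field. Qed.

Lemma dim_cst_gt0 n : 0 < dim_cst n.
Proof.
have A0 : 0 < alpha by case/andP: a02.
have k0 : 0 < kernel_exp n by rewrite (le_lt_trans _ (kernel_exp_gt n))// divr_ge0.
rewrite divr_gt0 ?Gamma_gt0// mulr_gt0 ?powR_gt0 ?pi_gt0// Gamma_gt0//; lra.
Qed.

Lemma dim_cstE n : dim_cst n =
  pi `^ (n%:R / 2) * Gamma (1 + alpha / 2) / Gamma (kernel_exp n) * slice_cst alpha.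
Proof.
have A0 : 0 < alpha by case/andP: a02.
rewrite /dim_cst /slice_cst mulrDl mul1r gt0_powRD ?pi_gt0// powR12_sqrt ?pi_ge0//.
have : 0 < Gamma (1 + alpha / 2) by apply: Gamma_gt0; lra.
move: (Gamma (1 + alpha / 2)) (Gamma (kernel_exp n)) (Gamma ((1 + alpha) / 2)) => a b c a0.
have [->|b0] := eqVneq b 0; first by rewrite invr0 !mulr0 !mul0r.
by field; rewrite b0 gt_eqF.
Qed.

Lemma hardy_constE n (p : R) :
  hardy_const n.+2 alpha p = 2 * dim_cst n * - hardy_bracket alpha p.
Proof.
rewrite /hardy_const mulrN mulNr; congr (- (_ * _)).
by rewrite (_ : (n.+2%:R - 1) / 2 = (n%:R + 1) / 2 :> R) ?mulrA// -[n.+2]addn2 natrD; field.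
Qed.

Lemma integral_ratio n (x : 'rV[R]_n.+2) (g : R -> R) : 0 < last_coord x ->
  measurable_fun [set: R] g -> (forall t, 0 <= g t) -> g 1 = 0 ->
  (\int[lebesgue_rV n.+2]_y (g (last_coord y / last_coord x) * sqdist x y `^ (- kernel_exp n))%:E =
   (dim_cst n * last_coord x `^ (- alpha))%:E * \int[leb]_t (g t * jump_kernel alpha t)%:E)%E.
Proof.
move=> x0 mg g0 g1.
pose G (z : R * R) := g (z.2 / last_coord x).
have mG : measurable_fun [set: R * R]%type G.
  by apply: (measurableT_comp mg); exact: measurable_funM.
have Gx a : G (a, last_coord x) = 0 by rewrite /G/= divff ?gt_eqF.
rewrite (integral_kernel (kernel_exp_gt n) mG (fun z => g0 _) Gx) kernel_expE dim_cstE.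
rewrite /G/= (integral_transverse a02 (penult_coord x) x0 mg g0 g1).
by rewrite muleA -EFinM mulrA.
Qed.

Variable tau : R.
Hypothesis ht : 0 < tau < 1 + alpha.

Definition depth_coord n (x : 'rV[R]_n.+2) : R := depth tau (penult_coord x) (last_coord x).

(** In this cost term the depth is taken at [y] while the ratio is [x_d / y_d], so [y] is the point
    near the boundary. After [integral_kernel] the claim is the two-variable bound of [depth_bound],
    taken as a hypothesis because [lam] is known only through that existence statement. *)
Lemma integral_depth_ratio n (lam sigma : R) : 2 <= lam ->
  (forall X Y : R, 0 < X ->
  (\int[leb]_b \int[leb]_a (\1_(jump_itv lam) (X / b) * (X / b) `^ (1 - alpha) * depth tau a b *
     ((Y - a) ^+ 2 + (X - b) ^+ 2) `^ (- (1 + alpha / 2)))%:E <=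
   (4^-1 * slice_cst alpha * X `^ (- alpha) * depth tau Y X)%:E *
   \int[leb]_t (\1_(jump_itv lam) t * jump_kernel alpha t)%:E)%E) ->
  (\int[leb]_t (\1_(jump_itv lam) t * jump_kernel alpha t)%:E = sigma%:E)%E ->
  forall x : 'rV[R]_n.+2, 0 < last_coord x ->
  (\int[lebesgue_rV n.+2]_y (depth_coord y * \1_(jump_itv lam) (last_coord x / last_coord y) *
     (last_coord x / last_coord y) `^ (1 - alpha) * sqdist x y `^ (- kernel_exp n))%:E <=
   (4^-1 * (dim_cst n * last_coord x `^ (- alpha) * depth_coord x * sigma))%:E)%E.
Proof.
move=> l2 H sE x x0; have k0 : 0 < kernel_exp n.
  by rewrite (le_lt_trans _ (kernel_exp_gt n))// divr_ge0.
have A0 : 0 < alpha by case/andP: a02.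
have mI : measurable (jump_itv lam : set R) by exact: measurable_itv.
pose G (z : R * R) :=
  \1_(jump_itv lam) (last_coord x / z.2) * (last_coord x / z.2) `^ (1 - alpha) * depth tau z.1 z.2.
have mr : measurable_fun [set: R * R]%type (fun z : R * R => last_coord x / z.2).
  by apply: measurable_funM => //; exact: measurable_funV.
have mG : measurable_fun [set: R * R]%type G.
  apply: measurable_funM; last exact: measurable_depth.
  apply: measurable_funM; last by apply: (measurableT_comp (measurable_powR _)).
  by apply: (measurableT_comp (f := (\1_(jump_itv lam) : R -> R))); [exact: measurable_indic|exact: mr].
have G0 z : 0 <= G z by rewrite mulr_ge0 ?depth_ge0// mulr_ge0 ?powR_ge0// indicE.
have Gx a : G (a, last_coord x) = 0.
  rewrite /G/= divff ?gt_eqF// indicE memNset ?mul0r// /jump_itv/= in_itv/= => /andP[h _].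
  lra.
have -> : (\int[lebesgue_rV n.+2]_y (depth_coord y * \1_(jump_itv lam) (last_coord x / last_coord y) *
     (last_coord x / last_coord y) `^ (1 - alpha) * sqdist x y `^ (- kernel_exp n))%:E =
   \int[lebesgue_rV n.+2]_y (G (penult_coord y, last_coord y) * sqdist x y `^ (- kernel_exp n))%:E)%E.
  apply: eq_integral => y _; congr EFin; congr (_ * _).
  by rewrite /G/= /depth_coord -mulrA mulrC.
rewrite (integral_kernel (kernel_exp_gt n) mG G0 Gx) kernel_expE /G/=.
set K := (X in (X%:E * _ <= _)%E).
have K0 : 0 <= K.
  by rewrite /K mulr_ge0 ?invr_ge0 ?Gamma_ge0// mulr_ge0 ?powR_ge0// Gamma_ge0//; lra.
apply: (@le_trans _ _ (K%:E * ((4^-1 * slice_cst alpha * last_coord x `^ (- alpha) *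
  depth tau (penult_coord x) (last_coord x))%:E * sigma%:E))%E).
  by apply: lee_wpmul2l; [rewrite lee_fin|rewrite -sE; exact: H].
rewrite -!EFinM lee_fin dim_cstE -/K le_eqVlt; apply/orP; left; apply/eqP.
by rewrite /depth_coord; move: (slice_cst alpha) K {K0} => a b; ring.
Qed.

Lemma jump_itv_fin (lam : R) : 2 <= lam -> exists2 sigma : R, 0 < sigma &
  (\int[leb]_t (\1_(jump_itv lam) t * jump_kernel alpha t)%:E = sigma%:E)%E.
Proof.
move=> l2; have mI : measurable (jump_itv lam : set R) by exact: measurable_itv.
have l0 : 0 < lam by lra.
have := jump_itv_mass a02 l2; set S := (\int[leb]_t _)%E => Sge.
have fS : S \is a fin_num.
  rewrite /S integral_indicM//.
  have : leb.-integrable (jump_itv lam) (EFin \o jump_kernel alpha).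
    apply: continuous_compact_integrable; first exact: segment_compact.
    apply: continuous_in_subspaceT => t; rewrite inE /jump_itv/= in_itv/= => /andP[lt _].
    apply: (@continuous_comp _ _ _ (fun t : R => (1 - t) ^+ 2) (fun t => t `^ _)).
      apply: (@continuous_comp _ _ _ (fun s : R => 1 - s) (fun t => t ^+ 2)); last exact: exprn_continuous.
      by apply: cvgB; [exact: cvg_cst|exact: cvg_id].
    by apply: continuous_powR; rewrite exprn_even_gt0//= subr_eq0 lt_eqF//; lra.
  by apply: integrable_fin_num.
exists (fine S); last by rewrite fineK.
rewrite -lte_fin fineK//; apply: lt_le_trans Sge.
by rewrite lte_fin mulr_gt0 ?powR_gt0.
Qed.

End halfspace_integrals.

(** * Lower bound for the Bregman form at a fixed truncation *)

Section core.
Context {R : realType}.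
Local Notation leb := (@lebesgue_measure R).
Variables (n : nat) (alpha p tau : R).
Hypotheses (a02 : 0 < alpha < 2) (p1 : 1 < p) (ht : 0 < tau < 1 + alpha).
Local Notation mu := (lebesgue_rV n.+2).
Local Notation X := (@last_coord R n).
Local Notation s := (kernel_exp alpha n).
Local Notation cd := (dim_cst alpha n).

(** The half-space is encoded by indicators inside the integrand, so that Tonelli and the exchange
    of variables take place on the full product space. *)
Definition bregman_integrand (v : 'rV[R]_n.+2 -> R) (z : 'rV[R]_n.+2 * 'rV[R]_n.+2) : R :=
  \1_(@halfspace R n.+1) z.1 * \1_(@halfspace R n.+1) z.2 *
  ((v z.1 - v z.2) * (spow (v z.1) (p - 1) - spow (v z.2) (p - 1))) * sqdist z.1 z.2 `^ (- s).

Lemma measurable_spow d (T : measurableType d) (f : T -> R) (t : R) :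
  measurable_fun setT f -> measurable_fun setT (fun x => spow (f x) t).
Proof.
move=> mf; apply: measurable_funM.
  apply: (measurableT_comp (measurable_powR _)); exact: measurableT_comp.
rewrite (_ : (fun x => Num.sg (f x)) = (fun x => f x * `|f x|^-1)).
  by apply: measurable_funM => //; apply: measurable_funV; exact: measurableT_comp.
apply/funext => x; have [->|f0] := eqVneq (f x) 0; first by rewrite sgr0 mul0r.
by rewrite {2}[f x]numEsg mulfK// normr_eq0.
Qed.

Lemma measurable_halfspace : measurable (@halfspace R n.+1).
Proof. by apply: open_measurable_rV; exact: open_halfspace. Qed.

Variable v : 'rV[R]_n.+2 -> R.
Hypothesis mv : measurable_fun [set: 'rV[R]_n.+2] v.
Hypothesis v0 : forall x, v x != 0 -> 0 < X x.

Let A x := `|v x| `^ p.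
Let mA : measurable_fun [set: 'rV[R]_n.+2] A.
Proof. apply: (measurableT_comp (measurable_powR _)); exact: measurableT_comp. Qed.
Let A0 x : 0 <= A x. Proof. exact: powR_ge0. Qed.
Let p0 : 0 < p. Proof. exact: lt_trans p1. Qed.
Let Av x : v x = 0 -> A x = 0. Proof. by move=> h; rewrite /A h normr0 powR0// gt_eqF. Qed.

Lemma measurable_bregman_integrand :
  measurable_fun [set: 'rV[R]_n.+2 * 'rV[R]_n.+2]%type (bregman_integrand v).
Proof.
have mI : measurable_fun setT (\1_(@halfspace R n.+1) : 'rV[R]_n.+2 -> R).
  by apply: measurable_indic; exact: measurable_halfspace.
have m1 : measurable_fun [set: 'rV[R]_n.+2 * 'rV[R]_n.+2]%type (fun z => v z.1).
  exact: measurableT_comp.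
have m2 : measurable_fun [set: 'rV[R]_n.+2 * 'rV[R]_n.+2]%type (fun z => v z.2).
  exact: measurableT_comp.
apply: measurable_funM.
  apply: measurable_funM.
    by apply: measurable_funM; [apply: (measurableT_comp mI)|apply: (measurableT_comp mI)].
  by apply: measurable_funM; apply: measurable_funB => //; exact: measurable_spow.
by apply: (measurableT_comp (measurable_powR _)); exact: measurable_sqdist.
Qed.

Lemma bregman_integrand_ge0 z : 0 <= bregman_integrand v z.
Proof.
by rewrite mulr_ge0 ?powR_ge0// mulr_ge0 ?sobolev_bregman_ge0// !indicE mulr_ge0.
Qed.

(** The gain [Q] integrates to [cd Zp Ir + cd eta sigma Jr] and the cost [P] to at most
    [cd Zm Ir + cd eta sigma Jr / 2], the half being [2 eta] times the quarter of [depth_bound].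
    Both are counted twice by [symmetrized_integral_le]. *)
Lemma bregman_lower_bound (lam eta sigma Ir Jr Zp Zm : R) (k : nat) :
  2 <= lam -> 2 * lam <= k.+1%:R -> 0 < eta -> eta <= bregman_cst p / (2 * lam) -> 0 < sigma ->
  (forall Y X : R, 0 < Y ->
  (\int[leb]_b \int[leb]_a (\1_(jump_itv lam) (Y / b) * (Y / b) `^ (1 - alpha) * depth tau a b *
     ((X - a) ^+ 2 + (Y - b) ^+ 2) `^ (- (1 + alpha / 2)))%:E <=
   (4^-1 * slice_cst alpha * Y `^ (- alpha) * depth tau X Y)%:E *
   \int[leb]_t (\1_(jump_itv lam) t * jump_kernel alpha t)%:E)%E) ->
  (\int[leb]_t (\1_(jump_itv lam) t * jump_kernel alpha t)%:E = sigma%:E)%E ->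
  (\int[leb]_t (trunc k t * 1 * jump_kernel alpha t)%:E = Zp%:E)%E ->
  (\int[leb]_t (trunc k t * hardy_weight alpha p t * jump_kernel alpha t)%:E = Zm%:E)%E ->
  (\int[mu]_x (A x * X x `^ (- alpha))%:E = Ir%:E)%E ->
  (\int[mu]_x (A x * X x `^ (- alpha) * depth_coord tau x)%:E = Jr%:E)%E ->
  ((2 * cd * (Zp - Zm) * Ir + cd * eta * sigma * Jr)%:E <=
   \int[mu]_x \int[mu]_y (bregman_integrand v (x, y))%:E)%E.
Proof.
move=> l2 lk eta0 etac sigma0 Hdepth sigmaE ZpE ZmE IrE JrE.
have cd0 := dim_cst_gt0 a02 n.
pose ker (z : 'rV[R]_n.+2 * 'rV[R]_n.+2) := sqdist z.1 z.2 `^ (- s).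
have mker : measurable_fun setT ker.
  by apply: (measurableT_comp (measurable_powR _)); exact: measurable_sqdist.
have ker0 z : 0 <= ker z by exact: powR_ge0.
have mS : measurable_fun setT (\1_(jump_itv lam) : R -> R).
  by apply: measurable_indic; exact: measurable_itv.
have S0 t : 0 <= \1_(jump_itv lam) t :> R by rewrite indicE.
have mX1 : measurable_fun [set: 'rV[R]_n.+2 * 'rV[R]_n.+2]%type (fun z => X z.1).
  exact: measurable_coord.
have mX2 : measurable_fun [set: 'rV[R]_n.+2 * 'rV[R]_n.+2]%type (fun z => X z.2).
  exact: measurable_coord.
have mY1 : measurable_fun [set: 'rV[R]_n.+2 * 'rV[R]_n.+2]%type (fun z => penult_coord z.1).
  exact: measurable_coord.
have mY2 : measurable_fun [set: 'rV[R]_n.+2 * 'rV[R]_n.+2]%type (fun z => penult_coord z.2).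
  exact: measurable_coord.
have md1 : measurable_fun [set: 'rV[R]_n.+2 * 'rV[R]_n.+2]%type (fun z => depth_coord tau z.1).
  exact: measurable_depth.
have md2 : measurable_fun [set: 'rV[R]_n.+2 * 'rV[R]_n.+2]%type (fun z => depth_coord tau z.2).
  exact: measurable_depth.
have mr : measurable_fun [set: 'rV[R]_n.+2 * 'rV[R]_n.+2]%type (fun z => X z.2 / X z.1).
  by apply: measurable_funM => //; exact: measurable_funV.
have mr' : measurable_fun [set: 'rV[R]_n.+2 * 'rV[R]_n.+2]%type (fun z => X z.1 / X z.2).
  by apply: measurable_funM => //; exact: measurable_funV.
have mA1 : measurable_fun [set: 'rV[R]_n.+2 * 'rV[R]_n.+2]%type (fun z => A z.1).
  exact: measurableT_comp.
have d0 x : 0 <= depth_coord tau x by exact: depth_ge0.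
(* Only the terms attached to [z.1] are collected in [Q] and [P]; those attached to the other point
   come from exchanging the variables. *)
pose q (z : 'rV[R]_n.+2 * 'rV[R]_n.+2) :=
  (trunc k (X z.2 / X z.1) + eta * depth_coord tau z.1 * \1_(jump_itv lam) (X z.2 / X z.1)) * ker z.
pose r1 (z : 'rV[R]_n.+2 * 'rV[R]_n.+2) :=
  trunc k (X z.2 / X z.1) * hardy_weight alpha p (X z.2 / X z.1) * ker z.
pose r2 (z : 'rV[R]_n.+2 * 'rV[R]_n.+2) :=
  depth_coord tau z.2 * \1_(jump_itv lam) (X z.1 / X z.2) * (X z.1 / X z.2) `^ (1 - alpha) * ker z.
have mq : measurable_fun setT q.
  apply: measurable_funM => //; apply: measurable_funD.
    by apply: (measurableT_comp (measurable_trunc k)).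
  apply: measurable_funM; last by apply: (measurableT_comp mS).
  exact: measurable_funM.
have mr1 : measurable_fun setT r1.
  apply: measurable_funM => //; apply: measurable_funM.
    by apply: (measurableT_comp (measurable_trunc k)).
  by apply: (measurableT_comp (measurable_hardy_weight alpha p)).
have mr2 : measurable_fun setT r2.
  apply: measurable_funM => //; apply: measurable_funM.
    by apply: measurable_funM => //; apply: (measurableT_comp mS).
  by apply: (measurableT_comp (measurable_powR _)).
have q0 z : 0 <= q z.
  by rewrite mulr_ge0// addr_ge0 ?trunc_ge0// mulr_ge0// mulr_ge0// ltW.
have r10 z : 0 <= r1 z by rewrite mulr_ge0// mulr_ge0 ?trunc_ge0// hardy_weight_ge0.
have r20 z : 0 <= r2 z by rewrite mulr_ge0// mulr_ge0 ?powR_ge0// mulr_ge0.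
pose Q z : \bar R := (A z.1 * q z)%:E.
pose P z : \bar R := (A z.1 * (1 * r1 z + 2 * eta * r2 z))%:E.
pose f z : \bar R := (bregman_integrand v z)%:E.
have e20 : 0 <= 2 * eta by rewrite mulr_ge0// ltW.
have mr12 : measurable_fun setT (fun z => 1 * r1 z + 2 * eta * r2 z).
  by apply: measurable_funD; apply: measurable_funM.
have r120 z : 0 <= 1 * r1 z + 2 * eta * r2 z by rewrite addr_ge0// mulr_ge0.
have mQ : measurable_fun setT Q by apply/measurable_EFinP; exact: measurable_funM.
have mP : measurable_fun setT P by apply/measurable_EFinP; exact: measurable_funM.
have mf : measurable_fun setT f by apply/measurable_EFinP; exact: measurable_bregman_integrand.
have Q0 z : (0 <= Q z)%E by rewrite lee_fin mulr_ge0.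
have P0 z : (0 <= P z)%E by rewrite lee_fin mulr_ge0.
have f0 z : (0 <= f z)%E by rewrite lee_fin bregman_integrand_ge0.
have nonpos_ratio (t : R) : t <= 0 -> trunc k t = 0 /\ \1_(jump_itv lam) t = 0 :> R.
  move=> t0; split.
    rewrite /trunc !indicE !memNset ?addr0//.
      by move=> /inner_itv_gt0; rewrite ltNge t0.
    by move=> /outer_itv_gt1 t1; lra.
  by rewrite indicE memNset// /jump_itv/= in_itv/= => /andP[t1 _]; lra.
have one_ratio : trunc k (1 : R) = 0 /\ \1_(jump_itv lam) (1 : R) = 0 :> R.
  split.
    rewrite /trunc !indicE !memNset ?addr0//.
      by move=> /inner_itv_lt1; rewrite ltxx.
    by move=> /outer_itv_gt1; rewrite ltxx.
  by rewrite indicE memNset// /jump_itv/= in_itv/= => /andP[t1 _]; lra.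
have kerC x y : ker (x, y) = ker (y, x) by rewrite /ker/= sqdistC.
(* [v] vanishes where [x_d <= 0], and the ratio of such a height to a positive one is nonpositive,
   outside the truncation: pairs with a point off the half-space carry no gain. *)
have outside x y : X x <= 0 -> A x * q (x, y) = 0 /\ A y * q (y, x) = 0.
  move=> Xx; have vx : v x = 0.
    by apply/eqP; apply/negP => /negP /v0; rewrite ltNge Xx.
  split; first by rewrite Av// mul0r.
  have [/Av ->|/v0 Xy] := eqVneq (v y) 0; first by rewrite mul0r.
  have [T0 J0] : trunc k (X x / X y) = 0 /\ \1_(jump_itv lam) (X x / X y) = 0 :> R.
    by apply: nonpos_ratio; rewrite pmulr_lle0// invr_gt0.
  by rewrite /q/= T0 J0 mulr0 addr0 mul0r mulr0.
have pw x y : (Q (x, y) + Q (y, x) <= f (x, y) + (P (x, y) + P (y, x)))%E.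
  have [Xx|Xx] := leP (X x) 0.
    have [-> e] : Q (x, y) = 0%E /\ Q (y, x) = 0%E.
      by rewrite /Q/=; have [-> ->] := outside x y Xx.
    by rewrite e adde0; apply: adde_ge0 => //; apply: adde_ge0.
  have [Xy|Xy] := leP (X y) 0.
    have [-> e] : Q (x, y) = 0%E /\ Q (y, x) = 0%E.
      by rewrite /Q/=; have [-> ->] := outside y x Xy.
    by rewrite e adde0; apply: adde_ge0 => //; apply: adde_ge0.
  have t0 : 0 < X y / X x by exact: divr_gt0.
  rewrite -!EFinD lee_fin.
  have ex1 : 0 <= depth_coord tau x <= 1 by rewrite d0/=; apply: (depth_le1 ht).
  have ey1 : 0 <= depth_coord tau y <= 1 by rewrite d0/=; apply: (depth_le1 ht).
  have := ground_state_pair a02 p1 (v x) (v y) l2 lk t0 (ltW eta0) etac ex1 ey1.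
  rewrite invf_div => /(ler_wpM2r (ker0 (x, y))) => H.
  have -> : A x * q (x, y) + A y * q (y, x) =
      (`|v x| `^ p * (trunc k (X y / X x) + eta * depth_coord tau x * \1_(jump_itv lam) (X y / X x)) +
       `|v y| `^ p * (trunc k (X x / X y) + eta * depth_coord tau y * \1_(jump_itv lam) (X x / X y))) * ker (x, y).
    by rewrite /q/= (kerC y x) /A; ring.
  apply: (le_trans H); rewrite le_eqVlt; apply/orP; left; apply/eqP.
  have I1 : \1_(@halfspace R n.+1) x = 1 :> R by rewrite indicE mem_set.
  have I2 : \1_(@halfspace R n.+1) y = 1 :> R by rewrite indicE mem_set.
  rewrite /bregman_integrand /r1 /r2 /A/= (kerC y x) I1 I2 -/(ker (x, y)).
  move: (ker (x, y)) => K.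
  by ring.
have iA : measurable_fun setT (fun x => A x * X x `^ (- alpha)).
  apply: measurable_funM => //; apply: (measurableT_comp (measurable_powR _)).
  exact: measurable_rV_coord.
have jA : measurable_fun setT (fun x => A x * X x `^ (- alpha) * depth_coord tau x).
  apply: measurable_funM => //; apply: measurable_depth; exact: measurable_rV_coord.
have iA0 x : 0 <= A x * X x `^ (- alpha) by rewrite mulr_ge0 ?powR_ge0.
have jA0 x : 0 <= A x * X x `^ (- alpha) * depth_coord tau x by rewrite mulr_ge0.
have j0 t : 0 <= jump_kernel alpha t by exact: powR_ge0.
have mj := measurable_jump_kernel alpha.
have Zp0 : 0 <= Zp.
  by rewrite -lee_fin -ZpE; apply: integral_ge0 => t _; rewrite lee_fin mulr_ge0// mulr1 trunc_ge0.
have Zm0 : 0 <= Zm.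
  rewrite -lee_fin -ZmE; apply: integral_ge0 => t _; rewrite lee_fin mulr_ge0//.
  by rewrite mulr_ge0 ?trunc_ge0// hardy_weight_ge0.
have Xpos x : A x != 0 -> 0 < X x.
  by move=> Ax; apply: v0; apply: contraNN Ax => /eqP /Av ->.
have mpair (h : 'rV[R]_n.+2 * 'rV[R]_n.+2 -> R) x : measurable_fun setT h ->
    measurable_fun setT (fun y => (h (x, y))%:E).
  move=> mh; apply/measurable_EFinP; apply: (measurableT_comp mh); exact: pair1_measurable.
have c0 : 0 <= cd * eta * sigma := mulr_ge0 (mulr_ge0 (ltW cd0) (ltW eta0)) (ltW sigma0).
have := symmetrized_integral_le mu mf mP mQ f0 P0 Q0 pw.
have QE : (\int[mu]_x \int[mu]_y Q (x, y) = (cd * Zp * Ir + cd * eta * sigma * Jr)%:E)%E.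
  rewrite -(ge0_integral_lincomb iA jA iA0 jA0 (mulr_ge0 (ltW cd0) Zp0) c0 IrE JrE).
  apply: eq_integral => x _.
  under eq_integral do rewrite /Q EFinM [(x, _).1]/=.
  rewrite ge0_integralZl_EFin; [|exact: measurableT|by move=> y _; rewrite lee_fin|exact: mpair|exact: A0].
  have [->|/Xpos Xx] := eqVneq (A x) 0; first by rewrite !mul0r !mulr0 addr0 mul0e.
  pose g t := trunc k t + eta * depth_coord tau x * \1_(jump_itv lam) t.
  have mg : measurable_fun [set: R] g.
    by apply: measurable_funD; [exact: measurable_trunc|exact: measurable_funM].
  have ed0 : 0 <= eta * depth_coord tau x by rewrite mulr_ge0// ltW.
  have g0 t : 0 <= g t by rewrite addr_ge0 ?trunc_ge0// mulr_ge0.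
  have g1 : g 1 = 0 by rewrite /g; have [-> ->] := one_ratio; rewrite mulr0 addr0.
  have -> : (\int[mu]_y (q (x, y))%:E = (cd * X x `^ (- alpha))%:E * \int[leb]_t (g t * jump_kernel alpha t)%:E)%E.
    by rewrite -(integral_ratio a02 Xx mg g0 g1).
  have -> : (\int[leb]_t (g t * jump_kernel alpha t)%:E = (1 * Zp + eta * depth_coord tau x * sigma)%:E)%E.
    rewrite -(@ge0_integral_lincomb _ _ _ leb (fun t => trunc k t * 1 * jump_kernel alpha t)
      (fun t => \1_(jump_itv lam) t * jump_kernel alpha t) _ _ _ _ _ _ _ _ ler01 ed0 ZpE sigmaE).
    - by apply: eq_integral => t _; congr EFin; rewrite /g; ring.
    - apply: measurable_funM => //; apply: measurable_funM => //; exact: measurable_trunc.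
    - exact: measurable_funM.
    - by move=> t; rewrite mulr_ge0// mulr1 trunc_ge0.
    - by move=> t; rewrite mulr_ge0.
  by rewrite -!EFinM; congr EFin; ring.
have PE : (\int[mu]_x \int[mu]_y P (x, y) <= (cd * Zm * Ir + cd * eta * sigma / 2 * Jr)%:E)%E.
  have c02 : 0 <= cd * eta * sigma / 2 by rewrite divr_ge0.
  rewrite -(ge0_integral_lincomb iA jA iA0 jA0 (mulr_ge0 (ltW cd0) Zm0) c02 IrE JrE).
  apply: ge0_le_integral.
  - exact: measurableT.
  - by move=> x _; apply: integral_ge0 => y _.
  - exact: (@measurable_fun_fubini_tonelli_F _ _ _ _ _ mu P mP P0).
  - by apply/measurable_EFinP; apply: measurable_funD; exact: measurable_funM.
  move=> x _.
  under eq_integral do rewrite /P EFinM [(x, _).1]/=.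
  rewrite ge0_integralZl_EFin; [|exact: measurableT|by move=> y _; rewrite lee_fin
    |exact: (mpair (fun z => 1 * r1 z + 2 * eta * r2 z))|exact: A0].
  have [->|/Xpos Xx] := eqVneq (A x) 0; first by rewrite !mul0r !mulr0 addr0 mul0e.
  pose g t := trunc k t * hardy_weight alpha p t.
  have mg : measurable_fun [set: R] g.
    by apply: measurable_funM; [exact: measurable_trunc|exact: measurable_hardy_weight].
  have g0 t : 0 <= g t by rewrite mulr_ge0 ?trunc_ge0// hardy_weight_ge0.
  have g1 : g 1 = 0 by rewrite /g; have [-> _] := one_ratio; rewrite mul0r.
  have r1E : (\int[mu]_y (r1 (x, y))%:E = (cd * X x `^ (- alpha) * Zm)%:E)%E.
    by rewrite EFinM -ZmE -(integral_ratio a02 Xx mg g0 g1).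
  have r2E : (\int[mu]_y (r2 (x, y))%:E <= (4^-1 * (cd * X x `^ (- alpha) * depth_coord tau x * sigma))%:E)%E.
    exact: (integral_depth_ratio a02 l2 Hdepth sigmaE Xx).
  (* Only an upper bound for this integral is known; being nonnegative it is then a real number, as
     [ge0_integral_lincomb] asks. *)
  have [e e4] : exists2 e : R, (\int[mu]_y (r2 (x, y))%:E)%E = e%:E &
      e <= 4^-1 * (cd * X x `^ (- alpha) * depth_coord tau x * sigma).
    move: r2E; have : (0 <= \int[mu]_y (r2 (x, y))%:E)%E by apply: integral_ge0 => y _; rewrite lee_fin.
    by case: (\int[mu]_y (r2 (x, y))%:E)%E => // e _ e4; exists e.
  have mm (h : 'rV[R]_n.+2 * 'rV[R]_n.+2 -> R) : measurable_fun setT h ->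
      measurable_fun setT (fun y => h (x, y)).
    by move=> mh; apply: (measurableT_comp mh); exact: pair1_measurable.
  move=> ee.
  rewrite (ge0_integral_lincomb (mm _ mr1) (mm _ mr2) (fun y => r10 (x, y)) (fun y => r20 (x, y)) ler01 e20 r1E e4).
  rewrite -EFinM lee_fin.
  apply: (@le_trans _ _ (A x * (1 * (cd * X x `^ (- alpha) * Zm) +
     2 * eta * (4^-1 * (cd * X x `^ (- alpha) * depth_coord tau x * sigma))))).
    by apply: ler_wpM2l => //; rewrite lerD2l; apply: ler_wpM2l.
  rewrite le_eqVlt; apply/orP; left; apply/eqP.
  by move: (dim_cst alpha n) (depth_coord tau x) => c dd; field.
rewrite QE => H.
have {H} := le_trans H (leeD2l _ (leeD PE PE)).
have : (0 <= \int[mu]_x \int[mu]_y f (x, y))%E.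
  by apply: integral_ge0 => x _; apply: integral_ge0 => y _.
(* An infinite Bregman integral makes the claim trivial; otherwise the inequality is between reals
   and the cost can be subtracted. *)
rewrite -/f; case: (\int[mu]_x _)%E => [e _|_ _|//].
  rewrite -!EFinD !lee_fin; lra.
by rewrite leey.
Qed.

End core.

(** * Removal of the truncation *)

Section hardy_inequality.
Context {R : realType}.
Local Notation leb := (@lebesgue_measure R).
Variables (n : nat) (alpha p tau : R).
Hypotheses (a02 : 0 < alpha < 2) (p1 : 1 < p) (ht : 0 < tau < 1 + alpha).
Local Notation mu := (lebesgue_rV n.+2).
Local Notation X := (@last_coord R n).

(** In [bregman_lower_bound], [k] tends to infinity while [lam] and [eta], taken as large as
    allowed, stay fixed; the constant is [cd eta sigma], free of [v]. Finiteness of the Hardy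
    integral makes it a real factor of [Zp - Zm], whose limit is then [hardy_bracket_cvg]. *)
Lemma bregman_hardy : exists2 C : R, 0 < C & forall v : 'rV[R]_n.+2 -> R,
  measurable_fun [set: 'rV[R]_n.+2] v -> (forall x, v x != 0 -> 0 < X x) ->
  (\int[mu]_x (`|v x| `^ p * X x `^ (- alpha))%:E < +oo)%E ->
  ((hardy_const n.+2 alpha p)%:E * \int[mu]_x (`|v x| `^ p * X x `^ (- alpha))%:E +
   C%:E * \int[mu]_x (`|v x| `^ p * X x `^ (- alpha) * depth_coord tau x)%:E <=
   \int[mu]_x \int[mu]_y (bregman_integrand alpha p v (x, y))%:E)%E.
Proof.
have [lam l2 Hdepth] := depth_bound a02 ht.
have [sigma sigma0 sigmaE] := jump_itv_fin a02 l2.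
have l0 : 0 < 2 * lam by lra.
have e0 : 0 < bregman_cst p / (2 * lam) by rewrite divr_gt0// bregman_cst_gt0.
have cd0 := dim_cst_gt0 a02 n.
exists (dim_cst alpha n * (bregman_cst p / (2 * lam)) * sigma).
  by rewrite mulr_gt0// mulr_gt0.
move=> v mv v0 fin.
have mA : measurable_fun setT (fun x => `|v x| `^ p * X x `^ (- alpha)).
  apply: measurable_funM; apply: (measurableT_comp (measurable_powR _)).
    exact: measurableT_comp.
  exact: measurable_rV_coord.
have I0 : (0 <= \int[mu]_x (`|v x| `^ p * X x `^ (- alpha))%:E)%E.
  by apply: integral_ge0 => x _; rewrite lee_fin mulr_ge0 ?powR_ge0.
have J0 : (0 <= \int[mu]_x (`|v x| `^ p * X x `^ (- alpha) * depth_coord tau x)%:E)%E.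
  by apply: integral_ge0 => x _; rewrite lee_fin mulr_ge0 ?depth_ge0// mulr_ge0 ?powR_ge0.
have JI : (\int[mu]_x (`|v x| `^ p * X x `^ (- alpha) * depth_coord tau x)%:E <=
  \int[mu]_x (`|v x| `^ p * X x `^ (- alpha))%:E)%E.
  apply: ge0_le_integral.
  - exact: measurableT.
  - by move=> x _; rewrite lee_fin mulr_ge0 ?depth_ge0// mulr_ge0 ?powR_ge0.
  - apply/measurable_EFinP; apply: measurable_funM; first exact: mA.
    by apply: measurable_depth; exact: measurable_rV_coord.
  - exact/measurable_EFinP.
  move=> x _; rewrite lee_fin.
  have [vx|/v0 Xx] := eqVneq (v x) 0.
    by rewrite vx normr0 powR0 ?mul0r// gt_eqF// (lt_trans _ p1).
  by rewrite ler_piMr ?mulr_ge0 ?powR_ge0//; apply: (depth_le1 ht).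
have [Ir IrE] : exists Ir : R, (\int[mu]_x (`|v x| `^ p * X x `^ (- alpha))%:E = Ir%:E)%E.
  by move: I0 fin; case: (\int[mu]_x _)%E => // r _ _; exists r.
have [Jr JrE] : exists Jr : R,
    (\int[mu]_x (`|v x| `^ p * X x `^ (- alpha) * depth_coord tau x)%:E = Jr%:E)%E.
  by move: JI J0; rewrite IrE; case: (\int[mu]_x _)%E => // r _ _; exists r.
have E0 : (0 <= \int[mu]_x \int[mu]_y (bregman_integrand alpha p v (x, y))%:E)%E.
  by apply: integral_ge0 => x _; apply: integral_ge0 => y _; rewrite lee_fin bregman_integrand_ge0.
pose h k := \int[leb]_(s in expanding_itv k)
  (hardy_fun (hardy_exp alpha p) (alpha - 1 - hardy_exp alpha p) s * s `^ (- 1 - alpha)).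
have lower k : (0 < k)%N -> 2 * lam <= k.+1%:R ->
    ((2 * dim_cst alpha n * h k * Ir + dim_cst alpha n * (bregman_cst p / (2 * lam)) * sigma * Jr)%:E <=
     \int[mu]_x \int[mu]_y (bregman_integrand alpha p v (x, y))%:E)%E.
  move=> k0 lk; have [Zp [Zm [ZpE ZmE ZE]]] := trunc_hardy_diff alpha p1 k0.
  rewrite /h -ZE.
  apply: bregman_lower_bound; [exact: a02|exact: p1|exact: ht|exact: mv|exact: v0|exact: l2
    |exact: lk|exact: e0|exact: lexx|exact: sigma0|exact: Hdepth|exact: sigmaE
    |exact: ZpE|exact: ZmE|exact: IrE|exact: JrE].
rewrite IrE JrE.
move: lower E0; case: (\int[mu]_x _)%E => [e lower _|_ _|//]; last by rewrite leey.
rewrite -!EFinM -EFinD lee_fin hardy_constE//.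
have cvgh : 2 * dim_cst alpha n * h k * Ir +
    dim_cst alpha n * (bregman_cst p / (2 * lam)) * sigma * Jr @[k --> \oo] -->
    2 * dim_cst alpha n * - hardy_bracket alpha p * Ir +
    dim_cst alpha n * (bregman_cst p / (2 * lam)) * sigma * Jr.
  apply: cvgD; last exact: cvg_cst.
  apply: cvgM; last exact: cvg_cst.
  apply: cvgM; first exact: cvg_cst.
  exact: hardy_bracket_cvg.
rewrite -(cvg_lim _ cvgh)//.
apply: limr_le; first by apply/cvg_ex; eexists; exact: cvgh.
near=> k; rewrite -lee_fin; apply: lower; near: k; first exact: nbhs_infty_gt.
apply: filterS (nbhs_infty_ger (2 * lam)) => k /= lk.
by apply: le_trans lk _; rewrite ler_nat.
Unshelve. all: by end_near.
Qed.

End hardy_inequality.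

(** * Test functions extended by zero *)

Section zero_extension.
Context {R : realType}.
Variables (n : nat) (alpha p : R).
Hypotheses (a02 : 0 < alpha < 2) (p1 : 1 < p).
Local Notation mu := (lebesgue_rV n.+2).
Local Notation Om := (@halfspace R n.+1).
Variable u : 'rV[R]_n.+2 -> R.
Hypotheses (u1 : 1 <= alpha -> Cc Om u) (u2 : alpha < 1 -> Cc (closure Om) u).

Lemma restrict_halfspace_measurable : measurable_fun [set: 'rV[R]_n.+2] (u \_ Om).
Proof.
apply/(measurable_restrictT _ _).1; first exact: measurable_halfspace.
apply: within_continuous_measurable_rV; first exact: open_halfspace.
have [/u2[cu _ _]|/u1[cu _ _]//] := ltP alpha 1.
exact: continuous_subspaceW (@subset_closure _ Om) cu.
Qed.

Lemma restrict_halfspace_gt0 x : (u \_ Om) x != 0 -> 0 < last_coord x.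
Proof. by rewrite patchE; case: ifPn => [/set_mem//|_]; rewrite eqxx. Qed.

(** The two classes of test functions matter here: for [alpha < 1] the weight [x_d^(-alpha)] is
    itself integrable at the boundary, while for [alpha >= 1] it is bounded on the support, which
    stays away from the boundary, and [dominated_integral_fin] is used with exponent 0. *)
Lemma restrict_halfspace_fin :
  (\int[mu]_x (`|(u \_ Om) x| `^ p * last_coord x `^ (- alpha))%:E < +oo)%E.
Proof.
have p0 : 0 < p by exact: lt_trans p1.
have a0 : 0 < alpha by case/andP: a02.
have mf : measurable_fun [set: 'rV[R]_n.+2]
    (fun x => `|(u \_ Om) x| `^ p * last_coord x `^ (- alpha)).
  apply: measurable_funM; apply: (measurableT_comp (measurable_powR _)).
    by apply: measurableT_comp => //; exact: restrict_halfspace_measurable.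
  exact: measurable_rV_coord.
have f0 x : 0 <= `|(u \_ Om) x| `^ p * last_coord x `^ (- alpha).
  by rewrite mulr_ge0 ?powR_ge0.
have supp x : `|(u \_ Om) x| `^ p * last_coord x `^ (- alpha) != 0 ->
    [/\ Om x, u x != 0 & (u \_ Om) x = u x].
  rewrite patchE; case: ifPn => [/set_mem Ox|_].
    split=> //; apply: contraNN H => /eqP ->.
    by rewrite normr0 powR0 ?mul0r// gt_eqF.
  by rewrite normr0 powR0 ?mul0r ?eqxx// gt_eqF.
have [a1|a1] := ltP alpha 1.
  have [M M0 HM] := Cc_bounded (u2 a1).
  have [B B0 HB] := Cc_coord_bounded (u2 a1).
  apply: (dominated_integral_fin mf f0 (powR_ge0 M p) B0 a1) => x /supp[Ox ux ->].
  have Cx := @subset_closure _ Om _ Ox.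
  split=> //; first exact: HB.
  apply: ler_wpM2r; first exact: powR_ge0.
  by apply: ge0_ler_powR; rewrite ?nnegrE ?(ltW p0)//; exact: HM.
have [M M0 HM] := Cc_bounded (u1 a1).
have [B B0 HB] := Cc_coord_bounded (u1 a1).
have [m m0 Hm] := Cc_halfspace_away (u1 a1).
have MM : 0 <= M `^ p * m `^ (- alpha) by rewrite mulr_ge0 ?powR_ge0.
apply: (dominated_integral_fin mf f0 MM B0 ltr01) => x /supp[Ox ux ->].
split=> //; first exact: HB.
rewrite oppr0 powRr0 mulr1; apply: ler_pM; rewrite ?powR_ge0//.
  by apply: ge0_ler_powR; rewrite ?nnegrE ?(ltW p0)//; exact: HM.
by apply: powR_anti; rewrite ?(ltW a0)//; exact: Hm.
Qed.

Lemma enorm_powR (x y : 'rV[R]_n.+2) :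
  (enorm (x - y) `^ (n.+2%:R + alpha))^-1 = sqdist x y `^ (- kernel_exp alpha n).
Proof.
have -> : enorm (x - y) = Num.sqrt (sqdist x y).
  by congr Num.sqrt; apply: eq_bigr => i _; rewrite !mxE.
rewrite powRN -powR12_sqrt ?sqdist_ge0// -powRrM; congr ((_ `^ _)^-1).
by rewrite /kernel_exp mulrC.
Qed.

Lemma bregman_restrict_halfspace :
  (\int[mu]_(x in Om) \int[mu]_(y in Om)
     ((u x - u y) * (spow (u x) (p - 1) - spow (u y) (p - 1))
      / enorm (x - y) `^ (n.+2%:R + alpha))%:E =
   \int[mu]_x \int[mu]_y (bregman_integrand alpha p (u \_ Om) (x, y))%:E)%E.
Proof.
rewrite integral_mkcond; apply: eq_integral => x _; rewrite patchE.
case: ifPn => Ox; last first.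
  apply/esym/integral0_eq => y _.
  by rewrite /bregman_integrand/= indicE (negbTE Ox) !mul0r.
rewrite integral_mkcond; apply: eq_integral => y _; rewrite patchE.
case: ifPn => Oy; last by rewrite /bregman_integrand/= !indicE (negbTE Oy) mulr0 !mul0r.
by rewrite /bregman_integrand/= !indicE !patchE Ox Oy !mul1r enorm_powR.
Qed.

Lemma hardy_restrict_halfspace (w w' : 'rV[R]_n.+2 -> R) :
  (forall x, Om x -> w x = w' x) ->
  (\int[mu]_(x in Om) (`|u x| `^ p * w x)%:E =
   \int[mu]_x (`|(u \_ Om) x| `^ p * w' x)%:E)%E.
Proof.
move=> ww; rewrite integral_mkcond; apply: eq_integral => x _; rewrite !patchE.
case: ifPn => [/set_mem/ww ->//|_].
by rewrite normr0 powR0 ?mul0r// gt_eqF// (lt_trans _ p1).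
Qed.

End zero_extension.

Unset Implicit Arguments.

(* MathComp-Analysis; the dimension is d = n.+2, x_d = x ord0 ord_max and
   x_(d-1) = x ord0 (inord n). *)
Theorem theorem2 (R : realType) (n : nat) (alpha p tau : R)
    (halpha : 0 < alpha < 2) (hp : 1 < p) (htau : 0 < tau < 1 + alpha) :
  exists C : R, 0 < C /\
  forall u : 'rV[R]_n.+2 -> R,
    (1 <= alpha -> Cc (@halfspace R n.+1) u) ->
    (alpha < 1 -> Cc (closure (@halfspace R n.+1)) u) ->
    (\int[lebesgue_rV n.+2]_(x in @halfspace R n.+1)
       \int[lebesgue_rV n.+2]_(y in @halfspace R n.+1)
         ((u x - u y) * (spow (u x) (p - 1) - spow (u y) (p - 1))
          / enorm (x - y) `^ (n.+2%:R + alpha))%:E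
     >=
     (hardy_const n.+2 alpha p)%:E *
       \int[lebesgue_rV n.+2]_(x in @halfspace R n.+1)
         (`|u x| `^ p / (x ord0 ord_max) `^ alpha)%:E
     + C%:E *
       \int[lebesgue_rV n.+2]_(x in @halfspace R n.+1)
         (`|u x| `^ p /
          ((x ord0 ord_max) `^ (alpha - tau) *
           ((x ord0 (inord n)) ^+ 2 + (x ord0 ord_max) ^+ 2) `^ (tau / 2)))%:E)%E.
Proof.
have [C C0 H] := bregman_hardy n halpha hp htau.
exists C; split=> // u u1 u2.
rewrite bregman_restrict_halfspace.
rewrite (hardy_restrict_halfspace hp u (w' := fun x => last_coord x `^ (- alpha))); last first.
  by move=> x _; rewrite powRN.
rewrite (hardy_restrict_halfspace hp u
  (w' := fun x => last_coord x `^ (- alpha) * depth_coord tau x)); last first.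
  (* The remainder weight is the Hardy weight times the depth; merging the powers of [x_d] uses
     [x_d > 0]. *)
  move=> x Ox; rewrite invfM -powRN /depth_coord /depth mulrA -gt0_powRD//.
  by congr (_ `^ _ * _); ring.
under [in X in (_ + _ * X <= _)%E]eq_integral do rewrite mulrA.
apply: H; first exact: (restrict_halfspace_measurable u1 u2).
  exact: restrict_halfspace_gt0.
exact: (restrict_halfspace_fin halpha hp u1 u2).
Qed.
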